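(* Fix an integer $p\ge3$ and suppose $(\beta,h)\in\Theta=[0,\infty)\times\mathbb{R}$ is $p$-critical. Assume $h$ is known, $\boldsymbol\sigma\sim\mathbb{P}_{\beta,h,p}$, and let $\hat\beta_N$ be the maximum likelihood estimate of $\beta$. Denote the $K\in\{2,3\}$ global maximizers of $H=H_{\beta,h,p}$ by $m_1<\dots<m_K$, and for $1\le k\le K$ let $$p_k=\frac{[(m_k^2-1)H''(m_k)]^{-1/2}}{\sum_{i=1}^K[(m_i^2-1)H''(m_i)]^{-1/2}}.$$ (1) Suppose $p\ge3$ is odd. Then $H$ has exactly two global maximizers $m_1<m_2$ and, as $N\to\infty$: - If $(\beta,h)\ne(\tilde\beta_p,0)$, then $$N^{1/2}(\hat\beta_N-\beta)\xrightarrow{D}\tfrac{p_1}{2}N^-\left(0,-\tfrac{H''(m_1)}{p^2m_1^{2p-2}}\right)+\tfrac{1-p_1}{2}N^+\left(0,-\tfrac{H''(m_2)}{p^2m_2^{2p-2}}\right)+\tfrac12\delta_0.$$ - If $(\beta,h)=(\tilde\beta_p,0)$, then $$N^{1/2}(\hat\beta_N-\beta)\xrightarrow{D}\tfrac{p_1}{2}\delta_{-\infty}+\tfrac{1-p_1}{2}N^+\left(0,-\tfrac{H''(m_2)}{p^2m_2^{2p-2}}\right)+\tfrac12\delta_0.$$ (2) Suppose $p\ge4$ is even. Then, as $N\to\infty$: - If $h>0$, then $$N^{1/2}(\hat\beta_N-\beta)\xrightarrow{D}\tfrac{p_1}{2}N^-\left(0,-\tfrac{H''(m_1)}{p^2m_1^{2p-2}}\right)+\tfrac{1-p_1}{2}N^+\left(0,-\tfrac{H''(m_2)}{p^2m_2^{2p-2}}\right)+\tfrac12\delta_0.$$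 - If $h<0$, then $$N^{1/2}(\hat\beta_N-\beta)\xrightarrow{D}\tfrac{p_1}{2}N^+\left(0,-\tfrac{H''(m_1)}{p^2m_1^{2p-2}}\right)+\tfrac{1-p_1}{2}N^-\left(0,-\tfrac{H''(m_2)}{p^2m_2^{2p-2}}\right)+\tfrac12\delta_0.$$ - If $h=0$ and $\beta>\tilde\beta_p$, there are exactly two global maximizers $m_1=-m_*$ and $m_2=m_*$ of $H$, where $m_*=m_*(\beta,h,p)>0$, and $$N^{1/2}(\hat\beta_N-\beta)\xrightarrow{D}N\left(0,-\tfrac{H''(m_* )}{p^2m_*^{2p-2}}\right).$$ - If $h=0$ and $\beta=\tilde\beta_p$, there are exactly three global maximizers $m_1=-m_*$, $m_2=0$, $m_3=m_*$ of $H$, where $m_*=m_*(\beta,h,p)>0$, and $$N^{1/2}(\hat\beta_N-\beta)\xrightarrow{D}p_2\gamma_p\delta_{-\infty}+p_1N^+\left(0,-\tfrac{H''(m_* )}{p^2m_*^{2p-2}}\right)+(1-p_1-p_2\gamma_p)\delta_0,$$ where $\gamma_p=\mathbb{P}(Z^p\le\mathbb{E}Z^p)$ with $Z\sim N(0,1)$.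
   Context: The $p$-spin Curie-Weiss model is the probability measure on $\{-1,1\}^N$ given by $\mathbb{P}_{\beta,h,p}(\boldsymbol\sigma)=\frac{1}{2^NZ_N(\beta,h,p)}\exp\{N(\beta\overline\sigma_N^p+h\overline\sigma_N)\}$, where $\overline\sigma_N=\frac1N\sum_{i=1}^N\sigma_i$ and $Z_N$ is the normalizing constant; expectation is $\mathbb{E}_{\beta,h,p}$. The same formula defines the measure for every real $\beta$. For fixed known $h$, the maximum likelihood estimate $\hat\beta_N\in[-\infty,\infty]$ is the maximizer of the likelihood over all real $\beta$, i.e. the solution in $\beta\in\mathbb{R}$ of $\mathbb{E}_{\beta,h,p}(\overline\sigma_N^p)=\overline\sigma_N^p$; if no real solution exists, it equals $+\infty$ or $-\infty$ according to whether the likelihood is increasing or decreasing in $\beta$. Define $H_{\beta,h,p}:[-1,1]\to\mathbb{R}$ by $H_{\beta,h,p}(x)=\beta x^p+hx-I(x)$, $I(x)=\frac12\{(1+x)\log(1+x)+(1-x)\log(1-x)\}$. The point $(\beta,h)$ is $p$-critical if $H_{\beta,h,p}$ has more than one global maximizer (it is known that there are then 2 or 3 of them, all in $(-1,1)$; exactly 2 unless $p$ is even and $(\beta,h)=(\tilde\beta_p,0)$). Define $\tilde\beta_p=\sup\{\beta\ge0:\sup_{x\in[-1,1]}H_{\beta,0,p}(x)=0\}$. For $\sigma>0$, $N^+(0,\sigma^2)$ and $N^-(0,\sigma^2)$ denote the laws of $|Z|$ and $-|Z|$, respectively, where $Z\sim N(0,\sigma^2)$. $\delta_x$ is the point mass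 at $x\in[-\infty,\infty]$. Weighted sums of distributions denote mixtures; convergence in distribution to a law with mass at $-\infty$ is understood on the extended real line $[-\infty,\infty]$. *)

(* Defs.v *)
From HB Require Import structures.
From mathcomp Require Import all_boot all_order all_algebra.
From mathcomp Require Import all_classical all_reals all_analysis.
From mathcomp Require Import measurable_realfun.

Set Implicit Arguments.
Unset Strict Implicit.
Unset Printing Implicit Defensive.

Import Order.TTheory GRing.Theory Num.Theory.
Import numFieldNormedType.Exports.

Local Open Scope classical_set_scope.
Local Open Scope ring_scope.

Section CurieWeiss.
Context {R : realType}.
Implicit Types (beta h : R) (p N : nat).

(* A configuration in {-1,1}^N is encoded by booleans: the spin at site i is
   (-1) ^+ sigma i. *)
Definition config N := {ffun 'I_N -> bool}.

Definition mag N (sigma : config N) : R :=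
  (\sum_(i < N) (-1) ^+ (sigma i)) / N%:R.

Definition gibbs_weight beta h p N (sigma : config N) : R :=
  expR (N%:R * (beta * mag sigma ^+ p + h * mag sigma)).

Definition partition_fun beta h p N : R :=
  (2 ^+ N)^-1 * \sum_(sigma : config N) gibbs_weight beta h p sigma.

Definition cw_prob beta h p N (sigma : config N) : R :=
  (2 ^+ N * partition_fun beta h p N)^-1 * gibbs_weight beta h p sigma.

Definition likelihood h p N (sigma : config N) : R -> R :=
  fun b => cw_prob b h p sigma.

Definition is_real_mle h p N (sigma : config N) (b : R) : Prop :=
  forall c : R, likelihood h p sigma c <= likelihood h p sigma b.

(* For p >= 1 and N >= 2 exactly one b satisfies this. For N = 0, and for N = 1
   with p even, the likelihood is constant, so every real b does. *)
Definition is_mle h p N (sigma : config N) (b : \bar R) : Prop :=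
  match b with
  | EFin r => is_real_mle h p sigma r
  | +oo%E => ~ (exists r, is_real_mle h p sigma r) /\
             (forall b1 b2 : R, b1 < b2 ->
               likelihood h p sigma b1 < likelihood h p sigma b2)
  | -oo%E => ~ (exists r, is_real_mle h p sigma r) /\
             (forall b1 b2 : R, b1 < b2 ->
               likelihood h p sigma b2 < likelihood h p sigma b1)
  end.

(* Since ln 0 = 0 in the library, this is also the usual value at x = 1, -1. *)
Definition entropyI (x : R) : R :=
  2^-1 * ((1 + x) * ln (1 + x) + (1 - x) * ln (1 - x)).

Definition H beta h p (x : R) : R := beta * x ^+ p + h * x - entropyI x.

Definition is_global_max beta h p (m : R) : Prop :=
  m \in `[-1, 1] /\ forall x : R, x \in `[-1, 1] -> H beta h p x <= H beta h p m.

Definition p_critical beta h p : Prop :=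
  exists m m' : R,
    [/\ m != m', is_global_max beta h p m & is_global_max beta h p m'].

Definition beta_tilde p : R :=
  sup [set b : R | 0 <= b /\ sup [set H b 0 p x | x in `[-1, 1]] = 0].

Definition H2 beta h p (m : R) : R := derive1n 2 (H beta h p) m.

Definition curv beta h p (m : R) : R :=
  (Num.sqrt ((m ^+ 2 - 1) * H2 beta h p m))^-1.

(* The weight p_k of m_k = mk, where ms lists all the global maximizers. *)
Definition max_weight beta h p (ms : seq R) (mk : R) : R :=
  curv beta h p mk / \sum_(m <- ms) curv beta h p m.

Definition asym_var beta h p (m : R) : R :=
  - (H2 beta h p m / (p%:R ^+ 2 * m ^+ (2 * p - 2))).

(* Laws on the extended real line. The second parameter of normal_prob is the
   standard deviation, whereas v is a variance. *)
Definition gauss (v : R) : set (\bar R) -> \bar R :=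
  pushforward (normal_prob 0 (Num.sqrt v)) (fun z : R => (z%:E : \bar R)).

Definition gauss_plus (v : R) : set (\bar R) -> \bar R :=
  pushforward (normal_prob 0 (Num.sqrt v)) (fun z : R => (`|z|%:E : \bar R)).

Definition gauss_minus (v : R) : set (\bar R) -> \bar R :=
  pushforward (normal_prob 0 (Num.sqrt v)) (fun z : R => ((- `|z|)%:E : \bar R)).

Definition mixture (ws : seq (R * (set (\bar R) -> \bar R))) :
    set (\bar R) -> \bar R :=
  fun A => (\sum_(w <- ws) w.1%:E * w.2 A)%E.

Definition gamma_ p : R :=
  fine (normal_prob 0 1
    [set z : R | ((z ^+ p)%:E <= 'E_(normal_prob 0 1)[fun z : R => (z ^+ p)%R])%E]).

(* Weak convergence on the topological space [-oo, +oo] of the laws of T N,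
   where the configuration has probability mass function P N. *)
Definition cvg_in_law (P : forall N, config N -> R)
    (T : forall N, config N -> \bar R) (mu : set (\bar R) -> \bar R) : Prop :=
  forall f : \bar R -> R, continuous f -> (exists M : R, forall x, `|f x| <= M) ->
    (\sum_(sigma : config N) P N sigma * f (T N sigma))%:E @[N --> \oo] -->
      (\int[mu]_x (f x)%:E)%E.

Definition scaled_error beta (bhat : forall N, config N -> \bar R)
    N (sigma : config N) : \bar R :=
  ((Num.sqrt N%:R)%:E * (bhat N sigma - beta%:E))%E.

End CurieWeiss.

(* Main.v *)
(* The derivative of the log-likelihood in [b] is [N] times the difference
   between [mag sigma ^+ p] and its mean under [cw_prob b h p], and this mean is
   strictly increasing in [b].  Hence [t < sqrt N * (bhat - beta)] if and only
   if [mag sigma ^+ p] exceeds its mean at [beta + t / sqrt N].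

   The law of the magnetization at [beta] concentrates on the global maximizers
   [m] of [H], with the weights of the theorem, and has Gaussian fluctuations of
   variance [- 1 / H''(m)] around each of them; this is Stirling's formula and
   Laplace's method.  Passing from [beta] to [beta + t / sqrt N] multiplies the
   density by [exp (t * sqrt N * x ^ p)], which singles out the maximizers with
   the largest value of [m ^ p] if [t > 0] and the smallest if [t < 0].  The
   mean is therefore [m ^ p + t v / sqrt N] to first order, where [m] is such a
   maximizer and [v] the variance of the fluctuations of [x ^ p].  Comparing
   [mag sigma ^+ p] with it around every maximizer gives the limit of the
   probability of [t < sqrt N * (bhat - beta)]: the other maximizers contribute
   [0] or their whole weight.  If the selected maximizer is [0] (so [t < 0]),
   then [x ^ p] fluctuates on the scale [N ^ (- p / 2)] instead and the limit is
   the same for all [t < 0], which produces the mass at [-oo].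

   Convergence of the tails for [t != 0] implies convergence in law, because a
   continuous function on [[-oo, +oo]] is a uniform limit of step functions with
   jumps away from [0]. *)
Require Import Defs.
From HB Require Import structures.
From mathcomp Require Import all_boot all_order all_algebra.
From mathcomp Require Import all_classical all_reals all_analysis.
From mathcomp Require Import measurable_realfun.
From mathcomp Require Import ring lra zify.

Set Implicit Arguments.
Unset Strict Implicit.
Unset Printing Implicit Defensive.

Import Order.TTheory GRing.Theory Num.Theory.
Import numFieldNormedType.Exports.

Local Open Scope classical_set_scope.
Local Open Scope ring_scope.

(** * Riemann sums over the lattice of spins *)

Section riemann_sum.
Context {R : realType}.
Implicit Types (m c C y : R) (f : nat -> nat -> R) (N k : nat).
Local Notation mu := (@lebesgue_measure R).

(** The mean of [x ^ p] at the shifted parameter is needed up to [o(1 / sqrt N)] (at the origin up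
    to [o(N ^ (- p / 2))]) while several maximizers compete. Everything is therefore reduced to
    limits of one kind of sum, [Wsum], whose test function may depend on [N]. A sum over the lattice
    of magnetizations is the integral of a step function of [y = sqrt N * (x - m)], and dominated
    convergence asks only for a Gaussian bound and for the limit of the summand along sequences
    [x_ N] with [sqrt N * (x_ N - m)] tending to [y], for almost every [y]; indicators of moving
    half-lines are thus allowed. The bound comes from attributing each lattice point to its nearest
    maximizer, where [H] is dominated by a parabola. This requires [H'' < 0] at every maximizer,
    which is obtained by counting zeros of [H''] with Rolle's theorem. *)

Definition spin N k : R := 1 - 2 * k%:R / N%:R.

Definition spin_dev m N k : R := Num.sqrt N%:R * (spin N k - m).

(** For [N > 0] the values of [spin_dev] decrease in [k] with spacing [2 / sqrt N], so the cells of
    consecutive [k] are adjacent and disjoint. *)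
Definition spin_cell m N k : set R :=
  `](spin_dev m N k - 2 / Num.sqrt N%:R), (spin_dev m N k)]%classic.

Definition step_fun m f N y : R :=
  \sum_(k < N.+1) f N k * \1_(spin_cell m N k) y.

Lemma integral_step_fun m f N :
  (\int[mu]_y (step_fun m f N y)%:E)%E =
  ((2 / Num.sqrt N%:R) * \sum_(k < N.+1) f N k)%:E.
Proof.
under eq_integral do rewrite /step_fun -sumEFin.
have mc k : measurable (spin_cell m N k) by exact: measurable_itv.
have muc k : mu (spin_cell m N k) = (2 / Num.sqrt N%:R)%:E.
  rewrite /spin_cell lebesgue_measure_itv /= lte_fin.
  (* The cell is empty only for [N = 0], where [2 / sqrt 0 = 0] because the inverse of [0] is
     [0]. *)
  case: ifPn => [_|]; first by rewrite -EFinB; congr EFin; lra.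
  rewrite -leNgt => h.
  have : 0 <= 2 / Num.sqrt N%:R :> R by rewrite divr_ge0 ?sqrtr_ge0.
  by move=> h'; congr EFin; lra.
have ifi k : mu.-integrable [set: R] (fun y => (\1_(spin_cell m N k) y)%:E).
  apply/integrableP; split.
    by apply/measurable_EFinP; apply: measurable_indic; exact: mc.
  under eq_integral do rewrite gee0_abs ?lee_fin//.
  by rewrite (@integral_indic _ _ _ mu setT measurableT _ (mc k)) setIT [X in (X < _)%E]muc ltry.
rewrite integral_sum //=; last first.
  move=> k; under eq_fun do rewrite EFinM; exact: integrableZl.
rewrite mulr_sumr -sumEFin; apply: eq_bigr => k _.
under eq_integral do rewrite EFinM.
by rewrite integralZl// (@integral_indic _ _ _ mu setT measurableT _ (mc k)) setIT [X in (_ * X)%E]muc -EFinM mulrC.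
Qed.

Lemma measurable_step_fun m f N : measurable_fun [set: R] (step_fun m f N).
Proof.
apply: measurable_sum => k; apply: measurable_funM => //.
by apply: measurable_indic; exact: measurable_itv.
Qed.

(** In this form membership says that [k] is the truncation of a real number, so that [y] lies in at
    most one cell. *)
Lemma spin_cellP m N k y : (0 < N)%N ->
  (y \in spin_cell m N k) =
  (k%:R <= N%:R * (1 - m - y / Num.sqrt N%:R) / 2 < k.+1%:R).
Proof.
move=> N0; have n0 : 0 < N%:R :> R by rewrite ltr0n.
have r0 : 0 < Num.sqrt N%:R :> R by rewrite sqrtr_gt0.
have rr : N%:R = Num.sqrt N%:R * Num.sqrt N%:R :> R by rewrite -expr2 sqr_sqrtr// ltW.
rewrite /spin_cell mem_setE in_itv /= /spin_dev /spin andbC.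
set r := Num.sqrt _ in r0 rr *; rewrite rr.
have -> : r * (1 - 2 * k%:R / (r * r) - m) = r - m * r - 2 * k%:R / r.
  by field; rewrite gt_eqF.
have -> : r * r * (1 - m - y / r) / 2 = (r - m * r - y) * r / 2.
  by field; rewrite gt_eqF.
rewrite -[k.+1]addn1 natrD.
set K := k%:R.
congr (_ && _).
  rewrite lerBrDr -lerBrDl ler_pdivrMr//.
  apply/idP/idP; lra.
have -> : r - m * r - 2 * K / r - 2 / r = r - m * r - (2 * K + 2) / r.
  by field; rewrite gt_eqF.
rewrite ltrBlDr -ltrBlDl ltr_pdivlMr//; apply/idP/idP; lra.
Qed.

Lemma step_fun_eq m f N y (z := N%:R * (1 - m - y / Num.sqrt N%:R) / 2) :
  (0 < N)%N -> 0 <= z -> (Num.truncn z <= N)%N ->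
  step_fun m f N y = f N (Num.truncn z) /\
  y \in spin_cell m N (Num.truncn z).
Proof.
move=> N0 z0 zN.
have zin : y \in spin_cell m N (Num.truncn z).
  by rewrite spin_cellP// -/z truncn_itv.
split => //; rewrite /step_fun.
have zN' : (Num.truncn z < N.+1)%N by [].
rewrite (bigD1 (Ordinal zN'))//= indicE zin mulr1 big1 ?addr0// => k kz.
rewrite indicE; case: (boolP (y \in _)) => [|_]; last by rewrite mulr0.
rewrite spin_cellP// -/z => /truncn_def zk.
by exfalso; move/eqP: kz; apply; apply/val_inj.
Qed.

Lemma step_fun_le m f N y B : 0 <= B -> (0 < N)%N ->
  (forall k, (k <= N)%N -> y \in spin_cell m N k -> `|f N k| <= B) ->
  `|step_fun m f N y| <= B.
Proof.
move=> B0 N0 fB; rewrite /step_fun.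
have [/existsP[k yk]|/existsPn h] :=
  boolP [exists k : 'I_N.+1, y \in spin_cell m N k]; last first.
  by rewrite big1 ?normr0// => k _; rewrite indicE (negbTE (h k)) mulr0.
rewrite (bigD1 k)//= indicE yk mulr1 big1 ?addr0.
  by apply: fB => //; rewrite -ltnS.
move=> j jk; rewrite indicE; case: (boolP (y \in _)) => [|_]; last by rewrite mulr0.
rewrite spin_cellP// => /truncn_def zj.
move: yk; rewrite spin_cellP// => /truncn_def; rewrite zj => /val_inj jk'.
by rewrite jk' eqxx in jk.
Qed.

Lemma cvg_sqrt_nat_inv : (2 / Num.sqrt N%:R : R) @[N --> \oo] --> (0 : R).
Proof.
apply/cvgrPdist_le => e e0; near=> N.
have N0 : 0 < N%:R :> R by rewrite ltr0n; near: N; exact: nbhs_infty_gt.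
rewrite sub0r normrN ger0_norm ?divr_ge0 ?sqrtr_ge0//.
rewrite ler_pdivrMr ?sqrtr_gt0// -ler_pdivrMl//.
rewrite -[leLHS]ger0_norm -?sqrtr_sqr; last by rewrite mulr_ge0// invr_ge0 ltW.
rewrite ler_wsqrtr//; near: N; exact: nbhs_infty_ger.
Unshelve. all: by end_near. Qed.

Lemma near_infty_succ (P : nat -> Prop) :
  (\forall n \near \oo, P n) -> \forall n \near \oo, P n.+1.
Proof. by move=> [M _ h]; exists M => // n /= Mn; apply: h => /=; exact: leqW. Qed.

(** Dominated convergence for [step_fun]. The step function at [y] is [f N (k_ N)] for the index
    [k_ N] of the cell of [y], and [spin_dev m N (k_ N)] tends to [y]. The integrability of [Phi] is
    a by-product that later supplies the integrability of the limits. *)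
Lemma cvg_riemann_sum m c C f (Phi : R -> R) : -1 < m < 1 -> 0 < c -> 0 <= C ->
  (forall N k, (0 < N)%N -> (k <= N)%N ->
     `|f N k| <= C * expR (- c * spin_dev m N k ^+ 2)) ->
  measurable_fun [set: R] Phi ->
  {ae mu, forall y, forall k_ : nat -> nat,
     (\forall N \near \oo, (k_ N <= N)%N) ->
     spin_dev m N (k_ N) @[N --> \oo] --> y ->
     f N (k_ N) @[N --> \oo] --> Phi y} ->
  mu.-integrable [set: R] (fun y => (Phi y)%:E) /\
  ((2 / Num.sqrt N%:R) * \sum_(k < N.+1) f N k)%:E @[N --> \oo] -->
    (\int[mu]_y (Phi y)%:E)%E.
Proof.
move=> /andP[m1 m1'] c0 C0 fC mPhi fPhi.
(* The dominating function is [C * exp (4 * c) * exp (- c / 2 * y ^ 2)], written as a multiple of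
   the normal density of variance [1 / c] so that its integrability is known. *)
pose s : R := (Num.sqrt c)^-1.
have s0 : s != 0 by rewrite invr_eq0 gt_eqF// sqrtr_gt0.
have s2 : (s ^+ 2 *+ 2)^-1 = c / 2.
  by rewrite -mulr_natr invfM /s exprVn invrK sqr_sqrtr// ltW.
pose D := C * expR (4 * c) / normal_peak s.
pose g y := D * normal_pdf 0 s y.
have gE y : g y = C * expR (4 * c) * expR (- (c / 2) * y ^+ 2).
  rewrite /g /D normal_pdfE// mulrA divfK ?gt_eqF ?normal_peak_gt0//.
  by rewrite /normal_fun subr0 s2 mulNr mulNr [y ^+ 2 * _]mulrC.
have ig : mu.-integrable [set: R] (fun y => (g y)%:E).
  by under eq_fun do rewrite EFinM; apply: integrableZl => //; exact: integrable_normal_pdf.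
have fg N y : (0 < N)%N -> `|step_fun m f N y| <= g y.
  move=> N0; apply: step_fun_le => //.
    by rewrite gE !mulr_ge0 ?expR_ge0.
  move=> k kN; rewrite /spin_cell mem_setE in_itv /= => /andP[yk1 yk2].
  apply: le_trans (fC _ _ N0 kN) _.
  rewrite gE -mulrA ler_wpM2l// -expRD ler_expR.
  set z := spin_dev m N k in yk1 yk2 *.
  have h2 : 2 / Num.sqrt N%:R <= 2 :> R.
    rewrite ler_pdivrMr ?sqrtr_gt0 ?ltr0n// ler_peMr//.
    by rewrite -[leLHS]sqrtr1 ler_wsqrtr// ler1n.
  (* The point [y] is within distance [2] of the right end [z] of its cell; passing from [z] to [y]
     halves the rate and costs the factor [exp (4 * c)]. *)
  have : y ^+ 2 <= 2 * z ^+ 2 + 8.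
    pose d := z - y; have d0 : 0 <= d by rewrite /d; lra.
    have d2 : d <= 2 by rewrite /d; lra.
    have -> : y = z - d by rewrite /d; lra.
    by have := sqr_ge0 (z + d); nra.
  nra.
(* The sequence is shifted by one because the bound holds for [N > 0]. *)
have [|||||] := @dominated_convergence _ _ _ mu [set: R] measurableT
  (fun N y => (step_fun m f N.+1 y)%:E) (fun y => (Phi y)%:E)
  (fun y => (g y)%:E).
- by move=> N; apply/measurable_EFinP; exact: measurable_step_fun.
- exact/measurable_EFinP.
- move: fPhi; apply: (@filterS _ _ (ae_filter_ringOfSetsType mu)) => y fy _.
  apply: cvg_EFin; first by near=> N.
  rewrite /comp /=.
  pose z N := N%:R * (1 - m - y / Num.sqrt N%:R) / 2 : R.
  pose k_ N := Num.truncn (z N).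
  have cv : (y / Num.sqrt N%:R : R) @[N --> \oo] --> (0 : R).
    rewrite -(mulr0 (y / 2)); under eq_fun => N.
      rewrite (_ : y / _ = (y / 2) * (2 / Num.sqrt N%:R)); last first.
        by rewrite mulrA divfK.
      over.
    by apply: cvgMr => //; exact: cvg_sqrt_nat_inv.
  have zn : \forall N \near \oo, 0 <= z N /\ z N <= N%:R.
    have d0 : 0 < Num.min (1 - m) (1 + m) by rewrite lt_min; lra.
    move/cvgrPdist_le : cv => /(_ _ d0); apply: filterS => N.
    rewrite sub0r normrN le_min ler_norml => /andP[/andP[h1 h2] h3].
    have h4 : - (y / Num.sqrt N%:R) <= 1 + m.
      by apply: le_trans h3; rewrite -normrN ler_norm.
    have n0 : 0 <= N%:R :> R by [].
    rewrite /z; split; first by rewrite divr_ge0// mulr_ge0//; lra.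
    rewrite ler_pdivrMr// ler_wpM2l//; lra.
  have kN : \forall N \near \oo, (k_ N <= N)%N.
    apply: filterS zn => N [z0 zN].
    by rewrite /k_ -(ler_nat R); apply: le_trans zN; rewrite truncn_le.
  have dk : spin_dev m N (k_ N) @[N --> \oo] --> y.
    have e1 : (fun N => y + 2 / Num.sqrt N%:R : R) @ \oo --> y.
      by rewrite -[X in _ --> X]addr0; apply: cvgD; [exact: cvg_cst|exact: cvg_sqrt_nat_inv].
    apply: (@squeeze_cvgr _ _ _ _ (fun=> y) (fun N => y + 2 / Num.sqrt N%:R)) => //; last exact: cvg_cst.
    near=> N.
    have [//|||_] := @step_fun_eq m f N y.
    + by near: N; exact: nbhs_infty_gt.
    + by rewrite -/(z N); have [] : 0 <= z N /\ z N <= N%:R by near: N.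
    + by rewrite -/(z N) -/(k_ N); near: N.
    + rewrite -/(z N) -/(k_ N) /spin_cell mem_setE in_itv /= => /andP[yk1 yk2].
      by rewrite yk2 /=; lra.
  have zn' := near_infty_succ zn; have kN' := near_infty_succ kN.
  have := fy k_ kN dk.
  rewrite -(cvg_shiftS (fun N => f N (k_ N))).
  apply: cvg_trans; apply: near_eq_cvg; near=> N.
  have [//|||//] := @step_fun_eq m f N.+1 y.
  + rewrite -/(z N.+1); suff [] : 0 <= z N.+1 /\ z N.+1 <= N.+1%:R by [].
    by near: N; exact: zn'.
  + by rewrite -/(z N.+1) -/(k_ N.+1); near: N; exact: kN'.
- exact: ig.
- by apply: aeW => y N _; rewrite lee_fin fg.
move=> iPhi _ h; split => //.
rewrite -cvg_shiftS.
apply: cvg_trans h; apply: near_eq_cvg; near=> N.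
by rewrite /= integral_step_fun.
Unshelve. all: by end_near. Qed.

End riemann_sum.

(** * Stirling's formula *)

Section stirling.
Context {R : realType}.
Implicit Types (x y a b : R) (n N k : nat).

Lemma ge0_derive_le (f df : R -> R) a b : a <= b ->
  (forall x, a <= x <= b -> is_derive x 1 f (df x)) ->
  (forall x, a <= x <= b -> 0 <= df x) -> f a <= f b.
Proof.
move=> ab fd df0.
case: (@MVT_segment R f df a b ab) => [||c cab].
- by move=> x /[!in_itv]/= /andP[ax xb]; apply: fd; rewrite !ltW.
- apply: derivable_within_continuous => x; rewrite in_itv /= => xab.
  by have := fd x xab; case.
- move=> fE; rewrite -subr_ge0 fE mulr_ge0 ?subr_ge0// df0//.
Qed.

(** The difference vanishes at [1] and has derivative [(x - 1) ^ 2 / (x * (x + 1) ^ 2)]. At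
    [y = 1 + 1 / n] this reads [1 <= (n + 1 / 2) * ln (1 + 1 / n)], which makes [lstir]
    nonincreasing. *)
Lemma ln_lower y : 1 <= y -> 2 * (y - 1) / (y + 1) <= ln y.
Proof.
move=> y1.
pose f (z : R) := ln z - 2 + 4 * (z + 1)^-1.
suff : f 1 <= f y.
  rewrite /f ln1 => h.
  have -> : 2 * (y - 1) / (y + 1) = 2 - 4 * (y + 1)^-1.
    by field; rewrite gt_eqF//; lra.
  have e : 4 * (1 + 1)^-1 = 2 :> R by field.
  by rewrite e in h; lra.
apply: (@ge0_derive_le f (fun z => z^-1 - 4 * (z + 1) ^- 2)) => //.
  move=> x /andP[x1 _].
  have x0 : 0 < x by lra.
  have xx0 : x + 1 != 0 by rewrite gt_eqF//; lra.
  have d1 := is_derive1_ln x0.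
  have d2 : is_derive x (1 : R) (fun z => (z + 1)^-1) (- (x + 1) ^- 2 *: 1).
    apply: is_deriveV => //; apply: is_derive_eq; by rewrite addr0.
  apply: is_derive_eq.
  rewrite /GRing.scale /=; ring.
move=> x /andP[x1 _].
have -> : x^-1 - 4 * (x + 1) ^- 2 = (x - 1) ^+ 2 / (x * (x + 1) ^+ 2).
  by field; rewrite !gt_eqF//; lra.
by rewrite divr_ge0 ?sqr_ge0// mulr_ge0 ?sqr_ge0//; lra.
Qed.

(** Here the derivative of the difference is [(1 - 1 / x) ^ 2 / 2]. At [y = 1 + 1 / n] the bound
    makes the decrements of [lstir] at most a quarter of the telescoping [1 / n - 1 / (n + 1)]. *)
Lemma ln_upper y : 1 <= y -> ln y <= (y - y^-1) / 2.
Proof.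
move=> y1.
pose f (z : R) := (z - z^-1) / 2 - ln z.
suff : f 1 <= f y by rewrite /f ln1 invr1; lra.
apply: (@ge0_derive_le f (fun z => (1 + z ^- 2) / 2 - z^-1)) => //.
  move=> x /andP[x1 _].
  have x0 : 0 < x by lra.
  have d1 := is_derive1_ln x0.
  have d2 : is_derive x (1 : R) (fun z => z^-1) (- x ^- 2 *: 1).
    by apply: (@is_deriveV R id) => //; rewrite gt_eqF.
  apply: is_derive_eq.
  rewrite /GRing.scale /=; field.
  by rewrite gt_eqF.
move=> x /andP[x1 _].
have -> : (1 + x ^- 2) / 2 - x^-1 = (1 - x^-1) ^+ 2 / 2.
  by field; rewrite gt_eqF//; lra.
by rewrite divr_ge0 ?sqr_ge0.
Qed.

(* Logarithm of n! e^n / (n^n sqrt n). *)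
Definition lstir n : R := ln n`!%:R - (n%:R + 2^-1) * ln n%:R + n%:R.

Lemma lstirB n : (0 < n)%N ->
  lstir n - lstir n.+1 = (n%:R + 2^-1) * ln (1 + n%:R^-1) - 1.
Proof.
move=> n0; rewrite /lstir factS natrM.
have n1 : 0 < n%:R :> R by rewrite ltr0n.
have -> : 1 + n%:R^-1 = n.+1%:R / n%:R :> R.
  by rewrite -[n.+1]addn1 natrD; field; rewrite gt_eqF.
rewrite lnM ?posrE ?ltr0n ?fact_gt0// ln_div ?posrE ?ltr0n//.
rewrite -[n.+1]addn1 natrD; lra.
Qed.

Lemma lstir_succ n : (0 < n)%N ->
  0 <= lstir n - lstir n.+1 <= n%:R^-1 - n.+1%:R^-1.
Proof.
move=> n0; rewrite lstirB//.
have n1 : 0 < n%:R :> R by rewrite ltr0n.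
have i0 : 0 < n%:R^-1 :> R by rewrite invr_gt0.
have h1 : 1 <= 1 + n%:R^-1 :> R by rewrite lerDl ltW.
apply/andP; split.
  have := ln_lower h1.
  have -> : 2 * (1 + n%:R^-1 - 1) / (1 + n%:R^-1 + 1) = (n%:R + 2^-1)^-1 :> R.
    by field; rewrite !gt_eqF//; nra.
  have h2 : 0 < n%:R + 2^-1 :> R by lra.
  by rewrite -(ler_pM2l h2) divff ?gt_eqF// => ?; lra.
have := ln_upper h1.
have h2 : 0 < n%:R + 2^-1 :> R by lra.
rewrite -(ler_pM2l h2) => h3.
rewrite lerBlDr; apply: le_trans h3 _.
have -> : (n%:R + 2^-1) * ((1 + n%:R^-1 - (1 + n%:R^-1)^-1) / 2) =
   1 + (n%:R^-1 - n.+1%:R^-1) / 4 :> R.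
  by rewrite -[n.+1]addn1 natrD; field; rewrite !gt_eqF//; nra.
have : n.+1%:R^-1 <= n%:R^-1 :> R by rewrite lef_pV2 ?posrE ?ltr0n// ler_nat.
set u := n.+1%:R^-1; set v := n%:R^-1; move=> ?; lra.
Qed.

Lemma lstir_ge0_le1 n : (0 < n)%N -> 0 <= lstir n <= 1.
Proof.
(* Strengthening [0 <= lstir n] to [1 / n <= lstir n] makes the induction work: the decrement is at
   most [1 / n - 1 / (n + 1)]. *)
suff : (0 < n)%N -> lstir n - n%:R^-1 >= 0 /\ lstir n <= 1.
  move=> h n0; have [h1 h2] := h n0; rewrite h2 andbT.
  by apply: le_trans h1 _; rewrite gerBl invr_ge0.
elim: n => // -[_ _|n ih _].
  by rewrite /lstir factS fact0 muln1 ln1 invr1; split; lra.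
have [ih1 ih2] := ih isT.
have /andP[h1 h2] := @lstir_succ n.+1 isT.
set u := n.+1%:R^-1 in ih1 h2 *; set v := n.+2%:R^-1 in h2 *.
by split; lra.
Qed.

Lemma cvg_lstir : exists L : R, lstir n @[n --> \oo] --> L.
Proof.
exists (limn (fun n => lstir n.+1)).
rewrite -(cvg_shiftS lstir) /=.
apply: nonincreasing_is_cvgn.
  apply/nonincreasing_seqP => n.
  by have /andP[] := @lstir_succ n.+1 isT; lra.
by exists 0 => _ [n _ <-]; have /andP[] := @lstir_ge0_le1 n.+1 isT.
Qed.

End stirling.

(** * Binomial weights without their entropic part *)

Section binomial_weight.
Context {R : realType}.
Implicit Types (x m : R) (n N k : nat).

(* The entropic part of the number of configurations is factored out, so that
   what remains is only polynomial in N. *)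
Definition qbin N k : R :=
  'C(N, k)%:R / 2 ^+ N * expR (N%:R * entropyI (spin N k)).

Lemma spin_itv N k : (k <= N)%N -> -1 <= (spin N k : R) <= 1.
Proof.
move=> kN; rewrite /spin; have [->|N0] := posnP N.
  by rewrite invr0 mulr0; lra.
have n0 : 0 < N%:R :> R by rewrite ltr0n.
have h : 0 <= (k%:R / N%:R : R) <= 1.
  by rewrite divr_ge0//= ler_pdivrMr// mul1r ler_nat.
lra.
Qed.

Lemma qbin_ge0 N k : 0 <= qbin N k.
Proof. by rewrite mulr_ge0 ?expR_ge0// divr_ge0// exprn_ge0. Qed.

(** With each factorial expressed through [lstir], the powers combine to [exp (- N * I)], which
    [qbin] cancels, and the square roots leave [sqrt (N / (k * (N - k)))], where
    [4 * k * (N - k) / N ^ 2 = 1 - spin ^ 2]. *)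
Lemma qbinE N k : (0 < k < N)%N -> qbin N k =
  expR (lstir N - lstir k - lstir (N - k)) *
  (2 / (Num.sqrt N%:R * Num.sqrt (1 - spin N k ^+ 2))) :> R.
Proof.
move=> /andP[k0 kN]; rewrite /qbin.
have NkE : (N - k)%:R = N%:R - k%:R :> R by rewrite natrB// ltnW.
have k1 : 0 < k%:R :> R by rewrite ltr0n.
have Nk1 : 0 < N%:R - k%:R :> R by rewrite -NkE ltr0n subn_gt0.
have N1 : 0 < N%:R :> R by rewrite ltr0n (leq_trans _ kN).
have f0 n : 0 < n`!%:R :> R by rewrite ltr0n fact_gt0.
set n : R := N%:R in NkE N1 Nk1 *; set j : R := k%:R in NkE k1 Nk1 *.
have binE : 'C(N, k)%:R = N`!%:R / (k`!%:R * (N - k)`!%:R) :> R.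
  by rewrite -(bin_fact (ltnW kN)) !natrM mulfK// mulf_neq0// gt_eqF.
have -> : 'C(N, k)%:R / 2 ^+ N =
    expR (ln N`!%:R - ln k`!%:R - ln (N - k)`!%:R - n * ln 2) :> R.
  rewrite binE !expRB lnK ?posrE// lnK ?posrE// lnK ?posrE//.
  rewrite mulr_natl expRM_natl lnK ?posrE//.
  by field; rewrite !gt_eqF//= exprn_gt0.
have e1 : 1 + spin N k = 2 * ((n - j) / n) :> R.
  by rewrite /spin; field; rewrite gt_eqF.
have e2 : 1 - spin N k = 2 * (j / n) :> R.
  by rewrite /spin; field; rewrite gt_eqF.
have e3 : 1 - spin N k ^+ 2 = 4 * (j * (n - j)) / n ^+ 2 :> R.
  have -> : 1 - spin N k ^+ 2 = (1 + spin N k) * (1 - spin N k) :> R by ring.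
  by rewrite e1 e2; field; rewrite gt_eqF.
have jn0 : 0 < j * (n - j) by rewrite mulr_gt0.
have -> : 2 / (Num.sqrt n * Num.sqrt (1 - spin N k ^+ 2)) =
    expR (2^-1 * (ln n - ln j - ln (n - j))).
  have s1 : 0 < Num.sqrt n by rewrite sqrtr_gt0.
  have s2 : 0 < Num.sqrt (1 - spin N k ^+ 2) :> R.
    by rewrite sqrtr_gt0 e3 divr_gt0 ?exprn_gt0// mulr_gt0.
  apply: ln_inj; rewrite ?posrE ?expR_gt0 ?divr_gt0 ?mulr_gt0//.
  apply: (@mulIf _ 2) => //; rewrite mulr_natr -lnXn ?divr_gt0 ?mulr_gt0//.
  rewrite expRK mulrAC mulVf// mul1r exprMn exprVn exprMn !sqr_sqrtr; last 2 first.
  - by rewrite ltW// -sqrtr_gt0.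
  - exact: ltW.
  rewrite e3.
  have -> : 2 ^+ 2 / (n * (4 * (j * (n - j)) / n ^+ 2)) = n / j / (n - j).
    by field; rewrite !gt_eqF.
  by rewrite !ln_div ?posrE ?divr_gt0.
rewrite -!expRD; congr expR.
rewrite /entropyI e1 e2 !lnM ?posrE ?divr_gt0 ?invr_gt0// !lnV ?posrE//.
rewrite /lstir NkE -/n -/j.
by field; rewrite gt_eqF.
Qed.

Lemma qbin_le_inner N k : (0 < k < N)%N ->
  qbin N k <= 2 * expR 1 / (Num.sqrt N%:R * Num.sqrt (1 - spin N k ^+ 2)) :> R.
Proof.
move=> kN; rewrite qbinE// mulrA ler_wpM2r ?invr_ge0 ?mulr_ge0 ?sqrtr_ge0//.
rewrite [leRHS]mulrC ler_wpM2r// ler_expR.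
move: kN => /andP[k0 kN].
have /andP[_ h1] := @lstir_ge0_le1 R N (leq_trans k0 (ltnW kN)).
have /andP[h2 _] := @lstir_ge0_le1 R k k0.
have Nk0 : (0 < N - k)%N by rewrite subn_gt0.
have /andP[h3 _] := @lstir_ge0_le1 R (N - k) Nk0.
lra.
Qed.

Lemma qbin0 N : qbin N 0 = 1 :> R.
Proof.
rewrite /qbin bin0 /spin mulr0 mul0r subr0 /entropyI subrr mul0r addr0.
have -> : N%:R * (2^-1 * ((1 + 1) * ln (1 + 1))) = N%:R * ln 2 :> R by field.
by rewrite expRM_natl lnK ?posrE// mul1r mulVf// expf_neq0.
Qed.

Lemma qbinn N : qbin N N = 1 :> R.
Proof.
have [->|N0] := posnP N; first exact: qbin0.
have e : spin N N = -1 :> R.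
  rewrite /spin mulfK ?pnatr_eq0 -?lt0n//; ring.
rewrite /qbin binn e /entropyI subrr mul0r add0r opprK.
have -> : N%:R * (2^-1 * ((1 + 1) * ln (1 + 1))) = N%:R * ln 2 :> R by field.
by rewrite expRM_natl lnK ?posrE// mul1r mulVf// expf_neq0.
Qed.

Lemma qbin_le N k : (k <= N)%N -> qbin N k <= 2 * expR 1 :> R.
Proof.
move=> kN.
have e1 : 1 <= 2 * expR 1 :> R.
  by have := expR_ge1Dx (1 : R); lra.
have [->|k0] := posnP k; first by rewrite qbin0.
move: kN; rewrite leq_eqVlt => /orP[/eqP ->|kN]; first by rewrite qbinn.
apply: le_trans (qbin_le_inner _) _; first by rewrite k0.
rewrite ler_pdivrMr; last first.
  have N0 : (0 < N)%N by rewrite (leq_trans _ kN).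
  have n0 : 0 < N%:R :> R by rewrite ltr0n.
  rewrite mulr_gt0 ?sqrtr_gt0//.
  have : 0 < (k%:R / N%:R : R) < 1.
    by rewrite divr_gt0 ?ltr0n//= ltr_pdivrMr// mul1r ltr_nat.
  by rewrite /spin -mulrA => /andP[h1 h2]; nra.
(* The denominator is at least [1]: its square is [4 * k * (N - k) / N] with [1 <= k <= N - 1]. *)
rewrite ler_peMr ?mulr_ge0 ?expR_ge0//.
rewrite -sqrtrM// -[leLHS]sqrtr1 ler_wsqrtr//.
have n0 : 0 < N%:R :> R by rewrite ltr0n (leq_trans _ kN).
have -> : N%:R * (1 - spin N k ^+ 2) = 4 * (k%:R * (N%:R - k%:R)) / N%:R :> R.
  by rewrite /spin; field; rewrite gt_eqF.
rewrite ler_pdivlMr// mul1r.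
have k1 : 1 <= k%:R :> R by rewrite ler1n.
have k2 : k%:R + 1 <= N%:R :> R by rewrite natr1 ler_nat.
nra.
Qed.

End binomial_weight.

(** * Laplace's method *)

Section laplace.
Context {R : realType}.
Implicit Types (x m a c A B y : R) (n N k : nat).
Local Notation mu := (@lebesgue_measure R).

Lemma cvg_near (u v : nat -> R) (l l' : R) : u N @[N --> \oo] --> l ->
  (\forall N \near \oo, u N = v N) -> l = l' -> v N @[N --> \oo] --> l'.
Proof. by move=> ul uv <-; apply: cvg_trans ul; exact: near_eq_cvg. Qed.

Lemma sqrt_nat_expR_le (e : R) N : 0 < e -> (0 < N)%N ->
  Num.sqrt N%:R * expR (- (e * N%:R)) <= e^-1.
Proof.
move=> e0 N0; have n1 : 1 <= N%:R :> R by rewrite ler1n.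
rewrite expRN ler_pdivrMr ?expR_gt0// -ler_pdivrMl ?invr_gt0// invrK.
apply: (@le_trans _ _ (e * N%:R)); last first.
  by apply: le_trans (expR_ge1Dx _); rewrite lerDr.
rewrite ler_pM2l// -[leRHS]ger0_norm// -sqrtr_sqr ler_wsqrtr//.
by rewrite expr2 ler_peMr.
Qed.

(** This is [1 / sqrt (2 * pi)]. The value is not computed because the constant cancels in every
    quotient of sums. *)
Definition laplace_cst : R := expR (- projT1 (cid (@cvg_lstir R))).

Lemma laplace_cst_gt0 : 0 < laplace_cst. Proof. exact: expR_gt0. Qed.

Lemma spin_sub_sqr m N k : (0 < N)%N ->
  N%:R * (spin N k - m) ^+ 2 = spin_dev m N k ^+ 2.
Proof. by move=> N0; rewrite /spin_dev exprMn sqr_sqrtr. Qed.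

Lemma cvg_seq_sum (T : Type) (F : set_system T) (FF : Filter F) (I : eqType)
    (s : seq I) (u : I -> T -> R) (l : I -> R) :
  (forall i, i \in s -> u i x @[x --> F] --> l i) ->
  (\sum_(i <- s) u i x) @[x --> F] --> \sum_(i <- s) l i.
Proof.
elim: s => [_|a s ih h].
  by rewrite big_nil; under eq_fun do rewrite big_nil; exact: cvg_cst.
rewrite big_cons; under eq_fun do rewrite big_cons.
apply: cvgD; first exact/h/mem_head.
by apply: ih => i si; apply: h; rewrite inE si orbT.
Qed.

Lemma cvg_scaled m y (x_ : nat -> R) :
  (Num.sqrt N%:R * (x_ N - m)) @[N --> \oo] --> y -> x_ N @[N --> \oo] --> m.
Proof.
move=> h.
have h2 : (m + Num.sqrt N%:R * (x_ N - m) * (2 / Num.sqrt N%:R) / 2) @[N --> \oo]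
    --> m + y * 0 / 2.
  by apply: cvgD; [exact: cvg_cst|apply: cvgMl; apply: cvgM => //; exact: cvg_sqrt_nat_inv].
apply: (cvg_near h2); last by rewrite mulr0 mul0r addr0.
near=> N.
have N0 : 0 < Num.sqrt N%:R :> R.
  by rewrite sqrtr_gt0 ltr0n; near: N; exact: nbhs_infty_gt.
by field; rewrite gt_eqF.
Unshelve. all: by end_near. Qed.

Lemma cvg_spin m y (k_ : nat -> nat) :
  spin_dev m N (k_ N) @[N --> \oo] --> y ->
  (spin N (k_ N) : R) @[N --> \oo] --> m.
Proof. exact: cvg_scaled. Qed.

Lemma cvg_nat_infty (k_ : nat -> nat) (l : R) : 0 < l ->
  ((k_ N)%:R / N%:R : R) @[N --> \oo] --> l -> k_ N @[N --> \oo] --> \oo.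
Proof.
move=> l0 h; apply/cvgnyPge => M; near=> N.
have N0 : 0 < N%:R :> R by rewrite ltr0n; near: N; exact: nbhs_infty_gt.
have h1 : l / 2 <= (k_ N)%:R / N%:R.
  near: N; move/cvgrPdist_le : h => /(_ (l / 2)); rewrite divr_gt0// => /(_ isT).
  apply: filterS => N; rewrite ler_norml => /andP[_]; lra.
rewrite -(ler_nat R).
rewrite ler_pdivlMr// in h1; apply: le_trans h1.
rewrite mulrC -ler_pdivrMr ?divr_gt0//.
near: N; exact: nbhs_infty_ger.
Unshelve. all: by end_near. Qed.

(** The factor [sqrt N / 2] is the inverse of the lattice spacing. Since [m] is interior, [k_ N] and
    [N - k_ N] both tend to infinity, and the three terms [lstir] in [qbinE] give
    [L - L - L = - L]. *)
Lemma cvg_qbin m y (k_ : nat -> nat) : -1 < m < 1 ->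
  (\forall N \near \oo, (k_ N <= N)%N) ->
  spin_dev m N (k_ N) @[N --> \oo] --> y ->
  (Num.sqrt N%:R / 2 * qbin N (k_ N)) @[N --> \oo] -->
    laplace_cst / Num.sqrt (1 - m ^+ 2).
Proof.
move=> /andP[m1 m2] kN h; have h1 := cvg_spin h.
rewrite /laplace_cst; case: cid => /= L cL.
have ck : ((k_ N)%:R / N%:R : R) @[N --> \oo] --> (1 - m) / 2.
  have : ((1 - spin N (k_ N)) / 2 : R) @[N --> \oo] --> (1 - m) / 2.
    by apply: cvgMl; apply: cvgB => //; exact: cvg_cst.
  by apply: cvg_trans; apply: near_eq_cvg; near=> N; rewrite /spin; lra.
have ck' : ((N - k_ N)%:R / N%:R : R) @[N --> \oo] --> (1 + m) / 2.
  have : ((1 + spin N (k_ N)) / 2 : R) @[N --> \oo] --> (1 + m) / 2.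
    by apply: cvgMl; apply: cvgD => //; exact: cvg_cst.
  apply: cvg_trans; apply: near_eq_cvg; near=> N; rewrite /spin natrB; last by near: N.
  have N0 : 0 < N%:R :> R by rewrite ltr0n; near: N; exact: nbhs_infty_gt.
  by field; rewrite gt_eqF.
have l1 : 0 < (1 - m) / 2 by lra.
have l2 : 0 < (1 + m) / 2 by lra.
have k1 := cvg_nat_infty l1 ck.
have k2 := cvg_nat_infty l2 ck'.
have c1 : lstir (k_ N) @[N --> \oo] --> L by apply: cvg_comp cL.
have c2 : lstir (N - k_ N) @[N --> \oo] --> L.
  exact: (cvg_comp (fun N => N - k_ N)%N lstir k2 cL).
have c3 : expR (lstir N - lstir (k_ N) - lstir (N - k_ N)) @[N --> \oo] --> expR (- L).
  have -> : - L = L - L - L by ring.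
  apply: (@continuous_cvg _ _ _ _ _ _ (@expR R)); first exact: continuous_expR.
  by apply: cvgB => //; apply: cvgB.
have c4 : ((Num.sqrt (1 - spin N (k_ N) ^+ 2))^-1 : R) @[N --> \oo] --> (Num.sqrt (1 - m ^+ 2))^-1.
  apply: cvgV; first by rewrite gt_eqF// sqrtr_gt0; nra.
  apply: (@continuous_cvg _ _ _ _ _ _ (@Num.sqrt R)); first exact: sqrt_continuous.
  apply: cvgB; first exact: cvg_cst.
  by under eq_fun do rewrite expr2; rewrite expr2; apply: cvgM.
apply: cvg_trans (cvgM c3 c4); apply: near_eq_cvg; near=> N.
have N0 : 0 < Num.sqrt N%:R :> R.
  by rewrite sqrtr_gt0 ltr0n; near: N; exact: nbhs_infty_gt.
rewrite qbinE; last first.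
  rewrite -(subn_gt0 (k_ N)); apply/andP; split; near: N.
    exact: (k1 _ (nbhs_infty_gt 0)).
  exact: (k2 _ (nbhs_infty_gt 0)).
rewrite /= invfM; set u := (Num.sqrt (1 - _))^-1.
by field; rewrite gt_eqF.
Unshelve. all: by end_near. Qed.

(** Near [m] the product [sqrt N * qbin] is bounded. Near the endpoints [-1] and [1] it is not, but
    there half of the Gaussian factor is at most [exp (- e * N)] and absorbs [sqrt N]. *)
Lemma qbin_gauss_le m c : -1 < m < 1 -> 0 < c -> exists2 C : R, 0 <= C &
  forall N k, (0 < N)%N -> (k <= N)%N ->
    Num.sqrt N%:R * qbin N k * expR (- c * spin_dev m N k ^+ 2) <=
    C * expR (- (c / 2) * spin_dev m N k ^+ 2).
Proof.
move=> /andP[m1 m2] c0.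
(* For [x] in [[-1, 1]] at distance at most [d] from [m], [x ^ 2] and [m ^ 2] differ by at most
   [2 * d], so [1 - x ^ 2] is at least [(1 - m ^ 2) / 2]. *)
pose d : R := (1 - m ^+ 2) / 4.
have d0 : 0 < d by rewrite /d divr_gt0//; nra.
pose e : R := c / 2 * d ^+ 2.
have e0 : 0 < e by rewrite /e mulr_gt0 ?exprn_gt0// divr_gt0.
pose C1 : R := 2 * expR 1 / Num.sqrt ((1 - m ^+ 2) / 2).
pose C2 : R := 2 * expR 1 * e^-1.
have C10 : 0 <= C1 by rewrite divr_ge0 ?sqrtr_ge0// mulr_ge0 ?expR_ge0.
have C20 : 0 <= C2 by rewrite mulr_ge0 ?invr_ge0 ?ltW// mulr_gt0 ?expR_gt0.
exists (C1 + C2); first exact: addr_ge0.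
move=> N k N0 kN.
have n0 : 0 < N%:R :> R by rewrite ltr0n.
have r0 : 0 < Num.sqrt N%:R :> R by rewrite sqrtr_gt0.
set Y := spin_dev m N k ^+ 2.
have Y0 : 0 <= Y by exact: sqr_ge0.
have [near|far] := leP `|spin N k - m| d.
- have s1 : (1 - m ^+ 2) / 2 <= 1 - spin N k ^+ 2.
    move: near; rewrite ler_norml /d => /andP[h1 h2].
    have /andP[h3 h4] := @spin_itv R N k kN.
    nra.
  have kN' : (0 < k < N)%N.
    apply/andP; split; rewrite ?lt0n ?ltn_neqAle ?kN ?andbT; apply/eqP => kE; move: s1.
      by rewrite kE /spin mulr0 mul0r subr0 expr1n subrr; nra.
    rewrite kE /spin mulfK ?gt_eqF//.
    have -> : (1 - 2) ^+ 2 = 1 :> R by ring.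
    by rewrite subrr; nra.
  apply: (@le_trans _ _ (C1 * expR (- c * Y))); last first.
    rewrite ler_pM ?expR_ge0 ?lerDl// ler_expR; nra.
  rewrite ler_wpM2r ?expR_ge0//.
  apply: (@le_trans _ _ (2 * expR 1 / Num.sqrt (1 - spin N k ^+ 2))).
    have := @qbin_le_inner R N k kN'.
    rewrite invfM mulrA -(ler_pM2l r0) => h; apply: le_trans h _.
    by rewrite mulrA mulrCA !mulrA mulfK ?gt_eqF.
  rewrite ler_wpM2l ?mulr_ge0 ?expR_ge0// lef_pV2 ?posrE ?sqrtr_gt0; [|nra|nra].
  exact: ler_wsqrtr.
- have -> : expR (- c * Y) = expR (- (c / 2) * Y) * expR (- (c / 2) * Y).
    by rewrite -expRD; congr expR; lra.
  rewrite mulrA ler_wpM2r ?expR_ge0//.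
  apply: (@le_trans _ _ C2); last by rewrite lerDr.
  rewrite mulrAC.
  apply: (@le_trans _ _ (e^-1 * qbin N k)); last first.
    by rewrite /C2 mulrC ler_wpM2r ?invr_ge0 ?(ltW e0)// qbin_le.
  rewrite ler_wpM2r ?qbin_ge0//.
  apply: le_trans (sqrt_nat_expR_le e0 N0).
  rewrite ler_wpM2l// ?ltW// ltr_expR.
  have : d ^+ 2 < (spin N k - m) ^+ 2.
    by rewrite -[ltRHS]real_normK ?num_real// ltr_pXn2r// ?nnegrE// ltW.
  rewrite /Y -spin_sub_sqr// /e => h.
  rewrite mulNr ltrN2 -mulrA ltr_pM2l ?divr_gt0// mulrC ltr_pM2l//.
Qed.

(** The predicate [V] selects the lattice points attributed to [m]. Two quadratic rates occur: [c]
    serves only for domination, while [a] is the exact second-order coefficient and appears in the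
    limit. The exponential growth allowed for [F] accommodates the tilts
    [exp (t * sqrt N * (x ^ p - m ^ p))]. *)
Lemma cvg_laplace (G : R -> R) (V : R -> bool) m a c A B
    (F : nat -> R -> R) (Phi : R -> R) :
  -1 < m < 1 -> 0 < c -> 0 <= A -> 0 <= B ->
  (forall x, -1 <= x <= 1 -> V x -> G x - G m <= - c * (x - m) ^+ 2) ->
  (\forall x \near m, V x) ->
  (forall e : R, 0 < e -> \forall x \near m,
     `|G x - G m + a / 2 * (x - m) ^+ 2| <= e * (x - m) ^+ 2) ->
  (forall N x, (0 < N)%N -> -1 <= x <= 1 -> V x ->
     `|F N x| <= A * expR (B * (Num.sqrt N%:R * `|x - m|))) ->
  measurable_fun [set: R] Phi ->
  {ae mu, forall y, forall x_ : nat -> R, (\forall N \near \oo, -1 <= x_ N <= 1) ->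
     Num.sqrt N%:R * (x_ N - m) @[N --> \oo] --> y ->
     F N (x_ N) @[N --> \oo] --> Phi y} ->
  mu.-integrable [set: R] (fun y => (Phi y * expR (- (a / 2) * y ^+ 2))%:E) /\
  (\sum_(k < N.+1)
     qbin N k * expR (N%:R * (G (spin N k) - G m)) * (V (spin N k))%:R * F N (spin N k))
   @[N --> \oo] --> laplace_cst / Num.sqrt (1 - m ^+ 2) *
     (\int[mu]_y (Phi y * expR (- (a / 2) * y ^+ 2))).
Proof.
move=> m1 c0 A0 B0 Gc Vm Ga FA mPhi FPhi.
have [C C0 qC] := @qbin_gauss_le m c m1 c0.
pose f N k := Num.sqrt N%:R / 2 *
  (qbin N k * expR (N%:R * (G (spin N k) - G m)) * (V (spin N k))%:R * F N (spin N k)).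
pose K := laplace_cst / Num.sqrt (1 - m ^+ 2).
have K0 : 0 < K.
  by rewrite divr_gt0 ?laplace_cst_gt0// sqrtr_gt0; move: m1 => /andP[]; nra.
pose Psi y := K * (Phi y * expR (- (a / 2) * y ^+ 2)).
have mE : measurable_fun [set: R] (fun y : R => expR (- (a / 2) * y ^+ 2)).
  apply: measurableT_comp => //; apply: measurable_funM => //.
have mPsi : measurable_fun [set: R] Psi.
  by apply: measurable_funM => //; exact: measurable_funM.
(* Of the rate [c / 2] left by [qbin_gauss_le], half pays for the growth of [F]:
   [B * |z| <= c / 4 * z ^ 2 + B ^ 2 / c] by completing the square. *)
case: (@cvg_riemann_sum R m (c / 4) (C / 2 * A * expR (B ^+ 2 / c)) f Psi m1 _ _ _ mPsi).
- by rewrite divr_gt0.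
- by rewrite !mulr_ge0 ?expR_ge0// divr_ge0.
- move=> N k N0 kN; rewrite /f.
  have r0 : 0 <= Num.sqrt N%:R :> R by rewrite sqrtr_ge0.
  have sp := @spin_itv R N k kN.
  case: (boolP (V (spin N k))) => [Vk|_]; last first.
    by rewrite mulr0 mul0r mulr0 normr0 !mulr_ge0 ?expR_ge0 ?divr_ge0.
  rewrite mulr1 normrM ger0_norm ?divr_ge0//.
  rewrite normrM (ger0_norm (mulr_ge0 (qbin_ge0 _ _) (expR_ge0 _))).
  set z := spin_dev m N k.
  have h1 : expR (N%:R * (G (spin N k) - G m)) <= expR (- c * z ^+ 2).
    rewrite ler_expR -spin_sub_sqr// mulrCA.
    by rewrite ler_wpM2l// Gc.
  have h2 : `|F N (spin N k)| <= A * expR (B * `|z|).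
    apply: le_trans (FA _ _ N0 sp Vk) _.
    by rewrite /z /spin_dev normrM (ger0_norm r0).
  apply: (@le_trans _ _ (2^-1 * (Num.sqrt N%:R * qbin N k * expR (- c * z ^+ 2)) * (A * expR (B * `|z|)))).
    have -> : Num.sqrt N%:R / 2 * (qbin N k * expR (N%:R * (G (spin N k) - G m)) * `|F N (spin N k)|) =
      2^-1 * (Num.sqrt N%:R * qbin N k * expR (N%:R * (G (spin N k) - G m))) * `|F N (spin N k)| by ring.
    apply: ler_pM => //.
      by rewrite !mulr_ge0 ?expR_ge0 ?qbin_ge0.
    rewrite ler_wpM2l// ler_wpM2l// mulr_ge0// qbin_ge0//.
  apply: (@le_trans _ _ (2^-1 * (C * expR (- (c / 2) * z ^+ 2)) * (A * expR (B * `|z|)))).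
    rewrite ler_wpM2r ?mulr_ge0 ?expR_ge0// ler_wpM2l//.
    exact: qC.
  have -> : 2^-1 * (C * expR (- (c / 2) * z ^+ 2)) * (A * expR (B * `|z|)) =
    C / 2 * A * (expR (- (c / 2) * z ^+ 2) * expR (B * `|z|)) by ring.
  rewrite -[leRHS]mulrA ler_wpM2l ?mulr_ge0//.
  rewrite -!expRD ler_expR.
  have : 0 <= (c / 2 * `|z| - B) ^+ 2 / c by rewrite divr_ge0 ?sqr_ge0// ltW.
  have -> : (c / 2 * `|z| - B) ^+ 2 / c = c / 4 * `|z| ^+ 2 - B * `|z| + B ^+ 2 / c.
    by field; rewrite gt_eqF.
  rewrite real_normK ?num_real//; lra.
- move: FPhi; apply: (@filterS _ _ (ae_filter_ringOfSetsType mu)) => y Fy k_ kN dk.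
  have cs := cvg_spin dk.
  have Fy' := Fy (fun N => spin N (k_ N)) _ dk.
  have c1 : F N (spin N (k_ N)) @[N --> \oo] --> Phi y.
    by apply: Fy'; apply: filterS kN => N; exact: spin_itv.
  have c2 := cvg_qbin m1 kN dk.
  have c3 : (N%:R * (G (spin N (k_ N)) - G m)) @[N --> \oo] --> - (a / 2) * y ^+ 2.
    have y2 : (spin_dev m N (k_ N) ^+ 2) @[N --> \oo] --> y ^+ 2.
      by under eq_fun do rewrite expr2; rewrite expr2; apply: cvgM.
    have e1 : (N%:R * (G (spin N (k_ N)) - G m) + a / 2 * spin_dev m N (k_ N) ^+ 2) @[N --> \oo] --> (0 : R).
      apply/cvgrPdist_le => e e0.
      have y20 : 0 < y ^+ 2 + 1 by rewrite ltr_wpDl ?sqr_ge0.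
      have e0' : 0 < e / (y ^+ 2 + 1) by rewrite divr_gt0.
      near=> N.
      have N0 : (0 < N)%N by near: N; exact: nbhs_infty_gt.
      rewrite sub0r normrN -spin_sub_sqr//.
      have h1 : `|G (spin N (k_ N)) - G m + a / 2 * (spin N (k_ N) - m) ^+ 2| <=
         e / (y ^+ 2 + 1) * (spin N (k_ N) - m) ^+ 2.
        by near: N; exact: (cs _ (Ga _ e0')).
      rewrite mulrCA -mulrDr normrM ger0_norm//.
      have h2 : spin_dev m N (k_ N) ^+ 2 <= y ^+ 2 + 1.
        near: N; move/cvgrPdist_le : y2 => /(_ 1 ltr01); apply: filterS => N.
        by rewrite ler_norml => /andP[+ _]; lra.
      apply: (@le_trans _ _ (e / (y ^+ 2 + 1) * spin_dev m N (k_ N) ^+ 2)).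
        by rewrite -spin_sub_sqr// [leRHS]mulrCA ler_wpM2l.
      apply: le_trans (ler_wpM2l (ltW e0') h2) _.
      by rewrite divfK ?gt_eqF.
    have e2 : (a / 2 * spin_dev m N (k_ N) ^+ 2) @[N --> \oo] --> a / 2 * y ^+ 2.
      by apply: cvgM => //; exact: cvg_cst.
    apply: (cvg_near (u := fun N => N%:R * (G (spin N (k_ N)) - G m) +
      a / 2 * spin_dev m N (k_ N) ^+ 2 - a / 2 * spin_dev m N (k_ N) ^+ 2)).
    - by apply: cvgB e1 e2.
    - by near=> N; ring.
    - by rewrite sub0r mulNr.
  have c4 : expR (N%:R * (G (spin N (k_ N)) - G m)) @[N --> \oo] --> expR (- (a / 2) * y ^+ 2).
    by apply: (@continuous_cvg _ _ _ _ _ _ (@expR R)) => //; exact: continuous_expR.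
  apply: (cvg_near (cvgM c2 (cvgM c1 c4))) => //; near=> N.
  have VN : V (spin N (k_ N)) by near: N; exact: (cs _ Vm).
  by rewrite /f VN mulr1 /=; ring.
move=> iPsi cPsi.
have iPhi : mu.-integrable [set: R] (fun y => (Phi y * expR (- (a / 2) * y ^+ 2))%:E).
  rewrite (_ : (fun y => _) = (fun y => (K^-1)%:E * (Psi y)%:E)%E).
    exact: integrableZl.
  by apply/funext => y; rewrite -EFinM /Psi mulKf// gt_eqF.
split => //.
have PsiE : (\int[mu]_y (Psi y)%:E)%E = (K * \int[mu]_y (Phi y * expR (- (a / 2) * y ^+ 2)))%:E.
  under eq_integral do rewrite EFinM.
  rewrite integralZl// [RHS]EFinM; congr (_ * _)%E.
  by rewrite /Rintegral fineK//; exact: integrable_fin_num.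
move: cPsi; rewrite PsiE => /fine_cvgP[_].
apply: cvg_trans; apply: near_eq_cvg; near=> N.
have N0 : 0 < Num.sqrt N%:R :> R.
  by rewrite sqrtr_gt0 ltr0n; near: N; exact: nbhs_infty_gt.
rewrite /= /f -mulr_sumr mulrA.
have -> : 2 / Num.sqrt N%:R * (Num.sqrt N%:R / 2) = 1 :> R.
  by field; rewrite gt_eqF.
by rewrite mul1r.
Unshelve. all: by end_near. Qed.

End laplace.

(** * Global maximizers of H *)

Section derivatives.
Context {R : realType}.
Implicit Types (x y m l e a b : R) (n : nat).

Lemma is_derive_exprn n x :
  is_derive x (1 : R) (fun z : R => z ^+ n) (n%:R * x ^+ n.-1).
Proof.
case: n => [|n].
  rewrite mul0r; apply: (is_derive_eq (is_derive_cst _ _ _)) => //.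
apply: DeriveDef; first exact: exprn_derivable.
by rewrite exp_derive /= scaler1.
Qed.

Lemma mvt_near (f df : R -> R) m x :
  (forall z, `|z - m| <= `|x - m| -> is_derive z (1 : R) f (df z)) ->
  exists2 c, `|c - m| <= `|x - m| & f x - f m = df c * (x - m).
Proof.
move=> fd.
have cont a b : (forall z, a <= z <= b -> `|z - m| <= `|x - m|) ->
    {within `[a, b], continuous f}.
  move=> h; apply: derivable_within_continuous => z; rewrite in_itv /= => zab.
  by have := fd z (h z zab); case.
have [mx|xm] := leP m x.
  have h z : m <= z <= x -> `|z - m| <= `|x - m|.
    by move=> /andP[? ?]; rewrite !ger0_norm ?subr_ge0//; lra.
  case: (@MVT_segment R f df m x mx) => [z||c].
  - by rewrite in_itv /= => /andP[? ?]; apply/fd/h; rewrite !ltW.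
  - exact: cont.
  - by rewrite in_itv /= => cmx fE; exists c => //; exact: h.
have h z : x <= z <= m -> `|z - m| <= `|x - m|.
  by move=> /andP[? ?]; rewrite !ler0_norm ?subr_le0//; lra.
case: (@MVT_segment R f df x m (ltW xm)) => [z||c].
- by rewrite in_itv /= => /andP[? ?]; apply/fd/h; rewrite !ltW.
- exact: cont.
- rewrite in_itv /= => cmx fE; exists c; first exact: h.
  by rewrite -opprB fE; ring.
Qed.

Lemma taylor2 (f df : R -> R) m l e : 0 < e ->
  (\forall x \near m, is_derive x (1 : R) f (df x)) ->
  df m = 0 -> is_derive m (1 : R) df l ->
  \forall x \near m, `|f x - f m - l / 2 * (x - m) ^+ 2| <= e * (x - m) ^+ 2.
Proof.
move=> e0 fd dfm /is_derive1_caratheodory[g [dfE gc gm]].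
have ge : \forall x \near m, `|g x - l| <= e.
  move/cvgrPdist_le : gc => /(_ e e0); rewrite gm; apply: filterS => x.
  by rewrite distrC.
have /nbhs_ballP[d /= d0 hd] : \forall x \near m,
    is_derive x (1 : R) f (df x) /\ `|g x - l| <= e by near=> x; split; near: x.
near=> x.
have xd : `|x - m| < d by rewrite distrC; near: x; exact: nbhsx_ballx.
have inball z : `|z - m| <= `|x - m| -> ball m d z.
  by move=> zx; rewrite /ball /= distrC; exact: le_lt_trans xd.
pose F z := f z - l / 2 * (z - m) ^+ 2.
case: (@mvt_near F (fun z => df z - l * (z - m)) m x).
  move=> z zx; have [fz _] := hd z (inball z zx).
  have d2 : is_derive z (1 : R) (fun z => (z - m) ^+ 2) (2 * (z - m)).
    have d1 : is_derive z (1 : R) (fun z => z - m) 1.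
      by apply: is_derive_eq; rewrite oppr0 addr0.
    have := @is_derive1_comp R (fun y => y ^+ 2) (fun z => z - m) z _ _ (is_derive_exprn 2 (z - m)) d1.
    by rewrite mulr1 /= expr1.
  by apply: is_derive_eq; rewrite /GRing.scale /=; field.
move=> c cx; rewrite /F subrr expr0n /= mulr0 subr0 => FE.
have -> : f x - f m - l / 2 * (x - m) ^+ 2 = (df c - l * (c - m)) * (x - m).
  by rewrite -FE; ring.
have := dfE c; rewrite dfm subr0 => ->.
have -> : g c * (c - m) - l * (c - m) = (g c - l) * (c - m) by ring.
rewrite !normrM -(real_normK (num_real (x - m))) expr2 mulrA ler_wpM2r//.
have [_ gc'] := hd c (inball c cx).
by rewrite ler_pM.
Unshelve. all: by end_near. Qed.

Lemma rolle_zero (f df : R -> R) a b : a < b ->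
  (forall x, a <= x <= b -> is_derive x (1 : R) f (df x)) -> f a = f b ->
  exists2 c, a < c < b & df c = 0.
Proof.
move=> ab fd fab.
case: (@Rolle R f a b ab) => [x|||c].
- by rewrite in_itv /= => /andP[? ?]; have [] := fd x; rewrite ?ltW.
- apply: derivable_within_continuous => z; rewrite in_itv /= => zab.
  by have := fd z zab; case.
- exact: fab.
- rewrite in_itv /= => /andP[ac cb] fc; exists c; first by rewrite ac.
  have [_ <-] : is_derive c (1 : R) f (df c) by apply: fd; rewrite !ltW.
  by case: fc.
Qed.

Lemma continuous_xlnx : continuous (fun x : R => x * ln x).
Proof.
move=> x; have [x0|x0|->] := ltgtP x 0.
- have c0 : (fun _ : R => 0 : R) z @[z --> x] --> x * ln x.
    by rewrite [ln x]ln0 ?mulr0 ?ltW//; exact: cvg_cst.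
  apply: cvg_trans c0; apply: near_eq_cvg; near=> z.
  rewrite ln0 ?mulr0// ltW//; near: z.
  exact: lt_nbhsl.
- apply: cvgM; first exact: cvg_id.
  exact: continuous_ln.
(* At [0] the bound is [|z * ln z| <= 2 * sqrt z] for [0 < z <= 1], from [ln (1 / s) <= 1 / s] with
   [s = sqrt z]. *)
- rewrite /continuous_at mul0r; apply/cvgrPdist_le => e e0.
  have s0 : (Num.sqrt `|z| * 2 : R) @[z --> (0 : R)] --> (0 * 2 : R).
    apply: cvgMl.
    have n0 : `|z| @[z --> (0 : R)] --> `|0 : R| by exact: norm_continuous.
    have := cvg_comp _ _ n0 (@sqrt_continuous R `|0|).
    by rewrite normr0 sqrtr0.
  rewrite mul0r in s0.
  move/cvgrPdist_le : s0 => /(_ e e0).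
  apply: filter_app; near=> z => h.
  rewrite sub0r normrN; rewrite sub0r normrN in h; apply: le_trans h.
  have [z0|z0] := leP z 0; first by rewrite ln0// mulr0 normr0.
  have z1 : z <= 1.
    by apply/ltW; near: z; exact: lt_nbhsl.
  rewrite [leRHS]ger0_norm ?mulr_ge0 ?sqrtr_ge0// (gtr0_norm z0).
  rewrite ler0_norm; last by rewrite mulr_ge0_le0 ?ln_le0// ltW.
  set s := Num.sqrt z.
  have s0 : 0 < s by rewrite sqrtr_gt0.
  have zE : z = s ^+ 2 by rewrite sqr_sqrtr// ltW.
  rewrite zE lnXn// -mulr_natr.
  have : ln s^-1 <= s^-1.
    apply: le_trans (_ : s^-1 - 1 <= _); last by lra.
    have := @expR_ge1Dx R (ln s^-1); rewrite lnK ?posrE ?invr_gt0//; lra.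
  rewrite lnV ?posrE// => h.
  have : s ^+ 2 * (- ln s) <= s ^+ 2 * s^-1 by rewrite ler_wpM2l ?sqr_ge0.
  rewrite expr2 mulfK ?gt_eqF//; lra.
Unshelve. all: by end_near. Qed.

End derivatives.

(** * Derivatives of [H] *)

Section hamiltonian.
Context {R : realType}.
Variables (beta h : R) (p : nat).
Implicit Types (x y m : R).

Definition dH x : R :=
  beta * (p%:R * x ^+ p.-1) + h - 2^-1 * (ln (1 + x) - ln (1 - x)).

Definition ddH x : R :=
  beta * (p%:R * (p.-1%:R * x ^+ p.-2)) - (1 - x ^+ 2)^-1.

Let d_1p x : -1 < x < 1 -> is_derive x (1 : R) (fun z => ln (1 + z)) (1 + x)^-1.
Proof.
move=> /andP[x1 x2].
have d1 : is_derive x (1 : R) (fun z => 1 + z) 1.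
  by apply: (is_derive_eq (is_deriveD (is_derive_cst (1 : R) x 1) (is_derive_id x 1))); rewrite add0r.
have := @is_derive1_comp R (@ln R) (fun z => 1 + z) x (1 + x)^-1 1 _ d1.
by rewrite mulr1; apply; apply: is_derive1_ln; lra.
Qed.

Let d_1m x : -1 < x < 1 -> is_derive x (1 : R) (fun z => ln (1 - z)) (- (1 - x)^-1).
Proof.
move=> /andP[x1 x2].
have d1 : is_derive x (1 : R) (fun z => 1 - z) (-1).
  by apply: (is_derive_eq (is_deriveB (is_derive_cst (1 : R) x 1) (is_derive_id x 1))); rewrite sub0r.
have := @is_derive1_comp R (@ln R) (fun z => 1 - z) x (1 - x)^-1 (-1) _ d1.
by rewrite mulrN1; apply; apply: is_derive1_ln; lra.
Qed.

Lemma is_derive_entropyI x : -1 < x < 1 ->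
  is_derive x (1 : R) (@entropyI R) (2^-1 * (ln (1 + x) - ln (1 - x))).
Proof.
move=> x1; have d1 := d_1p x1; have d2 := d_1m x1.
rewrite /entropyI; apply: is_derive_eq.
rewrite /GRing.scale /=; field; move: x1 => /andP[? ?].
by rewrite !gt_eqF//; lra.
Qed.

Lemma is_derive_H x : -1 < x < 1 -> is_derive x (1 : R) (H beta h p) (dH x).
Proof.
move=> x1; have d1 := is_derive_entropyI x1; have d2 := is_derive_exprn p x.
rewrite /H; apply: is_derive_eq.
by rewrite /GRing.scale /= /dH; ring.
Qed.

Lemma is_derive_dH x : -1 < x < 1 -> is_derive x (1 : R) dH (ddH x).
Proof.
move=> x1; have d1 := d_1p x1; have d2 := d_1m x1.
have d3 := is_derive_exprn p.-1 x.
rewrite /dH; apply: is_derive_eq.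
rewrite /GRing.scale /= /ddH.
have /andP[? ?] := x1.
have -> : (1 - x ^+ 2)^-1 = 2^-1 * ((1 + x)^-1 + (1 - x)^-1).
  by field; rewrite !gt_eqF//; nra.
ring.
Qed.

Lemma near_itv11 x : -1 < x < 1 -> \forall z \near x, -1 < z < 1.
Proof.
move=> x1; have : x \in `]-1, 1[ by rewrite in_itv.
by move/near_in_itvoo; apply: filterS => z; rewrite in_itv.
Qed.

Lemma H2E m : -1 < m < 1 -> H2 beta h p m = ddH m.
Proof.
move=> m1; rewrite /H2 derive1nS derive1n1 derive1E.
rewrite (@near_eq_derive _ _ _ _ dH) ?oner_neq0//.
  by have [_ ->] := is_derive_dH m1.
near=> z; rewrite derive1E.
have z1 : -1 < z < 1 by near: z; exact: near_itv11.
by have [_ ->] := is_derive_H z1.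
Unshelve. all: by end_near. Qed.

Lemma continuous_H : continuous (H beta h p).
Proof.
move=> x; rewrite /H; apply: cvgB.
  apply: cvgD; apply: cvgM; try exact: cvg_cst; last exact: cvg_id.
  exact: exprn_continuous.
rewrite /entropyI; apply: cvgM; first exact: cvg_cst.
have c1 : (1 + z) @[z --> x] --> 1 + x by apply: cvgD; [exact: cvg_cst|exact: cvg_id].
have c2 : (1 - z) @[z --> x] --> 1 - x by apply: cvgB; [exact: cvg_cst|exact: cvg_id].
apply: cvgD.
  exact: (cvg_comp (fun z => 1 + z) (fun y => y * ln y) c1 (@continuous_xlnx R (1 + x))).
exact: (cvg_comp (fun z => 1 - z) (fun y => y * ln y) c2 (@continuous_xlnx R (1 - x))).
Qed.

Lemma taylor_H m e : -1 < m < 1 -> dH m = 0 -> 0 < e ->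
  \forall x \near m, `|H beta h p x - H beta h p m + - ddH m / 2 * (x - m) ^+ 2|
     <= e * (x - m) ^+ 2.
Proof.
move=> m1 dm e0.
have := @taylor2 R (H beta h p) dH m (ddH m) e e0 _ dm (is_derive_dH m1).
have hn : \forall x \near m, is_derive x (1 : R) (H beta h p) (dH x).
  by apply: filterS (near_itv11 m1) => x; exact: is_derive_H.
by move=> /(_ hn); apply: filterS => x; rewrite !mulNr.
Qed.

End hamiltonian.

(** * Maximizers of [H] and zeros of [H''] *)

Section maximizers.
Context {R : realType}.
Implicit Types (beta h x y m a b c : R) (p n : nat).

Lemma exprn_lipschitz n x y : `|x| <= 1 -> `|y| <= 1 ->
  `|x ^+ n - y ^+ n| <= n%:R * `|x - y|.
Proof.
move=> x1 y1; elim: n => [|n ih]; first by rewrite !expr0 subrr normr0 mul0r.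
have -> : x ^+ n.+1 - y ^+ n.+1 = x * (x ^+ n - y ^+ n) + y ^+ n * (x - y).
  by rewrite !exprS; ring.
apply: le_trans (ler_normD _ _) _.
rewrite -natr1 mulrDl mul1r !normrM; apply: lerD.
  by apply: le_trans ih; rewrite ler_piMl.
by rewrite ler_piMl// normrX exprn_ile1.
Qed.

Lemma entropyIN x : entropyI (- x) = entropyI x.
Proof. by rewrite /entropyI opprK addrC. Qed.

Lemma entropyI0 : entropyI (0 : R) = 0.
Proof. by rewrite /entropyI addr0 subr0 ln1 mulr0 addr0 mulr0. Qed.

Lemma entropyI1 : entropyI (1 : R) = ln 2.
Proof. by rewrite /entropyI subrr mul0r addr0 mulrA mulVf ?mul1r. Qed.

Lemma xlnx_ge x : 0 <= x -> x - 1 <= x * ln x.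
Proof.
rewrite le_eqVlt => /orP[/eqP <-|x0]; first by rewrite mul0r; lra.
have := @expR_ge1Dx R (ln x^-1); rewrite lnK ?posrE ?invr_gt0// lnV ?posrE// => h.
have := ler_wpM2l (ltW x0) h; rewrite mulfV ?gt_eqF//; lra.
Qed.

Lemma entropyI_ge0 x : -1 <= x <= 1 -> 0 <= entropyI x.
Proof.
move=> /andP[x1 x2]; rewrite /entropyI.
have h1 := @xlnx_ge (1 + x) ltac:(lra).
have h2 := @xlnx_ge (1 - x) ltac:(lra).
lra.
Qed.

(** The infinite slope of the entropy at the endpoint, which pushes the maximizers into the open
    interval. *)
Lemma entropyI_sub1 e : 0 < e < 1 ->
  entropyI (1 : R) - entropyI (1 - e) >= - (e * ln e) / 2.
Proof.
move=> /andP[e0 e1]; rewrite entropyI1 /entropyI.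
have -> : 1 + (1 - e) = 2 - e by ring.
have -> : 1 - (1 - e) = e by ring.
have l2 : ln (2 - e) <= ln 2 by rewrite ler_ln ?posrE//; lra.
have l0 : 0 <= ln (2 : R) by rewrite ln_ge0//; lra.
have : (2 - e) * ln (2 - e) <= (2 - e) * ln 2 by rewrite ler_wpM2l//; lra.
nra.
Qed.

Lemma HN beta h p x : ~~ odd p -> H beta h p (- x) = H beta (- h) p x.
Proof.
move=> podd; rewrite /H entropyIN exprNn -signr_odd (negbTE podd) expr0 mul1r.
by ring.
Qed.

Lemma H0 beta h p : (0 < p)%N -> H beta h p 0 = 0.
Proof. by move=> p0; rewrite /H entropyI0 expr0n eqn0Ngt p0 /=; ring. Qed.

Lemma global_max_itv beta h p m : is_global_max beta h p m -> -1 < m < 1.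
Proof.
move=> [m1 mmax]; rewrite in_itv /= in m1.
have key s : (s = 1 \/ s = -1) -> m <> s.
  move=> s1 ms; rewrite {}ms in m1 mmax.
  pose C := `|beta| * p%:R + `|h|.
  have C0 : 0 <= C by rewrite addr_ge0// mulr_ge0.
  (* [C] is a Lipschitz constant of [beta * x ^ p + h * x]. Moving inwards by [e] costs at most
     [C * e] there and gains at least [- (e * ln e) / 2 = (C + 1 / 2) * e] from the entropy. *)
  pose e : R := expR (- (2 * C) - 1).
  have e0 : 0 < e by exact: expR_gt0.
  have e1 : e < 1 by rewrite -expR0 ltr_expR; lra.
  have le : ln e = - (2 * C) - 1 by rewrite expRK.
  have n1 : `|s| <= 1 by case: s1 => ->; rewrite ?normrN normr1.
  have n2 : `|s * (1 - e)| <= 1.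
    by rewrite normrM mulr_ile1// ger0_norm; lra.
  have n2' : s * (1 - e) \in `[-1, 1] by rewrite in_itv /= -ler_norml.
  have := mmax _ n2'.
  have Is : entropyI (s * (1 - e)) = entropyI (1 - e).
    by case: s1 => ->; rewrite ?mul1r ?mulN1r ?entropyIN.
  have Is1 : entropyI s = entropyI 1 by case: s1 => ->; rewrite ?entropyIN.
  rewrite /H Is Is1.
  have ee : 0 < e < 1 by rewrite e0.
  have := entropyI_sub1 ee; rewrite le.
  have d : s - s * (1 - e) = s * e by ring.
  have nse : `|s * e| = e.
    by rewrite normrM (gtr0_norm e0); case: s1 => ->; rewrite ?normrN1 ?normr1 mul1r.
  have h1 : beta * (s ^+ p - (s * (1 - e)) ^+ p) <= `|beta| * (p%:R * e).
    apply: le_trans (ler_norm _) _; rewrite normrM ler_wpM2l//.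
    by rewrite -[in leRHS]nse -d; exact: exprn_lipschitz.
  have h2 : h * (s * e) <= `|h| * e.
    by apply: le_trans (ler_norm _) _; rewrite normrM nse.
  have h3 : `|beta| * (p%:R * e) + `|h| * e = C * e by rewrite /C; ring.
  have h4 : h * (s * e) = h * s - h * (s * (1 - e)) by ring.
  rewrite h4 in h2; nra.
have /eqP k1 := key 1 (or_introl erefl).
have /eqP k2 := key (-1) (or_intror erefl).
by move: m1 => /andP[m1 m2]; rewrite !lt_neqAle m1 m2 k1 eq_sym k2.
Qed.

Lemma global_max_dH beta h p m : is_global_max beta h p m -> dH beta h p m = 0.
Proof.
move=> mm; have m1 := global_max_itv mm.
have [_ mmax] := mm.
have [_ <-] := is_derive_H beta h p m1.
have [] // := @derive1_at_max R (H beta h p) (-1) 1 m _ _ _ _.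
- by move=> x; rewrite in_itv /= => x1; have [] := is_derive_H beta h p x1.
- move=> x; rewrite in_itv /= => /andP[x1 x2]; apply: mmax.
  by rewrite in_itv /= !ltW.
Qed.

Lemma global_max_eq beta h p a b : is_global_max beta h p a ->
  is_global_max beta h p b -> H beta h p a = H beta h p b.
Proof. by move=> [a1 ha] [b1 hb]; apply/eqP; rewrite eq_le ha ?hb. Qed.

Lemma global_max_ddH_le0 beta h p m : is_global_max beta h p m ->
  ddH beta p m <= 0.
Proof.
move=> mm; rewrite leNgt; apply/negP => d0.
have m1 := global_max_itv mm; have dm := global_max_dH mm.
(* With half of the quadratic term given up to the remainder, [H] would still increase away from
   [m]. *)
have e0 : 0 < ddH beta p m / 4 by rewrite divr_gt0.
have T := taylor_H m1 dm e0.
have [x [[xm x1] Tx]] : exists x, (x != m /\ -1 < x < 1) /\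
   `|H beta h p x - H beta h p m + - ddH beta p m / 2 * (x - m) ^+ 2|
     <= ddH beta p m / 4 * (x - m) ^+ 2.
  have : \forall x \near m^', (x != m /\ -1 < x < 1) /\
     `|H beta h p x - H beta h p m + - ddH beta p m / 2 * (x - m) ^+ 2|
     <= ddH beta p m / 4 * (x - m) ^+ 2.
    near=> x; split; last by near: x; exact: nbhs_dnbhs.
    split; first by near: x; exact: nbhs_dnbhs_neq.
    by near: x; apply: nbhs_dnbhs; exact: near_itv11.
  by move/filter_ex.
have [_ mmax] := mm.
have hx : H beta h p x <= H beta h p m.
  by apply: mmax; move: x1 => /andP[? ?]; rewrite in_itv /= !ltW.
have xm2 : 0 < (x - m) ^+ 2 by rewrite exprn_even_gt0//= subr_eq0.
move: Tx; rewrite ler_norml => /andP[Tx _].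
by have := mulr_gt0 d0 xm2; lra.
Unshelve. all: by end_near. Qed.

Lemma ddH_zero beta h p a b : -1 < a -> a < b -> b < 1 ->
  dH beta h p a = 0 -> dH beta h p b = 0 ->
  exists2 c, a < c < b & ddH beta p c = 0.
Proof.
move=> a1 ab b1 da db; apply: (@rolle_zero R (dH beta h p) (ddH beta p) a b ab); last by rewrite da db.
by move=> x /andP[ax xb]; apply: is_derive_dH; lra.
Qed.

(** On [(0, 1)] the zeros of [H''] solve [K * g x = 1] with [g x = x ^ (p - 2) - x ^ p]. Three of
    them would give two positive zeros of [g'], but [g'] vanishes on the positive axis only where
    [x ^ 2 = (p - 2) / p]. *)
Lemma ddH_zeros_le2 beta p a b c : (2 < p)%N -> 0 < a -> a < b -> b < c -> c < 1 ->
  ddH beta p a = 0 -> ddH beta p b = 0 -> ddH beta p c = 0 -> False.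
Proof.
case: p => [|[|[|n]]] // _ a0 ab bc c1.
pose g (x : R) := x ^+ n.+1 - x ^+ n.+3.
pose dg (x : R) := n.+1%:R * x ^+ n - n.+3%:R * x ^+ n.+2.
have gd x : is_derive x (1 : R) g (dg x).
  have d1 := is_derive_exprn n.+1 x; have d2 := is_derive_exprn n.+3 x.
  by rewrite /g; apply: is_derive_eq.
pose K := beta * n.+3%:R * n.+2%:R.
have gE x : 0 < x < 1 -> ddH beta n.+3 x = 0 -> K * g x = 1.
  move=> /andP[x0 x1]; rewrite /ddH /= => /eqP; rewrite subr_eq0 => /eqP e.
  have x2 : 1 - x ^+ 2 != 0 by rewrite gt_eqF//; nra.
  rewrite -(mulVf x2) -e /K /g !exprS; ring.
move=> /gE ea /gE eb /gE ec.
have {}ea := ea ltac:(lra); have {}eb := eb ltac:(lra); have {}ec := ec ltac:(lra).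
have K0 : K != 0.
  by apply/eqP => K0; move: ea; rewrite K0 mul0r => /eqP; rewrite eq_sym oner_eq0.
have gab : g a = g b by apply: (mulfI K0); rewrite ea eb.
have gbc : g b = g c by apply: (mulfI K0); rewrite eb ec.
have [u /andP[u1 u2] du] := rolle_zero ab (fun x _ => gd x) gab.
have [v /andP[v1 v2] dv] := rolle_zero bc (fun x _ => gd x) gbc.
have dgE x : 0 < x -> dg x = 0 -> n.+3%:R * x ^+ 2 = n.+1%:R.
  move=> x0; rewrite /dg => /eqP; rewrite subr_eq0 => /eqP e.
  have xn : x ^+ n != 0 by rewrite expf_neq0// gt_eqF.
  by apply: (mulfI xn); rewrite [RHS]mulrC e !exprS; ring.
have := dgE u ltac:(lra) du; rewrite -(dgE v ltac:(lra) dv).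
have n3 : n.+3%:R != 0 :> R by rewrite pnatr_eq0.
move=> /(mulfI n3) uv.
have : u < v by lra.
nra.
Qed.

Lemma ddH_odd_zero beta p x : (2 < p)%N -> odd p -> 0 <= beta -> -1 < x < 1 ->
  ddH beta p x = 0 -> 0 < x.
Proof.
case: p => [|[|[|n]]] // _; rewrite /= !negbK => nodd b0 /andP[x1 x2].
rewrite ltNge => e; apply/negP => x0.
have : x ^+ n.+1 <= 0.
  rewrite -oppr_ge0; have -> : - x ^+ n.+1 = (- x) ^+ n.+1.
    by rewrite [RHS]exprNn -signr_odd /= nodd expr1 mulN1r.
  by rewrite exprn_ge0// oppr_ge0.
move: e; rewrite /ddH /= => e xn.
have : 0 < (1 - x ^+ 2)^-1 by rewrite invr_gt0; nra.
have : beta * (n.+3%:R * (n.+2%:R * x ^+ n.+1)) <= 0.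
  by rewrite mulr_ge0_le0// mulr_ge0_le0// mulr_ge0_le0.
lra.
Qed.

Lemma ddH00 beta p : (2 < p)%N -> ddH beta p 0 = -1.
Proof.
by case: p => [|[|[|n]]] // _; rewrite /ddH /= exprS mul0r !mulr0 expr0n /= subr0 invr1 sub0r.
Qed.

(* Between two maximizers H' vanishes once more, which gives two zeros of H'';
   a third one is impossible since H'' is, up to a positive factor, an affine
   function of x^(p-2) (1 - x^2). *)
Lemma two_max_zeros beta h p a b : a < b -> is_global_max beta h p a ->
  is_global_max beta h p b -> exists z1 z2, [/\ a < z1, z1 < z2, z2 < b,
    ddH beta p z1 = 0 & ddH beta p z2 = 0].
Proof.
move=> ab ma mb.
have /andP[a1 a2] := global_max_itv ma; have /andP[b1 b2] := global_max_itv mb.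
have [c /andP[ac cb] dc] : exists2 c, a < c < b & dH beta h p c = 0.
  apply: (rolle_zero ab) (global_max_eq ma mb) => x /andP[ax xb].
  by apply: is_derive_H; lra.
have [z1 /andP[az zc] dz1] := ddH_zero a1 ac (lt_trans cb b2) (global_max_dH ma) dc.
have [z2 /andP[cz zb] dz2] := ddH_zero (lt_trans a1 ac) cb b2 dc (global_max_dH mb).
by exists z1, z2; split => //; lra.
Qed.

Lemma two_max_beta beta h p a b : a < b -> is_global_max beta h p a ->
  is_global_max beta h p b -> beta != 0.
Proof.
move=> ab ma mb; have [z1 [z2 [az zz zb d1 _]]] := two_max_zeros ab ma mb.
have /andP[a1 _] := global_max_itv ma; have /andP[_ b2] := global_max_itv mb.
apply/eqP => b0; move: d1; rewrite /ddH b0 mul0r sub0r => /eqP.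
by rewrite oppr_eq0 invr_eq0 => /eqP; nra.
Qed.

(** A condition on a maximizer [a] ensuring, for [beta >= 0], that the zeros of [H''] in [[a, 1)]
    are positive, so that [ddH_zeros_le2] can count them. *)
Definition one_sided p a := odd p || (0 <= a).

Lemma ddH_zero_gt0 beta p a z : (2 < p)%N -> 0 <= beta -> one_sided p a ->
  -1 < a -> a <= z -> z < 1 -> ddH beta p z = 0 -> 0 < z.
Proof.
move=> p2 b0 /orP[podd|a0] a1 az z1 dz.
  by apply: ddH_odd_zero dz => //; lra.
rewrite lt_neqAle (le_trans a0 az) andbT; apply/eqP => z0.
by move: dz; rewrite -z0 ddH00// => /eqP; rewrite oppr_eq0 oner_eq0.
Qed.

(** Two zeros of [H''] already lie strictly between [a] and [b]; a degenerate maximizer would be a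
    third. *)
Lemma two_max_ddH beta h p a b : (2 < p)%N -> 0 <= beta -> one_sided p a ->
  a < b -> is_global_max beta h p a -> is_global_max beta h p b ->
  ddH beta p a < 0 /\ ddH beta p b < 0.
Proof.
move=> p2 b0 os ab ma mb.
have /andP[a1 a2] := global_max_itv ma; have /andP[b1 b2] := global_max_itv mb.
have [z1 [z2 [az zz zb d1 d2]]] := two_max_zeros ab ma mb.
split; rewrite lt_neqAle ?(global_max_ddH_le0 ma) ?(global_max_ddH_le0 mb) andbT;
  apply/eqP => d0.
- have a0 := ddH_zero_gt0 p2 b0 os a1 (lexx a) a2 d0.
  by apply: (ddH_zeros_le2 p2 a0 az zz _ d0 d1 d2); lra.
- have z0 : 0 < z1 by apply: (ddH_zero_gt0 p2 b0 os a1 _ _ d1); lra.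
  exact: (ddH_zeros_le2 p2 z0 zz zb b2 d1 d2 d0).
Qed.

(** Each of the two gaps between the maximizers contains two zeros of [H'']. *)
Lemma three_max_false beta h p a b c : (2 < p)%N -> 0 <= beta -> one_sided p a ->
  a < b -> b < c -> is_global_max beta h p a -> is_global_max beta h p b ->
  is_global_max beta h p c -> False.
Proof.
move=> p2 b0 os ab bc ma mb mc.
have /andP[a1 a2] := global_max_itv ma; have /andP[c1 c2] := global_max_itv mc.
have [z1 [z2 [az zz zb d1 d2]]] := two_max_zeros ab ma mb.
have [z3 [z4 [bz zz' zc d3 d4]]] := two_max_zeros bc mb mc.
have z0 : 0 < z1 by apply: (ddH_zero_gt0 p2 b0 os a1 _ _ d1); lra.
by apply: (ddH_zeros_le2 p2 z0 zz _ _ d1 d2 d3); lra.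
Qed.

Lemma dH00 beta p : (2 < p)%N -> dH beta 0 p 0 = 0.
Proof.
case: p => [|[|[|n]]] // _.
by rewrite /dH /= addr0 [1 + 0]addr0 subr0 ln1 subrr mulr0 subr0 exprS mul0r !mulr0.
Qed.

(* When h = 0 the origin is a strict local maximum, so H' also vanishes
   strictly between 0 and a positive maximizer. *)
Lemma pos_max_dH_zero beta p m : (2 < p)%N -> 0 < m ->
  is_global_max beta 0 p m -> exists2 c, 0 < c < m & dH beta 0 p c = 0.
Proof.
move=> p2 m0 mm; have /andP[m1 m2] := global_max_itv mm.
have p0 : (0 < p)%N by exact: ltn_trans p2.
have [_ mmax] := mm.
have T := @taylor_H R beta 0 p 0 (1 / 4) ltac:(lra) (dH00 beta p2) ltac:(lra).
have [x [/andP[x0 xm] Tx]] : exists x, 0 < x < m /\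
   `|H beta 0 p x - H beta 0 p 0 + - ddH beta p 0 / 2 * (x - 0) ^+ 2|
     <= 1 / 4 * (x - 0) ^+ 2.
  have /nbhs_ballP[d /= d0 hd] := T.
  pose x := Num.min d m / 2.
  have x0 : 0 < x by rewrite divr_gt0// lt_min d0.
  have [xd xm] : x < d /\ x < m.
    have : Num.min d m <= d /\ Num.min d m <= m by rewrite !ge_min !lexx orbT.
    by rewrite /x in x0 *; lra.
  exists x; rewrite x0 xm; split => //; apply: hd.
  by rewrite /ball /= sub0r normrN gtr0_norm.
have Hx : H beta 0 p x < H beta 0 p 0.
  move: Tx; rewrite ddH00// opprK subr0 ler_norml => /andP[_ Tx].
  have : 0 < x ^+ 2 by rewrite exprn_gt0.
  lra.
(* The zero of [H'] is a minimizer of [H] on [[0, m]], interior because [H] at [x] is below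
   [H 0 <= H m]. *)
have [|c c1 cmin] := @EVT_min R (H beta 0 p) 0 m (ltW m0).
  by apply: continuous_subspaceT; exact: continuous_H.
rewrite in_itv /= in c1.
have Hc : H beta 0 p c <= H beta 0 p x by apply: cmin; rewrite in_itv /= !ltW.
have Hm : H beta 0 p 0 <= H beta 0 p m.
  by apply: mmax; rewrite in_itv /=; lra.
have c0m : 0 < c < m.
  move: c1 => /andP[c1 c2]; rewrite !lt_neqAle c1 c2 !andbT.
  by apply/andP; split; apply/eqP => e; subst; lra.
exists c => //.
have cc : -1 < c < 1 by move: c0m => /andP[? ?]; lra.
have [_ <-] := is_derive_H beta 0 p cc.
have [] // := @derive1_at_min R (H beta 0 p) 0 m c (ltW m0) _ _ _.
- move=> y; rewrite in_itv /= => /andP[y1 y2].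
  by have [] // : is_derive y (1 : R) (H beta 0 p) (dH beta 0 p y) by apply: is_derive_H; lra.
- by move=> y; rewrite in_itv /= => /andP[y1 y2]; apply: cmin; rewrite in_itv /= !ltW.
Unshelve. all: by end_near. Qed.

(** [H'] vanishes at [0], at an intermediate point and at [m], hence [H''] has two zeros in [(0, m)]
    and [m] cannot be a third. *)
Lemma pos_max_ddH beta p m : (2 < p)%N -> 0 <= beta -> 0 < m ->
  is_global_max beta 0 p m -> ddH beta p m < 0.
Proof.
move=> p2 b0 m0 mm; have /andP[m1 m2] := global_max_itv mm.
rewrite lt_neqAle (global_max_ddH_le0 mm) andbT; apply/eqP => d0.
have [c /andP[c0 cm] dc] := pos_max_dH_zero p2 m0 mm.
have [z1 /andP[z0 zc] dz1] := ddH_zero (ltrN10 _) c0 (lt_trans cm m2) (dH00 beta p2) dc.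
have [z2 /andP[cz zm] dz2] := ddH_zero (lt_trans (ltrN10 _) c0) cm m2 dc (global_max_dH mm).
exact: (ddH_zeros_le2 p2 z0 (lt_trans zc cz) zm m2 dz1 dz2 d0).
Qed.

(** [H''] has one zero in [(0, a)], since [H'] vanishes at both ends, and two more in [(a, b)]. *)
Lemma pos_max_uniq beta p a b : (2 < p)%N -> 0 < a ->
  is_global_max beta 0 p a -> is_global_max beta 0 p b -> a < b -> False.
Proof.
move=> p2 a0 ma mb ab.
have /andP[a1 a2] := global_max_itv ma; have /andP[b1 b2] := global_max_itv mb.
have [z1 [z2 [az zz zb d1 d2]]] := two_max_zeros ab ma mb.
have [z /andP[z0 za] dz] := ddH_zero (ltrN10 _) a0 a2 (dH00 beta p2) (global_max_dH ma).
exact: (ddH_zeros_le2 p2 z0 (lt_trans za az) zz (lt_trans zb b2) dz d1 d2).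
Qed.

End maximizers.

(** * Classification of the critical points *)

Section classification.
Context {R : realType}.
Implicit Types (beta h x y m a b c : R) (p n : nat).

Lemma crit_one_sided beta h p : (2 < p)%N -> 0 <= beta -> p_critical beta h p ->
  (forall x, is_global_max beta h p x -> one_sided p x) ->
  exists a b, [/\ a < b,
    forall x, is_global_max beta h p x <-> x = a \/ x = b,
    ddH beta p a < 0 & ddH beta p b < 0].
Proof.
move=> p2 b0 [m [m' [mm' hm hm']]] os.
have [a [b [ab ha hb]]] : exists a b, [/\ a < b, is_global_max beta h p a &
    is_global_max beta h p b].
  by move: mm'; rewrite neq_lt => /orP[?|?]; [exists m, m'|exists m', m].
exists a, b; have [da db] := two_max_ddH p2 b0 (os a ha) ab ha hb.
split => // x; split; last by case=> ->.
move=> hx; have [xa|ax|->] := ltgtP x a; last by left.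
  by have := three_max_false p2 b0 (os x hx) xa ab hx ha hb.
have [xb|bx|->] := ltgtP x b; last by right.
  by have := three_max_false p2 b0 (os a ha) ax xb ha hx hb.
by have := three_max_false p2 b0 (os a ha) ab bx ha hb hx.
Qed.

Lemma global_maxN beta h p x : ~~ odd p ->
  is_global_max beta h p x -> is_global_max beta (- h) p (- x).
Proof.
move=> podd [x1 xmax]; split.
  by move: x1; rewrite !in_itv /= => /andP[? ?]; lra.
move=> y y1; rewrite -!(HN beta h _ podd) opprK; apply: xmax.
by move: y1; rewrite !in_itv /= => /andP[? ?]; lra.
Qed.

Lemma ddHN beta p x : (2 < p)%N -> ~~ odd p -> ddH beta p (- x) = ddH beta p x.
Proof.
case: p => [|[|[|n]]] // _; rewrite /= !negbK => nodd.
rewrite /ddH /= sqrrN; congr (_ * (_ * (_ * _)) - _).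
by rewrite exprNn -signr_odd /= nodd expr0 mul1r.
Qed.

Lemma dH0h beta h p : (2 < p)%N -> dH beta h p 0 = h.
Proof.
case: p => [|[|[|n]]] // _.
by rewrite /dH /= [1 + 0]addr0 subr0 ln1 subrr mulr0 subr0 exprS mul0r !mulr0 add0r.
Qed.

(** By evenness [H x - H (- x) = 2 * h * x], so no maximizer is negative, and [0] is excluded by
    [H'(0) = h]. *)
Lemma crit_even_pos beta h p : (2 < p)%N -> ~~ odd p -> 0 <= beta -> 0 < h ->
  p_critical beta h p -> exists a b, [/\ a < b, 0 < a,
    forall x, is_global_max beta h p x <-> x = a \/ x = b,
    ddH beta p a < 0 & ddH beta p b < 0].
Proof.
move=> p2 podd b0 h0 crit.
have pos x : is_global_max beta h p x -> 0 < x.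
  move=> hx; rewrite ltNge; apply/negP => x0.
  have [x1 xmax] := hx.
  have := xmax (- x); rewrite HN//.
  have -> : - x \in `[-1, 1] by move: x1; rewrite !in_itv /= => /andP[? ?]; lra.
  move=> /(_ isT); rewrite /H => hle.
  have xz : x = 0 by nra.
  by have := global_max_dH hx; rewrite xz dH0h// => hz; lra.
have [|a [b [ab iff da db]]] := crit_one_sided p2 b0 crit.
  by move=> x /pos /ltW; rewrite /one_sided orbC => ->.
by exists a, b; split => //; apply: pos; apply/iff; left.
Qed.

Lemma crit_even_neg beta h p : (2 < p)%N -> ~~ odd p -> 0 <= beta -> h < 0 ->
  p_critical beta h p -> exists a b, [/\ a < b, b < 0,
    forall x, is_global_max beta h p x <-> x = a \/ x = b,
    ddH beta p a < 0 & ddH beta p b < 0].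
Proof.
move=> p2 podd b0 h0 [m [m' [mm' hm hm']]].
have crit : p_critical beta (- h) p.
  by exists (- m), (- m'); split; rewrite ?eqr_opp//; exact: global_maxN.
have [|a [b [ab a0 iff da db]]] := crit_even_pos p2 podd b0 _ crit; first by lra.
exists (- b), (- a); split; rewrite ?ddHN//; [lra|lra|].
move=> x; split.
  by move=> /(global_maxN podd) /iff [e|e]; [right|left]; rewrite -e opprK.
move=> e; rewrite -[x]opprK -[h]opprK; apply: global_maxN => //.
by apply/iff; case: e => ->; rewrite opprK; [right|left].
Qed.

Lemma crit_even_zero beta p : (2 < p)%N -> ~~ odd p -> 0 <= beta ->
  p_critical beta 0 p -> exists m, [/\ 0 < m, is_global_max beta 0 p m,
    is_global_max beta 0 p (- m),
    forall x, is_global_max beta 0 p x -> x = 0 \/ x = m \/ x = - m &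
    ddH beta p m < 0].
Proof.
move=> p2 podd b0 [m [m' [mm' hm hm']]].
have sym x : is_global_max beta 0 p x -> is_global_max beta 0 p (- x).
  by move=> /(global_maxN podd); rewrite oppr0.
have [a [a0 ha]] : exists a, 0 < a /\ is_global_max beta 0 p a.
  have [m0|m0|m0] := ltgtP m 0.
  - by exists (- m); rewrite oppr_gt0; split => //; exact: sym.
  - by exists m.
  - rewrite m0 in mm'; move: mm'; rewrite eq_sym neq_lt => /orP[?|?].
      by exists (- m'); rewrite oppr_gt0; split => //; exact: sym.
    by exists m'.
have uniq b : 0 < b -> is_global_max beta 0 p b -> b = a.
  move=> bb hb; have [ba|ab|//] := ltgtP b a.
    by have := pos_max_uniq p2 bb hb ha ba.
  by have := pos_max_uniq p2 a0 ha hb ab.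
exists a; split => //; first exact: sym.
- move=> x hx; have [x0|x0|->] := ltgtP x 0; [right; right|right; left|by left].
    by rewrite -(uniq (- x)) ?opprK ?oppr_gt0//; exact: sym.
  exact: uniq.
- exact: pos_max_ddH ha.
Qed.

(** Two maximizers force [beta > 0], so that [H x < H (- x)] for [x < 0] and no maximizer is
    negative; since at most one is positive, the smaller one is [0]. *)
Lemma crit_odd_zero beta p : (2 < p)%N -> odd p -> 0 <= beta ->
  p_critical beta 0 p -> exists b, [/\ 0 < b,
    forall x, is_global_max beta 0 p x <-> x = 0 \/ x = b &
    ddH beta p b < 0].
Proof.
move=> p2 podd b0 crit.
have [|a [b [ab iff da db]]] := crit_one_sided p2 b0 crit.
  by move=> x _; rewrite /one_sided podd.
have ha : is_global_max beta 0 p a by apply/iff; left.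
have hb : is_global_max beta 0 p b by apply/iff; right.
have bpos : 0 < beta by rewrite lt_neqAle b0 eq_sym (two_max_beta ab ha hb).
have ge0 x : is_global_max beta 0 p x -> 0 <= x.
  move=> [x1 xmax]; rewrite leNgt; apply/negP => x0.
  have := xmax (- x).
  have -> : - x \in `[-1, 1] by move: x1; rewrite !in_itv /= => /andP[? ?]; lra.
  move=> /(_ isT); rewrite /H entropyIN exprNn -signr_odd podd expr1 mulN1r.
  have : 0 < (- x) ^+ p by rewrite exprn_gt0// oppr_gt0.
  rewrite exprNn -signr_odd podd expr1 mulN1r => xp.
  have := mulr_gt0 bpos xp; lra.
have a0 : a = 0.
  apply/eqP; rewrite eq_le ge0// andbT leNgt; apply/negP => a0.
  exact: (pos_max_uniq p2 a0 ha hb ab).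
by rewrite {}a0 in ab iff *; exists b.
Qed.

Lemma sup_H_eq0 b p : (0 < p)%N ->
  sup [set H b 0 p x | x in `[-1, 1]] = 0 <->
  (forall x, x \in `[-1, 1] -> H b 0 p x <= 0).
Proof.
move=> p0.
have i0 : (0 : R) \in `[-1, 1] by rewrite in_itv /=; lra.
have H00 := H0 b 0 p0.
have hub : has_ubound [set H b 0 p x | x in `[-1, 1]].
  have [|c _ cmax] := @EVT_max R (H b 0 p) (-1) 1 ltac:(lra).
    by apply: continuous_subspaceT; exact: continuous_H.
  by exists (H b 0 p c) => _ [x /= xi <-]; exact: cmax.
have in0 : [set H b 0 p x | x in `[-1, 1]] 0 by exists 0.
split=> [s0 x xi|hle].
  by rewrite -[leRHS]s0; apply: ub_le_sup => //; exists x.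
apply/eqP; rewrite eq_le; apply/andP; split.
  by apply: ge_sup; [exists 0|move=> _ [x /= xi <-]; exact: hle].
exact: ub_le_sup.
Qed.

(** The bound [ln 2] comes from [x = 1], where [H] equals [b - ln 2]. *)
Lemma beta_tilde_ubound p : (0 < p)%N -> has_ubound
  [set b : R | 0 <= b /\ sup [set H b 0 p x | x in `[-1, 1]] = 0].
Proof.
move=> p0; exists (ln 2) => b [b0 /(sup_H_eq0 _ p0) hle].
have := hle 1; rewrite in_itv /= lexx andbT.
have -> : -1 <= 1 :> R by lra.
by move=> /(_ isT); rewrite /H entropyI1 expr1n mul0r; lra.
Qed.

Lemma beta_tilde_nonempty p : (0 < p)%N ->
  [set b : R | 0 <= b /\ sup [set H b 0 p x | x in `[-1, 1]] = 0] 0.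
Proof.
move=> p0; split => //; apply/(sup_H_eq0 _ p0) => x; rewrite in_itv /= => x1.
by rewrite /H !mul0r add0r sub0r oppr_le0 entropyI_ge0.
Qed.

Lemma global_max0_le b p x : (0 < p)%N -> is_global_max b 0 p 0 ->
  x \in `[-1, 1] -> H b 0 p x <= 0.
Proof. by move=> p0 [_ hmax] xi; rewrite -[leRHS](H0 b 0 p0); exact: hmax. Qed.

Lemma beta_tilde_ge b p : (0 < p)%N -> 0 <= b -> is_global_max b 0 p 0 ->
  b <= beta_tilde p.
Proof.
move=> p0 b0 hb; apply: ub_le_sup; first exact: beta_tilde_ubound.
by split => //; apply/(sup_H_eq0 _ p0) => x; exact: global_max0_le.
Qed.

(** Equal values at [0] and [m] mean [beta * m ^ p = I m], whereas every [b] in the set defining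
    [beta_tilde] satisfies [b * m ^ p <= I m]. *)
Lemma beta_tilde_eq beta p m : (0 < p)%N -> 0 <= beta -> 0 < m ->
  is_global_max beta 0 p 0 -> is_global_max beta 0 p m -> beta = beta_tilde p.
Proof.
move=> p0 b0 m0 h0 hm; apply/eqP; rewrite eq_le beta_tilde_ge//=.
apply: ge_sup; first by exists 0; exact: beta_tilde_nonempty.
move=> b [_ /(sup_H_eq0 _ p0) hle].
have [mi _] := hm.
have := hle m mi; have := global_max_eq h0 hm; rewrite H0// /H => h1 h2.
have mp : 0 < m ^+ p by rewrite exprn_gt0.
rewrite -(ler_pM2r mp); lra.
Qed.

(** A positive value at [x] would make [I x / x ^ p] an upper bound of the defining set smaller than
    its supremum; evenness gives [x ^ p > 0]. *)
Lemma beta_tilde_max0 p : (0 < p)%N -> ~~ odd p -> is_global_max (beta_tilde p) 0 p (0 : R).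
Proof.
move=> p0 podd; split; first by rewrite in_itv /=; lra.
move=> x xi; rewrite H0// leNgt; apply/negP => Hx.
have x0 : x != 0 by apply/eqP => x0; move: Hx; rewrite x0 H0// ltxx.
have xp : 0 < x ^+ p by rewrite exprn_even_gt0// x0 orbT.
have : beta_tilde p <= entropyI x / x ^+ p.
  apply: ge_sup; first by exists 0; exact: beta_tilde_nonempty.
  move=> b [_ /(sup_H_eq0 _ p0) hle]; rewrite ler_pdivlMr//.
  by have := hle x xi; rewrite /H; lra.
rewrite ler_pdivlMr//; move: Hx; rewrite /H; lra.
Qed.

Lemma seq_nearest (ms : seq R) x : ms != [::] -> exists2 m, m \in ms &
  forall m', m' \in ms -> `|x - m| <= `|x - m'|.
Proof.
elim: ms => // a [_ _|b s ih _].
  by exists a; rewrite ?inE// => m'; rewrite inE => /eqP ->.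
have [//|m ms mle] := ih.
have [am|ma] := leP `|x - a| `|x - m|.
  exists a; first by rewrite inE eqxx.
  move=> m'; rewrite inE => /orP[/eqP -> //|/mle]; exact: le_trans.
exists m; first by rewrite inE ms orbT.
by move=> m'; rewrite inE => /orP[/eqP -> |/mle//]; exact: ltW.
Qed.

Lemma local_quad_bound beta h p (ms : seq R) :
  (forall m, m \in ms -> is_global_max beta h p m /\ ddH beta p m < 0) ->
  exists d c, [/\ 0 < d, 0 < c & forall m x, m \in ms -> `|x - m| < d ->
    H beta h p x - H beta h p m <= - c * (x - m) ^+ 2].
Proof.
elim: ms => [_|a s ih hs]; first by exists 1, 1.
have [m ms|d [c [d0 c0 hdc]]] := ih; first by apply: hs; rewrite inE ms orbT.
have [ha da] := hs a (mem_head _ _).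
(* Half of the Taylor coefficient [- H'' / 2] is given up to the remainder; the other half is the
   rate. *)
have e0 : 0 < - ddH beta p a / 4 by rewrite divr_gt0// oppr_gt0.
have /nbhs_ballP[d' /= d'0 hd'] := taylor_H (global_max_itv ha) (global_max_dH ha) e0.
exists (Num.min d d'), (Num.min c (- ddH beta p a / 4)).
split; rewrite ?lt_min ?d0 ?c0//.
move=> m x; rewrite inE lt_min => /orP[/eqP -> {m}|ms] /andP[xd xd'].
  have := hd' x; rewrite /ball /= distrC => /(_ xd').
  rewrite ler_norml => /andP[_ T].
  have : Num.min c (- ddH beta p a / 4) * (x - a) ^+ 2 <= - ddH beta p a / 4 * (x - a) ^+ 2.
    by rewrite ler_wpM2r ?sqr_ge0// ge_min lexx orbT.
  lra.
have := hdc m x ms xd.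
have : Num.min c (- ddH beta p a / 4) * (x - m) ^+ 2 <= c * (x - m) ^+ 2.
  by rewrite ler_wpM2r ?sqr_ge0// ge_min lexx.
lra.
Qed.

(** The parabola has to be centred at the nearest maximizer, since one centred at a fixed maximizer
    fails at the others. On the compact set [K] of points far from all maximizers, [H] is below its
    maximum by some [e], and [(x - m) ^ 2 <= 4] turns this gap into the rate [e / 4]. *)
Lemma quad_bound beta h p (ms : seq R) : ms != [::] ->
  (forall x, x \in ms <-> is_global_max beta h p x) ->
  (forall m, m \in ms -> ddH beta p m < 0) ->
  exists2 c, 0 < c & forall x m, -1 <= x <= 1 -> m \in ms ->
    (forall m', m' \in ms -> `|x - m| <= `|x - m'|) ->
    H beta h p x - H beta h p m <= - c * (x - m) ^+ 2.
Proof.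
move=> ms0 hms dms.
have [|d [c [d0 c0 hdc]]] := @local_quad_bound beta h p ms.
  by move=> m mms; split; [exact/hms|exact: dms].
have [m0 m0ms _] := seq_nearest 0 ms0.
have [m0i m0max] := (hms m0).1 m0ms.
pose K : set R := `[-1, 1]%classic `&` \bigcap_(m in [set` ms]) ((fun x : R => `|x - m|) @^-1` [set y | d <= y]).
have cK : compact K.
  have clK : closed K.
    apply: closedI; first exact: itv_closed.
    apply: closed_bigI => m _.
    have ctn : continuous (fun x : R => `|x - m|).
      move=> x; have xm : (y - m) @[y --> x] --> x - m.
        by apply: cvgB; [exact: cvg_id|exact: cvg_cst].
      exact: (cvg_comp (fun y => y - m) _ xm (@norm_continuous R R (x - m))).
    by apply: closed_comp; [move=> x _; exact: ctn|exact: closed_ge].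
  by apply: (subclosed_compact clK (@segment_compact R (-1) 1)) => x [].
have [e e0 he] : exists2 e, 0 < e & forall x, K x -> H beta h p x - H beta h p m0 <= - e.
  have [K0|/set0P K0] := eqVneq K set0; first by exists 1 => // x; rewrite K0.
  have [|x Kx xmax] := @compact_EVT_max _ R (H beta h p) K K0 cK.
    by apply: continuous_subspaceT; exact: continuous_H.
  rewrite inE in Kx; have [x1 xms] := Kx.
  exists (H beta h p m0 - H beta h p x).
    rewrite subr_gt0 lt_neqAle m0max// andbT; apply/eqP => xE.
    have xm : x \in ms by apply/hms; split => // y yi; rewrite xE; exact: m0max.
    by have := xms x xm; rewrite /= subrr normr0 leNgt d0.
  by move=> y Ky; have := xmax y; rewrite inE => /(_ Ky); lra.
have Hm m : m \in ms -> H beta h p m = H beta h p m0.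
  by move=> /hms mm; apply: global_max_eq mm _; exact/hms.
exists (Num.min c (e / 4)); first by rewrite lt_min c0 divr_gt0.
move=> x m xi mms mle.
have s0 := sqr_ge0 (x - m).
case: (pselect (K x)) => [Kx|nK].
  have := he x Kx; rewrite (Hm m mms) => hx.
  have [/andP[m1 m2] _] := (hms m).1 mms.
  have x2 : (x - m) ^+ 2 <= 4.
    move: xi m1 m2 => /andP[x1 x2]; rewrite ?bnd_simp => m1 m2; nra.
  have : Num.min c (e / 4) * (x - m) ^+ 2 <= e / 4 * (x - m) ^+ 2.
    by rewrite ler_wpM2r// ge_min lexx orbT.
  nra.
have [m' [m'ms xm']] : exists m', m' \in ms /\ `|x - m'| < d.
  apply: contrapT => hn; apply: nK; split; first by rewrite /= in_itv.
  move=> m' m'ms /=; rewrite leNgt; apply/negP => lt; apply: hn.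
  by exists m'.
have h1 := hdc m' x m'ms xm'; rewrite (Hm m' m'ms) in h1; rewrite (Hm m mms).
(* The bound is known at a maximizer [m'] close to [x]; it passes to [m], which is at least as close
   and has the same value of [H]. *)
have h2 : (x - m) ^+ 2 <= (x - m') ^+ 2.
  rewrite -[leLHS]real_normK ?num_real// -[leRHS]real_normK ?num_real//.
  by rewrite lerXn2r ?nnegrE// mle.
have : Num.min c (e / 4) * (x - m) ^+ 2 <= c * (x - m') ^+ 2.
  apply: ler_pM => //; last by rewrite ge_min lexx.
  by rewrite le_min ltW//= divr_ge0// ltW.
lra.
Qed.

End classification.

(** * Gaussian integrals *)

Section gaussian.
Context {R : realType}.
Implicit Types (a b t x y z : R) (n : nat).
Local Notation mu := (@lebesgue_measure R).

(* [a] is the inverse of the variance. *)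
Definition gint a (Phi : R -> R) : R :=
  \int[mu]_y (Phi y * expR (- (a / 2) * y ^+ 2)).

Definition gintegrable a (Phi : R -> R) :=
  mu.-integrable [set: R] (fun y => (Phi y * expR (- (a / 2) * y ^+ 2))%:E).

Definition gmass a : R := Num.sqrt (2 * pi / a).

Lemma gmass_gt0 a : 0 < a -> 0 < gmass a.
Proof. by move=> a0; rewrite sqrtr_gt0 divr_gt0// mulr_gt0// pi_gt0. Qed.

(** Completing the square: tilting the centred Gaussian of variance [1 / a] by [exp (t * y)] moves
    its mean to [t / a]. *)
Lemma normal_pdf_gauss a t y : 0 < a ->
  normal_pdf (t / a) (Num.sqrt a^-1) y =
  (gmass a)^-1 * expR (- (t ^+ 2 / (2 * a))) * expR (t * y) * expR (- (a / 2) * y ^+ 2).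
Proof.
move=> a0.
have s0 : Num.sqrt a^-1 != 0 by rewrite gt_eqF// sqrtr_gt0 invr_gt0.
rewrite normal_pdfE// /normal_peak /normal_fun sqr_sqrtr ?invr_ge0 ?ltW//.
rewrite -!mulrA -!expRD; congr (_ * expR _).
  by rewrite /gmass; congr (Num.sqrt _)^-1; rewrite -mulr_natr; field; rewrite gt_eqF.
by rewrite -mulr_natr; field; rewrite gt_eqF.
Qed.

Lemma gintE a (Phi : R -> R) : gintegrable a Phi ->
  (\int[mu]_y (Phi y * expR (- (a / 2) * y ^+ 2))%:E)%E = (gint a Phi)%:E.
Proof. by move=> h; rewrite /gint /Rintegral fineK//; exact: integrable_fin_num. Qed.

Lemma gint_exp a t : 0 < a ->
  gintegrable a (fun y => expR (t * y)) /\
  gint a (fun y => expR (t * y)) = gmass a * expR (t ^+ 2 / (2 * a)).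
Proof.
move=> a0.
pose K := gmass a * expR (t ^+ 2 / (2 * a)).
have KE y : expR (t * y) * expR (- (a / 2) * y ^+ 2) =
    K * normal_pdf (t / a) (Num.sqrt a^-1) y.
  rewrite normal_pdf_gauss// /K.
  set g := gmass a; set u := expR (t * y); set v := expR (- (a / 2) * y ^+ 2).
  rewrite expRN; field.
  by rewrite !gt_eqF ?expR_gt0// /g gmass_gt0.
have ig : gintegrable a (fun y => expR (t * y)).
  rewrite /gintegrable; under eq_fun do rewrite KE EFinM.
  by apply: integrableZl => //; exact: integrable_normal_pdf.
split => //; apply: EFin_inj; rewrite -gintE//.
under eq_integral do rewrite KE EFinM.
rewrite integralZl//; last exact: integrable_normal_pdf.
by rewrite integral_normal_pdf mule1.
Qed.

Lemma gint1 a : 0 < a -> gint a (fun=> 1) = gmass a.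
Proof.
move=> a0; have [_] := @gint_exp a 0 a0.
rewrite expr0n mul0r expR0 mulr1 => <-; congr (gint a _).
by apply/funext => y; rewrite mul0r expR0.
Qed.

Lemma gint_indic a (A : set R) : 0 < a -> measurable A ->
  gintegrable a (\1_A) /\
  gint a (\1_A) = gmass a * fine (normal_prob 0 (Num.sqrt a^-1) A).
Proof.
move=> a0 mA.
have gE y : expR (- (a / 2) * y ^+ 2) = gmass a * normal_pdf 0 (Num.sqrt a^-1) y.
  have := @normal_pdf_gauss a 0 y a0; rewrite !mul0r expr0n mul0r oppr0 expR0 !mulr1 => ->.
  by rewrite mulVKf// gt_eqF// gmass_gt0.
have i1 : mu.-integrable [set: R] (fun y => ((\1_A y) * normal_pdf 0 (Num.sqrt a^-1) y)%:E).
  apply: (le_integrable _ _ _ (@integrable_normal_pdf R 0 (Num.sqrt a^-1))) => //.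
    apply/measurable_EFinP; apply: measurable_funM; first exact: measurable_indic.
    exact: measurable_normal_pdf.
  move=> y _; rewrite lee_fin normrM indicE.
  by case: (y \in A); rewrite ?normr1 ?mul1r// normr0 mul0r.
have fE y : \1_A y * expR (- (a / 2) * y ^+ 2) =
    gmass a * ((\1_A y) * normal_pdf 0 (Num.sqrt a^-1) y).
  by rewrite gE mulrCA.
have ig : gintegrable a (\1_A).
  rewrite /gintegrable; under eq_fun do rewrite fE EFinM.
  exact: integrableZl.
split => //; apply: EFin_inj; rewrite -gintE//.
under eq_integral do rewrite fE EFinM.
rewrite integralZl// [RHS]EFinM fineK; last exact: fin_num_measure.
congr (_ * _)%E.
rewrite /normal_prob [RHS]integral_mkcond/=; apply: eq_integral => y _.
by rewrite patchE indicE; case: ifPn => yA; rewrite ?mul1r ?mul0r.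
Qed.

(* The map e |-> gint a (fun y => expR ((t + e) * y)) lies above its tangent
   of slope gint a (fun y => y * expR (t * y)) at 0, so that this slope is its
   derivative there. *)
Lemma gint_id_exp a t : 0 < a -> gintegrable a (fun y => y * expR (t * y)) ->
  gint a (fun y => y * expR (t * y)) = t / a * gint a (fun y => expR (t * y)).
Proof.
move=> a0 ig.
have [it Et] := @gint_exp a t a0.
set L := gint a (fun y => y * expR (t * y)).
pose f (e : R) := gmass a * expR ((t + e) ^+ 2 / (2 * a)) - e * L.
have fmin e : f 0 <= f e.
  rewrite /f mul0r subr0 addr0 -Et.
  have [ie <-] := @gint_exp a (t + e) a0.
  rewrite lerBrDr -lee_fin EFinD EFinM -!gintE//.
  rewrite -integralZl// -integralD//; last exact: integrableZl.
  apply: le_integral => //.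
    by apply: integrableD => //; exact: integrableZl.
  move=> y _; rewrite -EFinM -EFinD lee_fin.
  have -> : expR (t * y) * expR (- (a / 2) * y ^+ 2) +
      e * (y * expR (t * y) * expR (- (a / 2) * y ^+ 2)) =
    (1 + e * y) * (expR (t * y) * expR (- (a / 2) * y ^+ 2)) by ring.
  have -> : expR ((t + e) * y) * expR (- (a / 2) * y ^+ 2) =
    expR (e * y) * (expR (t * y) * expR (- (a / 2) * y ^+ 2)).
    by rewrite mulrDl expRD; ring.
  rewrite ler_wpM2r ?mulr_ge0 ?expR_ge0//.
  exact: expR_ge1Dx.
have df e : is_derive e (1 : R) f
    (gmass a * (expR ((t + e) ^+ 2 / (2 * a)) * ((t + e) / a)) - L).
  have d1 : is_derive e (1 : R) (fun e => (t + e) ^+ 2 / (2 * a)) ((t + e) / a).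
    have d0 : is_derive e (1 : R) (fun e => t + e) 1.
      by apply: (is_derive_eq (is_deriveD (is_derive_cst t e 1) (is_derive_id e 1))); rewrite add0r.
    have d2 := @is_derive1_comp R (fun y => y ^+ 2) (fun e => t + e) e _ _ (is_derive_exprn 2 (t + e)) d0.
    apply: (is_derive_eq (is_deriveM d2 (is_derive_cst (2 * a)^-1 e 1))).
    rewrite /GRing.scale /=.
    by field; rewrite gt_eqF.
  have d2 := @is_derive1_comp R expR (fun e => (t + e) ^+ 2 / (2 * a)) e _ _ (is_derive_expR _) d1.
  rewrite /f; apply: is_derive_eq.
  by rewrite /GRing.scale /=; ring.
have [_] : is_derive (0 : R) (1 : R) f 0.
  apply: (@derive1_at_min R f (-1) 1 0) => //.
  by rewrite in_itv /= ltrN10 ltr01.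
have [_ ->] := df 0; rewrite addr0 => h.
rewrite Et; have -> : L = gmass a * (expR (t ^+ 2 / (2 * a)) * (t / a)) by lra.
by ring.
Qed.

(** The density is a Radon-Nikodym derivative of the normal law, and such a derivative is unique
    only almost everywhere, whence the detour through [ae_eq_integral]. *)
Lemma integral_normal_prob a (f : R -> R) : 0 < a ->
  measurable_fun [set: R] f -> gintegrable a f ->
  (\int[normal_prob 0 (Num.sqrt a^-1)]_y `|(f y)%:E| < +oo)%E ->
  (\int[normal_prob 0 (Num.sqrt a^-1)]_y (f y)%:E)%E = ((gmass a)^-1 * gint a f)%:E.
Proof.
move=> a0 mf ig finf.
have gE y : normal_pdf 0 (Num.sqrt a^-1) y = (gmass a)^-1 * expR (- (a / 2) * y ^+ 2).
  by have := @normal_pdf_gauss a 0 y a0; rewrite !mul0r expr0n mul0r oppr0 expR0 !mulr1 => ->.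
have dom := @normal_prob_dominates R 0 (Num.sqrt a^-1).
transitivity (\int[mu]_y ((f y)%:E * (normal_pdf 0 (Num.sqrt a^-1) y)%:E))%E; last first.
  under eq_integral do rewrite -EFinM gE mulrCA EFinM.
  by rewrite integralZl// EFinM gintE.
rewrite -(Radon_Nikodym_change_of_variables dom)//=; last first.
  by apply/integrableP; split => //; exact/measurable_EFinP.
apply: ae_eq_integral => //.
- apply: emeasurable_funM; first exact/measurable_EFinP.
  apply: (measurable_int mu).
  by apply: Radon_Nikodym_integrable; exact: dom.
- apply: emeasurable_funM; first exact/measurable_EFinP.
  by apply/measurable_EFinP; exact: measurable_normal_pdf.
- apply: ae_eqe_mul2l => /=.
  rewrite Radon_NikodymE//=.
  case: cid => /= g [g1 g2 g3].
  apply: integral_ae_eq => //=.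
  + by apply/measurable_EFinP; exact: measurable_normal_pdf.
  + by move=> E E01 mE; rewrite -g3.
Qed.

End gaussian.

(** * Sums over configurations *)

Section global_laplace.
Context {R : realType}.
Implicit Types (beta h x y m : R) (p n N k : nat) (ms : seq R).
Local Notation mu := (@lebesgue_measure R).

Lemma near_seq_all (s : seq R) (x : R) (P : R -> R -> Prop) :
  (forall m, m \in s -> \forall z \near x, P m z) ->
  \forall z \near x, forall m, m \in s -> P m z.
Proof.
elim: s => [_|a s ih h]; first by near=> z.
have h1 := h a (mem_head _ _).
have h2 : \forall z \near x, forall m, m \in s -> P m z.
  by apply: ih => m ms; apply: h; rewrite inE ms orbT.
near=> z => m; rewrite inE => /orP[/eqP ->|]; first by near: z.
by move: m; near: z.
Unshelve. all: by end_near. Qed.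

Definition nearest_in ms m x := forall m', m' \in ms -> `|x - m| <= `|x - m'|.

(** Up to the factor [2 ^ N * exp (N * Hs)] this is the sum of [F] over configurations with their
    Gibbs weights ([sum_gibbs]). Taking for [Hs] the maximum of [H] gives finite limits. *)
Definition Wsum beta h p (Hs : R) N (F : R -> R) : R :=
  \sum_(k < N.+1) qbin N k *
    expR (N%:R * (H beta h p (spin N k) - Hs)) * F (spin N k).

Record maximizers beta h p ms : Prop := Maximizers {
  max_nil : ms != [::];
  max_uniq : uniq ms;
  max_mem : forall x, x \in ms <-> is_global_max beta h p x;
  max_ddH : forall m, m \in ms -> ddH beta p m < 0 }.

Lemma cvg_Wsum beta h p ms m0 (F : nat -> R -> R) (Phi : R -> R -> R) :
  maximizers beta h p ms -> m0 \in ms ->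
  (forall m, m \in ms -> exists A B, [/\ 0 <= A, 0 <= B &
     forall N x, (0 < N)%N -> -1 <= x <= 1 -> nearest_in ms m x ->
       `|F N x| <= A * expR (B * (Num.sqrt N%:R * `|x - m|))]) ->
  (forall m, m \in ms -> measurable_fun [set: R] (Phi m)) ->
  (forall m, m \in ms -> {ae mu, forall y, forall x_ : nat -> R,
     (\forall N \near \oo, -1 <= x_ N <= 1) ->
     Num.sqrt N%:R * (x_ N - m) @[N --> \oo] --> y ->
     F N (x_ N) @[N --> \oo] --> Phi m y}) ->
  (forall m, m \in ms -> gintegrable (- ddH beta p m) (Phi m)) /\
  Wsum beta h p (H beta h p m0) N (F N) @[N --> \oo] -->
    \sum_(m <- ms) laplace_cst / Num.sqrt (1 - m ^+ 2) *
      gint (- ddH beta p m) (Phi m).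
Proof.
move=> [ms0 ums hms dms] m0ms FA mPhi FPhi.
have [c c0 hc] := quad_bound ms0 hms dms.
(* A choice function breaks ties, so that each lattice point is counted for exactly one
   maximizer. *)
have /choice[asg hasg] : forall x, exists m, m \in ms /\ nearest_in ms m x.
  by move=> x; have [m ? ?] := seq_nearest x ms0; exists m.
have Hm m : m \in ms -> H beta h p m = H beta h p m0.
  by move=> /hms mm; apply: global_max_eq mm _; exact/hms.
have asg_near m : m \in ms -> \forall x \near m, asg x == m.
  move=> mms.
  have : \forall x \near m, forall m', m' \in ms -> m' != m -> `|x - m| < `|x - m'|.
    apply: near_seq_all => m' m'ms.
    have [->|mm'] := eqVneq m' m; first by near=> x.
    have d0 : 0 < `|m - m'| / 2 by rewrite divr_gt0// normr_gt0 subr_eq0 eq_sym.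
    near=> x => _.
    have xm : `|x - m| < `|m - m'| / 2 by rewrite distrC; near: x; exact: nbhsx_ballx.
    have := ler_distD x m m'; rewrite [`|m - x|]distrC; lra.
  apply: filterS => x hx; have [ax /(_ m mms) xle] := hasg x.
  apply: contraT => /(hx _ ax); rewrite ltNge; by rewrite xle.
have key m : m \in ms -> gintegrable (- ddH beta p m) (Phi m) /\
   (\sum_(k < N.+1) qbin N k * expR (N%:R * (H beta h p (spin N k) - H beta h p m)) *
     (asg (spin N k) == m)%:R * F N (spin N k)) @[N --> \oo] -->
   laplace_cst / Num.sqrt (1 - m ^+ 2) * gint (- ddH beta p m) (Phi m).
  move=> mms; have [A [B [A0 B0 FAB]]] := FA m mms.
  have mm := (hms m).1 mms.
  apply: (@cvg_laplace R (H beta h p) (fun x => asg x == m) m (- ddH beta p m) c A B F (Phi m)) => //.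
  - exact: global_max_itv mm.
  - move=> x xi /eqP xm; apply: hc => //.
    by rewrite -xm; have [] := hasg x.
  - exact: asg_near.
  - by move=> e e0; apply: taylor_H => //; [exact: global_max_itv mm|exact: global_max_dH mm].
  - move=> N x N0 xi /eqP xm; apply: FAB => //.
    by rewrite -xm; have [] := hasg x.
  - exact: mPhi.
  - exact: FPhi.
split; first by move=> m /key[].
apply: (cvg_near (cvg_seq_sum _ (fun m mms => (key m mms).2))) => //; near=> N.
rewrite exchange_big /=; apply: eq_bigr => k _.
have [ax _] := hasg (spin N k).
rewrite (bigD1_seq (asg (spin N k)))//= eqxx mulr1 (Hm _ ax) big1_seq ?addr0//.
by move=> m /andP[mneq _]; rewrite eq_sym (negbTE mneq) mulr0 mul0r.
Unshelve. all: by end_near. Qed.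

(** The origin of the weights [p_k]: Stirling's factor [(1 - m ^ 2) ^ (- 1 / 2)] times the mass of a
    Gaussian of variance [- 1 / H''(m)]. *)
Lemma curvE beta h p m : -1 < m < 1 -> ddH beta p m < 0 ->
  (Num.sqrt (1 - m ^+ 2))^-1 * gmass (- ddH beta p m) =
  Num.sqrt (2 * pi) * curv beta h p m.
Proof.
move=> m1 d0; rewrite /curv H2E//.
have m2 : 0 < 1 - m ^+ 2 by move: m1 => /andP[]; nra.
have -> : (m ^+ 2 - 1) * ddH beta p m = (1 - m ^+ 2) * (- ddH beta p m) by ring.
rewrite /gmass sqrtrM ?mulr_ge0 ?pi_ge0// sqrtrV ?oppr_ge0 ?ltW//.
rewrite (sqrtrM (- ddH beta p m)) ?ltW// invfM; ring.
Qed.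

Lemma curv_gt0 beta h p m : -1 < m < 1 -> ddH beta p m < 0 -> 0 < curv beta h p m.
Proof.
move=> m1 d0; rewrite /curv H2E// invr_gt0 sqrtr_gt0.
have -> : (m ^+ 2 - 1) * ddH beta p m = (1 - m ^+ 2) * (- ddH beta p m) by ring.
by rewrite mulr_gt0 ?oppr_gt0//; move: m1 => /andP[]; nra.
Qed.

Lemma sum_curv_gt0 beta h p ms : maximizers beta h p ms ->
  0 < \sum_(m <- ms) curv beta h p m.
Proof.
move=> [ms0 ums hms dms].
have pos m : m \in ms -> 0 < curv beta h p m.
  by move=> mms; apply: curv_gt0 (dms m mms); exact/global_max_itv/hms.
case: ms ms0 pos {ums hms dms} => // a s _ pos; rewrite big_cons ltr_pwDl//.
  exact/pos/mem_head.
by rewrite big_seq sumr_ge0// => m ms; rewrite ltW// pos// inE ms orbT.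
Qed.

Lemma max_weight_sum beta h p ms : maximizers beta h p ms ->
  \sum_(m <- ms) max_weight beta h p ms m = 1.
Proof.
by move=> hms; rewrite /max_weight -mulr_suml divff// gt_eqF// sum_curv_gt0.
Qed.

Lemma max_weight_ge0 beta h p ms m : 0 <= max_weight beta h p ms m.
Proof.
by rewrite divr_ge0 ?invr_ge0 ?sqrtr_ge0// sumr_ge0// => i _; rewrite invr_ge0 sqrtr_ge0.
Qed.

(** The limit law of the magnetization. The event [F N] may move with [N]; [E m] is its limit in the
    scaled variable around [m], where a null set of boundary points is disregarded. *)
Lemma cvg_Wsum_prob beta h p ms m0 (F : nat -> R -> bool) (E : R -> set R) :
  maximizers beta h p ms -> m0 \in ms ->
  (forall m, m \in ms -> measurable (E m)) ->
  (forall m, m \in ms -> {ae mu, forall y, forall x_ : nat -> R,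
     (\forall N \near \oo, -1 <= x_ N <= 1) ->
     Num.sqrt N%:R * (x_ N - m) @[N --> \oo] --> y ->
     \forall N \near \oo, F N (x_ N) = (y \in E m)}) ->
  (Wsum beta h p (H beta h p m0) N (fun x => (F N x)%:R) /
   Wsum beta h p (H beta h p m0) N (fun=> 1)) @[N --> \oo] -->
  \sum_(m <- ms) max_weight beta h p ms m *
    fine (normal_prob 0 (Num.sqrt (- ddH beta p m)^-1) (E m)).
Proof.
move=> hmax m0ms mE FE; have [ms0 ums hms dms] := hmax.
have lap0 := @laplace_cst_gt0 R.
have mi m : m \in ms -> -1 < m < 1 by move=> /hms/global_max_itv.
have W (G : nat -> R -> R) (B : R -> set R) : (forall N x, `|G N x| <= 1) ->
    (forall m, m \in ms -> measurable (B m)) ->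
    (forall m, m \in ms -> {ae mu, forall y, forall x_ : nat -> R,
      (\forall N \near \oo, -1 <= x_ N <= 1) ->
      Num.sqrt N%:R * (x_ N - m) @[N --> \oo] --> y ->
      G N (x_ N) @[N --> \oo] --> (\1_(B m) y : R)}) ->
    Wsum beta h p (H beta h p m0) N (G N) @[N --> \oo] -->
    laplace_cst * Num.sqrt (2 * pi) * \sum_(m <- ms) curv beta h p m *
      fine (normal_prob 0 (Num.sqrt (- ddH beta p m)^-1) (B m)).
  move=> G1 mB GB.
  have [||_] := @cvg_Wsum beta h p ms m0 G (fun m => \1_(B m)) hmax m0ms _ _ GB.
  - move=> m mms; exists 1, 0; split => // N x _ _ _.
    by rewrite mul0r expR0 mulr1.
  - by move=> m mms; apply: measurable_indic; exact: mB.
  congr (_ --> _); rewrite mulr_sumr big_seq [RHS]big_seq; apply: eq_bigr => m mms.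
  have a0 : 0 < - ddH beta p m by rewrite oppr_gt0 dms.
  have [_ ->] := gint_indic a0 (mB m mms).
  have := curvE h (mi m mms) (dms m mms).
  set u := (Num.sqrt _)^-1; set v := gmass _; set w := curv _ _ _ _ => uv.
  rewrite mulrA -[_ * u * v]mulrA uv; ring.
have W1 : Wsum beta h p (H beta h p m0) N (fun=> 1) @[N --> \oo] -->
    laplace_cst * Num.sqrt (2 * pi) * \sum_(m <- ms) curv beta h p m.
  have := W (fun _ _ => 1) (fun=> setT).
  rewrite normr1; under eq_bigr do rewrite probability_setT mulr1.
  apply => //.
  by move=> m mms; apply: aeW => y x_ _ _; rewrite indicT; exact: cvg_cst.
have WF : Wsum beta h p (H beta h p m0) N (fun x => (F N x)%:R) @[N --> \oo] -->
    laplace_cst * Num.sqrt (2 * pi) * \sum_(m <- ms) curv beta h p m *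
      fine (normal_prob 0 (Num.sqrt (- ddH beta p m)^-1) (E m)).
  apply: (W (fun N x => (F N x)%:R)) => //.
    by move=> N x; case: (F N x); rewrite ?normr1 ?normr0.
  move=> m mms; move: (FE m mms).
  apply: (@filterS _ _ (ae_filter_ringOfSetsType mu)) => y Fy x_ x1 xy.
  apply: (@cvg_near R (fun=> (\1_(E m) y : R))); first exact: cvg_cst.
    by have := Fy x_ x1 xy; apply: filterS => N ->; rewrite indicE.
  by [].
have S0 := sum_curv_gt0 hmax.
have K0 : 0 < laplace_cst * Num.sqrt (2 * pi) :> R.
  by rewrite mulr_gt0// sqrtr_gt0 mulr_gt0// pi_gt0.
have : (Wsum beta h p (H beta h p m0) N (fun x => (F N x)%:R) *
   (Wsum beta h p (H beta h p m0) N (fun=> 1))^-1) @[N --> \oo] -->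
   (laplace_cst * Num.sqrt (2 * pi) * \sum_(m <- ms) curv beta h p m *
      fine (normal_prob 0 (Num.sqrt (- ddH beta p m)^-1) (E m))) *
   (laplace_cst * Num.sqrt (2 * pi) * \sum_(m <- ms) curv beta h p m)^-1.
  by apply: cvgM => //; apply: cvgV => //; rewrite gt_eqF// mulr_gt0.
congr (_ --> _); rewrite /max_weight.
rewrite invfM mulrACA divff ?gt_eqF// mul1r mulr_suml.
by apply: eq_bigr => m _; rewrite mulrAC.
Qed.

End global_laplace.

(** * From configurations to magnetizations *)

Section config_sum.
Context {R : realType}.
Implicit Types (beta h b x y m : R) (p n N k : nat).

Lemma magE N (sigma : config N) : (0 < N)%N ->
  mag sigma = spin N #|[set i | sigma i]%SET| :> R.
Proof.
move=> N0; rewrite /mag /spin.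
have n0 : N%:R != 0 :> R by rewrite pnatr_eq0 -lt0n.
suff -> : \sum_(i < N) (-1) ^+ sigma i = N%:R - 2 * #|[set i | sigma i]%SET|%:R :> R.
  by field.
have -> : \sum_(i < N) (-1) ^+ sigma i = \sum_(i < N) (1 - 2 * (sigma i)%:R) :> R.
  by apply: eq_bigr => i _; case: (sigma i) => /=; rewrite ?expr1 ?expr0; ring.
rewrite sumrB sumr_const card_ord -mulr_sumr; congr (_ - 2 * _).
rewrite -natr_sum; congr (_%:R).
by rewrite -sum1dep_card [RHS]big_mkcond /=; apply: eq_bigr => i _; case: (sigma i).
Qed.

Lemma sum_config (F : R -> R) N : (0 < N)%N ->
  \sum_(sigma : config N) F (mag sigma) =
  \sum_(k < N.+1) 'C(N, k)%:R * F (spin N k).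
Proof.
move=> N0; under eq_bigr do rewrite magE//.
have cardN (sigma : config N) : (#|[set i | sigma i]%SET| < N.+1)%N.
  by rewrite ltnS -[leqRHS]card_ord max_card.
rewrite (partition_big (fun sigma : config N => Ordinal (cardN sigma)) predT)//=.
apply: eq_bigr => k _.
rewrite (eq_bigr (fun=> F (spin N k))); last first.
  by move=> sigma /eqP <-.
rewrite sumr_const mulr_natl; congr (_ *+ _).
rewrite -[N in 'C(N, _)]card_ord -card_draws.
rewrite -(card_imset _ (f := fun sigma : config N => [set i | sigma i]%SET)); last first.
  move=> s1 s2 /setP e; apply/ffunP => i.
  by have := e i; rewrite !inE.
apply: eq_card => A; rewrite inE; apply/imsetP/idP => [[sigma]|/eqP cA].
  by rewrite unfold_in => /eqP <- -> /=.
exists [ffun i => i \in A].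
  rewrite unfold_in; apply/eqnP; rewrite /= -cA.
  by apply: eq_card => i; rewrite !inE ffunE.
by apply/setP => i; rewrite !inE ffunE.
Qed.

Lemma sum_gibbs beta h p b (F : R -> R) Hs N : (0 < N)%N ->
  \sum_(sigma : config N) gibbs_weight b h p sigma * F (mag sigma) =
  2 ^+ N * expR (N%:R * Hs) *
    Wsum beta h p Hs N (fun x => expR (N%:R * (b - beta) * x ^+ p) * F x).
Proof.
move=> N0; rewrite /gibbs_weight.
rewrite (@sum_config (fun x => expR (N%:R * (b * x ^+ p + h * x)) * F x))//.
rewrite /Wsum mulr_sumr; apply: eq_bigr => k _.
rewrite /qbin /H; set x := spin N k.
have -> : N%:R * (b * x ^+ p + h * x) = N%:R * Hs + N%:R * entropyI x +
  N%:R * (beta * x ^+ p + h * x - entropyI x - Hs) + N%:R * (b - beta) * x ^+ p by ring.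
rewrite !expRD; field.
by rewrite expf_neq0.
Qed.

Lemma gibbs_weight_gt0 b h p N (sigma : config N) : 0 < gibbs_weight b h p sigma :> R.
Proof. exact: expR_gt0. Qed.

Lemma cw_probE b h p N (sigma : config N) : cw_prob b h p sigma =
  gibbs_weight b h p sigma / \sum_(tau : config N) gibbs_weight b h p tau :> R.
Proof. by rewrite /cw_prob /partition_fun mulrA mulfV ?mul1r ?expf_neq0// mulrC. Qed.

Lemma cw_sum beta h p b (F : R -> R) Hs N : (0 < N)%N ->
  \sum_(sigma : config N) cw_prob b h p sigma * F (mag sigma) =
  Wsum beta h p Hs N (fun x => expR (N%:R * (b - beta) * x ^+ p) * F x) /
  Wsum beta h p Hs N (fun x => expR (N%:R * (b - beta) * x ^+ p)).
Proof.
move=> N0; under eq_bigr do rewrite cw_probE mulrAC.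
rewrite -mulr_suml (sum_gibbs beta h p b F Hs)//.
have := sum_gibbs beta h p b (fun=> 1) Hs N0.
under eq_bigr do rewrite mulr1; move=> ->.
have -> : Wsum beta h p Hs N (fun x => expR (N%:R * (b - beta) * x ^+ p) * 1) =
          Wsum beta h p Hs N (fun x => expR (N%:R * (b - beta) * x ^+ p)).
  by rewrite /Wsum; under eq_bigr do rewrite mulr1.
rewrite invfM mulrACA divff ?mul1r// gt_eqF// mulr_gt0 ?expR_gt0// exprn_gt0//.
Qed.

End config_sum.

(** * Sums under the tilted parameter *)

Section tilt.
Context {R : realType}.
Implicit Types (beta h t s a y x m : R) (p n N k : nat) (ms : seq R).
Local Notation mu := (@lebesgue_measure R).

(** The [n]-th power of [x / n <= exp (x / n)]. *)
Lemma pow_le_exp n x : 0 <= x -> x ^+ n <= n%:R ^+ n * expR x.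
Proof.
case: n => [|n] x0; first by rewrite !expr0 mul1r -expR0 ler_expR.
have n0 : 0 < n.+1%:R :> R by rewrite ltr0n.
have -> : expR x = expR (x / n.+1%:R) ^+ n.+1.
  by rewrite -expRM_natl mulrC divfK// gt_eqF.
rewrite -exprMn lerXn2r ?nnegrE ?mulr_ge0 ?expR_ge0//.
rewrite -ler_pdivrMl// mulrC.
by apply: le_trans (expR_ge1Dx _); rewrite lerDr.
Qed.

Lemma sqrt_pow_exp_le k (D : R) : 0 < D -> exists2 C, 0 <= C & forall N, (0 < N)%N ->
  Num.sqrt N%:R ^+ k * expR (- (D * Num.sqrt N%:R)) <= C * (2 / Num.sqrt N%:R).
Proof.
move=> D0; exists (k.+1%:R ^+ k.+1 / D ^+ k.+1 / 2).
  by rewrite !divr_ge0// ?exprn_ge0// ltW.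
move=> N N0.
have r0 : 0 < Num.sqrt N%:R :> R by rewrite sqrtr_gt0 ltr0n.
set r := Num.sqrt _ in r0 *.
have := @pow_le_exp k.+1 (D * r) (mulr_ge0 (ltW D0) (ltW r0)).
rewrite exprMn => h.
rewrite expRN ler_pdivrMr ?expR_gt0// mulrAC.
have -> : k.+1%:R ^+ k.+1 / D ^+ k.+1 / 2 * expR (D * r) * (2 / r) =
   (k.+1%:R ^+ k.+1 * expR (D * r)) / D ^+ k.+1 / r.
  by field; rewrite expf_neq0 ?gt_eqF.
rewrite ler_pdivlMr// ler_pdivlMr ?exprn_gt0// -exprSr mulrC.
exact: h.
Qed.

(** The delta method for [x ^ p]. *)
Lemma cvg_scaled_pow p m y (x_ : nat -> R) :
  (Num.sqrt N%:R * (x_ N - m)) @[N --> \oo] --> y ->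
  (Num.sqrt N%:R * (x_ N ^+ p - m ^+ p)) @[N --> \oo] --> p%:R * m ^+ p.-1 * y.
Proof.
move=> xy; have xm := cvg_scaled xy.
have /is_derive1_caratheodory[g [gE gc <-]] := is_derive_exprn p m.
have gx : g (x_ N) @[N --> \oo] --> g m by exact: (cvg_comp x_ g xm gc).
apply: (cvg_near (cvgM gx xy)) => //; near=> N.
by rewrite /= gE; ring.
Unshelve. all: by end_near. Qed.

Lemma gint0 a : gint a (fun=> 0) = 0.
Proof.
rewrite /gint /Rintegral; under eq_integral do rewrite mul0r.
by rewrite integral0.
Qed.

Lemma gintZ a c (Phi : R -> R) : gintegrable a Phi ->
  gint a (fun y => c * Phi y) = c * gint a Phi.
Proof.
move=> ig; rewrite /gint -RintegralZl//.
by congr Rintegral; apply/funext => y; rewrite mulrA.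
Qed.

(** Since [|y| <= exp y + exp (- y)], the tilts by [t + 1] and [t - 1] dominate. *)
Lemma gintegrable_id_exp a t : 0 < a -> gintegrable a (fun y => y * expR (t * y)).
Proof.
move=> a0.
have [i1 _] := gint_exp (t + 1) a0; have [i2 _] := gint_exp (t - 1) a0.
have i12 := integrableD measurableT i1 i2.
have key (y : R) : `|y * expR (t * y) * expR (- (a / 2) * y ^+ 2)| <=
    `|expR ((t + 1) * y) * expR (- (a / 2) * y ^+ 2) +
      expR ((t - 1) * y) * expR (- (a / 2) * y ^+ 2)|.
  rewrite [leRHS]ger0_norm ?addr_ge0 ?mulr_ge0 ?expR_ge0//.
  rewrite -mulrDl !normrM (ger0_norm (expR_ge0 (t * y))).
  rewrite (ger0_norm (expR_ge0 (- (a / 2) * y ^+ 2))).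
  have -> : expR ((t + 1) * y) + expR ((t - 1) * y) = (expR y + expR (- y)) * expR (t * y).
    by rewrite [RHS]mulrDl -!expRD; congr (expR _ + expR _); ring.
  apply: ler_wpM2r; first exact: expR_ge0.
  apply: ler_wpM2r; first exact: expR_ge0.
  have := expR_ge1Dx y; have := expR_ge1Dx (- y).
  have := expR_ge0 y; have := expR_ge0 (- y).
  by move=> ? ? ? ?; rewrite ler_norml; apply/andP; split; lra.
apply: (le_integrable _ _ _ i12) => //; last first.
  by move=> y _; rewrite -EFinD lee_fin; exact: key.
apply/measurable_EFinP; apply: measurable_funM.
  by apply: measurable_funM => //; apply: measurableT_comp => //.
by apply: measurableT_comp => //; apply: measurable_funM => //; exact: measurable_funX.
Qed.

(** [s] is the value of [m ^ p] at the selected maximizers. Around any other one the tilt carries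
    the factor [exp (- (t * s - t * m ^ p) * sqrt N)], which beats any power of [sqrt N]; a
    polynomial bound on [G] thus suffices there, and these maximizers drop out of the limit. *)
Lemma cvg_tilt beta h p ms m0 t s (G : nat -> R -> R) (g : R -> R -> R) k C :
  maximizers beta h p ms -> m0 \in ms ->
  (forall m, m \in ms -> m ^+ p = s \/ t * m ^+ p < t * s) ->
  0 <= C -> (forall N x, (0 < N)%N -> -1 <= x <= 1 ->
     `|G N x| <= C * Num.sqrt N%:R ^+ k) ->
  (forall m, m \in ms -> m ^+ p = s -> exists A B, [/\ 0 <= A, 0 <= B &
     forall N x, (0 < N)%N -> -1 <= x <= 1 ->
       `|G N x| <= A * expR (B * (Num.sqrt N%:R * `|x - m|))]) ->
  (forall m, m \in ms -> measurable_fun [set: R] (g m)) ->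
  (forall m, m \in ms -> m ^+ p = s -> forall y (x_ : nat -> R),
     (\forall N \near \oo, -1 <= x_ N <= 1) ->
     Num.sqrt N%:R * (x_ N - m) @[N --> \oo] --> y ->
     G N (x_ N) @[N --> \oo] --> g m y) ->
  Wsum beta h p (H beta h p m0) N
    (fun x => expR (t * (Num.sqrt N%:R * (x ^+ p - s))) * G N x) @[N --> \oo] -->
  \sum_(m <- ms) laplace_cst / Num.sqrt (1 - m ^+ 2) *
    gint (- ddH beta p m)
      (fun y => if m ^+ p == s then expR (t * (p%:R * m ^+ p.-1) * y) * g m y else 0).
Proof.
move=> hmax m0ms sep C0 GC GA mg Gg.
have [ms0 ums hms dms] := hmax.
have normm m : m \in ms -> `|m| <= 1.
  by move=> /hms/global_max_itv/andP[? ?]; rewrite ler_norml !ltW.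
have lip m N x : m \in ms -> -1 <= x <= 1 ->
    expR (t * (Num.sqrt N%:R * (x ^+ p - m ^+ p))) <=
    expR (`|t| * p%:R * (Num.sqrt N%:R * `|x - m|)).
  move=> mms xi; rewrite ler_expR; apply: le_trans (ler_norm _) _.
  rewrite !normrM (ger0_norm (sqrtr_ge0 _)) -mulrA ler_wpM2l// mulrCA ler_wpM2l ?sqrtr_ge0//.
  by apply: exprn_lipschitz; [rewrite ler_norml|exact: normm].
have far m N x : m \in ms -> m ^+ p != s -> (0 < N)%N -> -1 <= x <= 1 ->
    `|expR (t * (Num.sqrt N%:R * (x ^+ p - s))) * G N x| <=
    C * (Num.sqrt N%:R ^+ k * expR (- ((t * s - t * m ^+ p) * Num.sqrt N%:R))) *
    expR (`|t| * p%:R * (Num.sqrt N%:R * `|x - m|)).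
  move=> mms ms' N0 xi.
  rewrite normrM ger0_norm ?expR_ge0//.
  have -> : t * (Num.sqrt N%:R * (x ^+ p - s)) =
     t * (Num.sqrt N%:R * (x ^+ p - m ^+ p)) - (t * s - t * m ^+ p) * Num.sqrt N%:R by ring.
  rewrite expRD [leLHS]mulrC [leLHS]mulrA.
  have -> : C * (Num.sqrt N%:R ^+ k * expR (- ((t * s - t * m ^+ p) * Num.sqrt N%:R))) *
    expR (`|t| * p%:R * (Num.sqrt N%:R * `|x - m|)) =
    C * Num.sqrt N%:R ^+ k * expR (`|t| * p%:R * (Num.sqrt N%:R * `|x - m|)) *
    expR (- ((t * s - t * m ^+ p) * Num.sqrt N%:R)) by ring.
  rewrite ler_wpM2r ?expR_ge0// ler_pM ?expR_ge0//; first exact: GC.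
  exact: lip.
apply: (@cvg_Wsum R beta h p ms m0 _ (fun m y => if m ^+ p == s then
    expR (t * (p%:R * m ^+ p.-1) * y) * g m y else 0) hmax m0ms _ _ _).2.
- move=> m mms; have [mseq|mneq] := eqVneq (m ^+ p) s.
    have [A [B [A0 B0 hAB]]] := GA m mms mseq.
    exists A, (`|t| * p%:R + B); split => //; first by rewrite addr_ge0 ?mulr_ge0.
    move=> N x N0 xi _; rewrite normrM ger0_norm ?expR_ge0//.
    rewrite mulrDl expRD [leRHS]mulrCA -mseq; apply: ler_pM; rewrite ?expR_ge0//.
      exact: lip.
    exact: hAB.
  have D0 : 0 < t * s - t * m ^+ p.
    by rewrite subr_gt0; case: (sep m mms) => // e; rewrite e eqxx in mneq.
  have [C' C'0 hC'] := @sqrt_pow_exp_le k _ D0.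
  exists (C * (C' * 2)), (`|t| * p%:R); split; rewrite ?mulr_ge0//.
  move=> N x N0 xi _; apply: le_trans (far m N x mms mneq N0 xi) _.
  rewrite ler_wpM2r ?expR_ge0// ler_wpM2l//.
  apply: le_trans (hC' N N0) _; rewrite ler_wpM2l//.
  rewrite ler_pdivrMr ?sqrtr_gt0 ?ltr0n// ler_peMr//.
  by rewrite -[leLHS]sqrtr1 ler_wsqrtr// ler1n.
- move=> m mms; case: (m ^+ p == s) => //.
  apply: measurable_funM; last exact: mg.
  by apply: measurableT_comp => //; exact: measurable_funM.
- move=> m mms; apply: aeW => y x_ xi xy.
  have [mseq|mneq] := eqVneq (m ^+ p) s.
    apply: cvgM; last exact: Gg.
    apply: (@continuous_cvg _ _ _ _ _ _ (@expR R)); first exact: continuous_expR.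
    rewrite -mulrA; apply: cvgM; first exact: cvg_cst.
    by rewrite -mseq; exact: cvg_scaled_pow.
  have D0 : 0 < t * s - t * m ^+ p.
    by rewrite subr_gt0; case: (sep m mms) => // e; rewrite e eqxx in mneq.
  have [C' C'0 hC'] := @sqrt_pow_exp_le k _ D0.
  have ub : (C * (C' * (2 / Num.sqrt N%:R)) *
     expR (`|t| * p%:R * `|Num.sqrt N%:R * (x_ N - m)|)) @[N --> \oo] -->
     C * (C' * 0) * expR (`|t| * p%:R * `|y|).
    apply: cvgM.
      apply: cvgM; first exact: cvg_cst.
      by apply: cvgM; [exact: cvg_cst|exact: cvg_sqrt_nat_inv].
    apply: (@continuous_cvg _ _ _ _ _ _ (@expR R)); first exact: continuous_expR.
    apply: cvgM; first exact: cvg_cst.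
    exact: cvg_norm.
  rewrite mulr0 mulr0 mul0r in ub.
  apply/cvgrPdist_le => e e0; move/cvgrPdist_le : ub => /(_ e e0).
  apply: filter_app; near=> N => hN.
  have N0 : (0 < N)%N by near: N; exact: nbhs_infty_gt.
  rewrite sub0r normrN; rewrite sub0r normrN in hN.
  apply: le_trans hN.
  apply: le_trans (far m N (x_ N) mms mneq N0 _) _; first by near: N.
  rewrite [leRHS]ger0_norm; last first.
    by rewrite !mulr_ge0 ?expR_ge0// invr_ge0 sqrtr_ge0.
  rewrite normrM (ger0_norm (sqrtr_ge0 _)) ler_wpM2r ?expR_ge0//.
  by rewrite ler_wpM2l//; exact: hC'.
Unshelve. all: by end_near. Qed.

(** When all selected maximizers have the same tilted Gaussian mean [c], their weights cancel in the
    quotient. *)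
Lemma cvg_tilt_ratio beta h p ms m0 t s (G : nat -> R -> R) (g : R -> R -> R) k C c :
  maximizers beta h p ms -> m0 \in ms ->
  (forall m, m \in ms -> m ^+ p = s \/ t * m ^+ p < t * s) ->
  (exists2 m, m \in ms & m ^+ p = s) ->
  0 <= C -> (forall N x, (0 < N)%N -> -1 <= x <= 1 ->
     `|G N x| <= C * Num.sqrt N%:R ^+ k) ->
  (forall m, m \in ms -> m ^+ p = s -> exists A B, [/\ 0 <= A, 0 <= B &
     forall N x, (0 < N)%N -> -1 <= x <= 1 ->
       `|G N x| <= A * expR (B * (Num.sqrt N%:R * `|x - m|))]) ->
  (forall m, m \in ms -> measurable_fun [set: R] (g m)) ->
  (forall m, m \in ms -> m ^+ p = s -> forall y (x_ : nat -> R),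
     (\forall N \near \oo, -1 <= x_ N <= 1) ->
     Num.sqrt N%:R * (x_ N - m) @[N --> \oo] --> y ->
     G N (x_ N) @[N --> \oo] --> g m y) ->
  (forall m, m \in ms -> m ^+ p = s ->
     gint (- ddH beta p m) (fun y => expR (t * (p%:R * m ^+ p.-1) * y) * g m y) =
     c * gint (- ddH beta p m) (fun y => expR (t * (p%:R * m ^+ p.-1) * y))) ->
  (Wsum beta h p (H beta h p m0) N
    (fun x => expR (t * (Num.sqrt N%:R * (x ^+ p - s))) * G N x) /
   Wsum beta h p (H beta h p m0) N
    (fun x => expR (t * (Num.sqrt N%:R * (x ^+ p - s))))) @[N --> \oo] --> c.
Proof.
move=> hmax m0ms sep [j jms js] C0 GC GA mg Gg hc.
have [ms0 ums hms dms] := hmax.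
have c1 := @cvg_tilt beta h p ms m0 t s G g k C hmax m0ms sep C0 GC GA mg Gg.
(* The denominator is the case [G = 1]. *)
have c2 := @cvg_tilt beta h p ms m0 t s (fun _ _ => 1) (fun _ _ => 1) 0 1 hmax m0ms sep ler01.
have {}c2 := c2 _ _ _ _.
pose w m := laplace_cst / Num.sqrt (1 - m ^+ 2) *
  gint (- ddH beta p m) (fun y => if m ^+ p == s then expR (t * (p%:R * m ^+ p.-1) * y) else 0).
have lap0 := @laplace_cst_gt0 R.
have wge m : m \in ms -> 0 <= w m /\ (m ^+ p = s -> 0 < w m).
  move=> mms; have a0 : 0 < - ddH beta p m by rewrite oppr_gt0 dms.
  have l0 : 0 < laplace_cst / Num.sqrt (1 - m ^+ 2).
    rewrite divr_gt0// sqrtr_gt0.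
    by have /andP[] := global_max_itv ((hms m).1 mms); nra.
  rewrite /w; have [mseq|mneq] := eqVneq (m ^+ p) s.
    have [_ ->] := gint_exp (t * (p%:R * m ^+ p.-1)) a0.
    have g0 := gmass_gt0 a0.
    have P : 0 < laplace_cst / Num.sqrt (1 - m ^+ 2) * (gmass (- ddH beta p m) *
        expR ((t * (p%:R * m ^+ p.-1)) ^+ 2 / (2 * - ddH beta p m))).
      by apply: mulr_gt0 => //; rewrite mulr_gt0// expR_gt0.
    by split=> [|_//]; exact: ltW.
  by rewrite gint0 mulr0; split => // e; rewrite e eqxx in mneq.
have W0 : 0 < \sum_(m <- ms) w m.
  rewrite (bigD1_seq j)//= ltr_pwDl ?(wge j jms).2// big_seq_cond sumr_ge0//.
  by move=> m /andP[mms _]; exact: (wge m mms).1.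
have {}c2 : Wsum beta h p (H beta h p m0) N
    (fun x => expR (t * (Num.sqrt N%:R * (x ^+ p - s)))) @[N --> \oo] --> \sum_(m <- ms) w m.
  apply: (cvg_near (c2 _ _ _ _)).
  - by move=> N x _ _; rewrite normr1 expr0 mulr1.
  - by move=> m _ _; exists 1, 0; split => // N x _ _; rewrite normr1 mul0r expR0 mulr1.
  - by move=> m _.
  - by move=> *; exact: cvg_cst.
  - by near=> N; rewrite /Wsum; under eq_bigr do rewrite mulr1.
  - apply: eq_bigr => m _; rewrite /w; congr (_ * gint _ _).
    by apply/funext => y; rewrite mulr1.
rewrite (_ : \sum_(m <- ms) _ = c * \sum_(m <- ms) w m) in c1; last first.
  rewrite mulr_sumr big_seq [RHS]big_seq; apply: eq_bigr => m mms.
  rewrite /w [RHS]mulrCA; congr (_ * _).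
  have [mseq|mneq] := eqVneq (m ^+ p) s; first by rewrite /= hc.
  by rewrite gint0 mulr0.
apply: (cvg_near (cvgM c1 (cvgV _ c2))); first by rewrite gt_eqF.
  by near=> N.
by rewrite mulfK// gt_eqF.
Unshelve. all: by end_near. Qed.

End tilt.

(** * The maximum likelihood estimate *)

Section exp_sum.
Context {R : realType} {I : finType}.
Variables (w s : I -> R).
Implicit Types (b c : R).
Hypothesis w_gt0 : forall i, 0 < w i.

(** The reciprocal of the likelihood of a configuration is, up to a constant factor, such a sum in
    the parameter. Its tangent inequality, which is [1 + x <= exp x] term by term, provides the
    convexity used below. *)
Definition exp_sum c : R := \sum_i w i * expR (c * s i).

Definition dexp_sum c : R := \sum_i w i * (s i * expR (c * s i)).

Lemma exp_sum_tangent b c : exp_sum b + (c - b) * dexp_sum b <= exp_sum c.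
Proof.
rewrite /exp_sum /dexp_sum mulr_sumr -big_split /=; apply: ler_sum => i _.
have -> : w i * expR (b * s i) + (c - b) * (w i * (s i * expR (b * s i))) =
  w i * (expR (b * s i) * (1 + (c - b) * s i)) by ring.
rewrite ler_wpM2l ?(ltW (w_gt0 i))//.
have -> : c * s i = b * s i + (c - b) * s i by ring.
by rewrite expRD ler_wpM2l ?expR_ge0// expR_ge1Dx.
Qed.

Lemma exp_sum_tangent_lt b c : b != c -> (exists i, s i != 0) ->
  exp_sum b + (c - b) * dexp_sum b < exp_sum c.
Proof.
move=> bc [i0 si0]; rewrite /exp_sum /dexp_sum mulr_sumr -big_split /=.
have E i : w i * expR (b * s i) + (c - b) * (w i * (s i * expR (b * s i))) =
  w i * (expR (b * s i) * (1 + (c - b) * s i)) by ring.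
have E' i : c * s i = b * s i + (c - b) * s i by ring.
under eq_bigr do rewrite E; under [X in _ < X]eq_bigr do rewrite E' expRD.
rewrite (bigD1 i0)//= [ltRHS](bigD1 i0)//=; apply: ltr_leD.
  rewrite ltr_pM2l// ltr_pM2l ?expR_gt0//; apply: expR_gt1Dx.
  by rewrite mulf_neq0// subr_eq0 eq_sym.
apply: ler_sum => i _; rewrite ler_wpM2l ?(ltW (w_gt0 i))//.
by rewrite ler_wpM2l ?expR_ge0// expR_ge1Dx.
Qed.

Lemma continuous_dexp_sum : continuous dexp_sum.
Proof.
move=> c; apply: (@cvg_seq_sum R _ _ _ _ (index_enum I)
  (fun i c => w i * (s i * expR (c * s i))) (fun i => w i * (s i * expR (c * s i)))).
move=> i _; apply: cvgM; first exact: cvg_cst.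
apply: cvgM; first exact: cvg_cst.
apply: (@continuous_cvg _ _ _ _ _ _ (@expR R)); first exact: continuous_expR.
by apply: cvgM; [exact: cvg_id|exact: cvg_cst].
Qed.

(** A negative slope at [b] would persist at a slightly larger point, whose tangent would put the
    value at [b] strictly above the value there. *)
Lemma exp_sum_argmin_dge0 b : (forall c, exp_sum b <= exp_sum c) -> 0 <= dexp_sum b.
Proof.
move=> bmin; rewrite leNgt; apply/negP => d0.
have /nbhs_ballP : \forall c \near b, dexp_sum c < 0.
  have /cvgrPdist_lt/(_ (- dexp_sum b)) := @continuous_dexp_sum b.
  rewrite oppr_gt0 => /(_ d0); apply: filterS => c.
  by rewrite ltr_norml => /andP[]; lra.
move=>[d /= dd hd].
have d2 : 0 < d / 2 by rewrite divr_gt0.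
have := hd (b + d / 2).
have bb : ball b d (b + d / 2).
  by rewrite /ball /= opprD addrA subrr add0r normrN gtr0_norm//; lra.
move=> /(_ bb) dc.
have := exp_sum_tangent (b + d / 2) b; have := bmin (b + d / 2).
have : 0 < (b - (b + d / 2)) * dexp_sum (b + d / 2).
  have b0 : b - (b + d / 2) < 0 by lra.
  by rewrite nmulr_rgt0.
lra.
Qed.

End exp_sum.

Section mle.
Context {R : realType}.
Implicit Types (beta h b c t : R) (p n N k : nat).

Definition mean_pow b h p N : R := \sum_(sigma : config N) cw_prob b h p sigma * mag sigma ^+ p.

Lemma cw_prob_ge0 b h p N (sigma : config N) : 0 <= cw_prob b h p sigma :> R.
Proof.
rewrite cw_probE divr_ge0 ?expR_ge0// sumr_ge0// => i _; exact: expR_ge0.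
Qed.

Lemma sum_gibbs_gt0 b h p N : 0 < \sum_(tau : config N) gibbs_weight b h p tau :> R.
Proof.
rewrite (bigD1 [ffun=> false])//= ltr_pwDl ?gibbs_weight_gt0// sumr_ge0// => i _.
exact: expR_ge0.
Qed.

Lemma cw_prob_sum1 b h p N : \sum_(sigma : config N) cw_prob b h p sigma = 1 :> R.
Proof.
under eq_bigr do rewrite cw_probE.
by rewrite -mulr_suml divff// gt_eqF// sum_gibbs_gt0.
Qed.

(** This makes the exponential sum strictly convex. The powers [1] and [(1 - 2 / N) ^ p], attained
    with no and with one negative spin, differ, so one of them is not that of [sigma]. *)
Lemma mag_pow_neq p N (sigma : config N) : (0 < p)%N -> (2 <= N)%N ->
  exists tau : config N, N%:R * (mag tau ^+ p - mag sigma ^+ p) != 0 :> R.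
Proof.
move=> p0 N2; have N0 : (0 < N)%N by exact: ltn_trans N2.
have n0 : N%:R != 0 :> R by rewrite pnatr_eq0 -lt0n.
pose t0 : config N := [ffun=> false].
pose t1 : config N := [ffun i => i == Ordinal N0].
have m0 : mag t0 = 1 :> R.
  rewrite magE//; have -> : [set i | t0 i]%SET = finset.set0.
    by apply/setP => i; rewrite !inE ffunE.
  by rewrite cards0 /spin mulr0 mul0r subr0.
have m1 : mag t1 = 1 - 2 / N%:R :> R.
  rewrite magE//; have -> : [set i | t1 i]%SET = finset.set1 (Ordinal N0).
    by apply/setP => i; rewrite !inE ffunE.
  by rewrite cards1 /spin mulr1.
have [e|e] := eqVneq (mag sigma ^+ p) (1 : R); last first.
  by exists t0; rewrite m0 expr1n mulf_neq0// subr_eq0 eq_sym.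
exists t1; rewrite m1 e mulf_neq0// subr_eq0.
have nr : 2 <= N%:R :> R by rewrite ler_nat.
have h1 : 0 <= 1 - 2 / N%:R :> R.
  by rewrite subr_ge0 ler_pdivrMr ?mul1r// (lt_le_trans _ nr).
have h2 : 1 - 2 / N%:R < 1 :> R.
  by rewrite ltrBlDr ltrDl divr_gt0// (lt_le_trans _ nr).
by rewrite lt_eqF// exprn_ilt1// -lt0n.
Qed.

(** The likelihood at [c] is [w sigma / D c], so a finite estimate minimizes the strictly convex
    [D]. The slope [dD b] has the sign of the mean minus [mag sigma ^ p] and tells on which side of
    [b] the minimizer lies. For infinite estimates, comparing [D b] with [D (b + 1)] or [D (b - 1)]
    gives the sign of the slope. *)
Lemma mle_gt p N h (sigma : config N) (e : \bar R) b : (0 < p)%N -> (2 <= N)%N ->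
  is_mle h p sigma e -> (b%:E < e)%E = (mean_pow b h p N < mag sigma ^+ p).
Proof.
move=> p0 N2 he.
have n0 : 0 < N%:R :> R by rewrite ltr0n (ltn_trans _ N2).
pose w (tau : config N) : R := expR (N%:R * (h * mag tau)).
pose s (tau : config N) : R := N%:R * (mag tau ^+ p - mag sigma ^+ p).
have w0 tau : 0 < w tau by exact: expR_gt0.
pose D := exp_sum w s; pose dD := dexp_sum w s.
have ws c tau : gibbs_weight c h p tau =
    expR (N%:R * (c * mag sigma ^+ p)) * (w tau * expR (c * s tau)).
  by rewrite /gibbs_weight /w /s -!expRD; congr expR; ring.
have Z c : \sum_(tau : config N) gibbs_weight c h p tau =
    expR (N%:R * (c * mag sigma ^+ p)) * D c.
  by under eq_bigr do rewrite ws; rewrite -mulr_sumr.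
have D0 c : 0 < D c.
  by have := @sum_gibbs_gt0 c h p N; rewrite Z pmulr_rgt0 ?expR_gt0.
have LE c : likelihood h p sigma c = w sigma / D c.
  rewrite /likelihood cw_probE Z ws /s subrr !mulr0 expR0 mulr1 invfM mulrACA.
  by rewrite divff ?mul1r// gt_eqF ?expR_gt0.
have Lle c c' : (likelihood h p sigma c <= likelihood h p sigma c') = (D c' <= D c).
  by rewrite !LE ler_pM2l// lef_pV2 ?posrE.
have Llt c c' : (likelihood h p sigma c < likelihood h p sigma c') = (D c' < D c).
  by rewrite !LE ltr_pM2l// ltf_pV2 ?posrE.
have -> : (mean_pow b h p N < mag sigma ^+ p) = (dD b < 0).
  have dDE : dD b = N%:R * D b * (mean_pow b h p N - mag sigma ^+ p).
    have -> : mean_pow b h p N - mag sigma ^+ p =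
        \sum_(tau : config N) cw_prob b h p tau * (mag tau ^+ p - mag sigma ^+ p).
      under [RHS]eq_bigr do rewrite mulrBr.
      by rewrite sumrB -mulr_suml cw_prob_sum1 mul1r.
    rewrite mulr_sumr; apply: eq_bigr => tau _.
    rewrite cw_probE Z ws.
    have Eb : expR (N%:R * (b * mag sigma ^+ p)) != 0 by rewrite gt_eqF// expR_gt0.
    by rewrite /s; field; rewrite Eb gt_eqF.
  by rewrite dDE pmulr_rlt0 ?mulr_gt0// subr_lt0.
have snz := @mag_pow_neq p N sigma p0 N2.
have tan c c' : D c + (c' - c) * dD c <= D c' by exact: exp_sum_tangent.
have tanlt c c' : c != c' -> D c + (c' - c) * dD c < D c'.
  by move=> cc; exact: exp_sum_tangent_lt.
case: e he => [r| |] /=.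
- move=> hr; have {}hr c : D r <= D c by rewrite -Lle.
  rewrite lte_fin; apply/idP/idP => [br|dDb].
    rewrite ltNge; apply/negP => dDb.
    have := tanlt b r (negbT (lt_eqF br)); have := hr b.
    have : 0 <= (r - b) * dD b by rewrite mulr_ge0// subr_ge0 ltW.
    lra.
  rewrite ltNge; apply/negP; rewrite le_eqVlt => /orP[/eqP rb|rb].
    by have := exp_sum_argmin_dge0 w0 hr; rewrite rb leNgt dDb.
  have := tan b r; have := hr b.
  have : 0 < (r - b) * dD b by rewrite nmulr_rgt0// subr_lt0.
  lra.
- move=> [_ inc]; rewrite ltry; apply/esym; rewrite ltNge; apply/negP => dDb.
  have := inc b (b + 1); rewrite ltrDl ltr01 => /(_ isT); rewrite Llt.
  have := tan b (b + 1); have -> : b + 1 - b = 1 by ring.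
  by rewrite mul1r; lra.
- move=> [_ dec]; rewrite ltNge leNye /=; apply/esym/negP => dDb.
  have := dec (b - 1) b; rewrite gtrBl ltr01 => /(_ isT); rewrite Llt.
  have := tan b (b - 1); have -> : b - 1 - b = -1 by ring.
  by rewrite mulN1r; lra.
Qed.

Lemma scaled_error_gt p N h beta t (bhat : forall N, config N -> \bar R) (sigma : config N) :
  (0 < p)%N -> (2 <= N)%N -> is_mle h p sigma (bhat N sigma) ->
  (t%:E < scaled_error beta bhat sigma)%E =
  (mean_pow (beta + t / Num.sqrt N%:R) h p N < mag sigma ^+ p).
Proof.
move=> p0 N2 he; rewrite -(mle_gt _ p0 N2 he) /scaled_error.
have r0 : 0 < Num.sqrt N%:R :> R by rewrite sqrtr_gt0 ltr0n (ltn_trans _ N2).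
case: (bhat N sigma) => [r| |].
- by rewrite -EFinB -EFinM !lte_fin -ltrBrDl ltr_pdivrMr// [X in _ < X]mulrC.
- by rewrite addye// gt0_muley ?lte_fin// !ltry.
- by rewrite addNye gt0_muleNy ?lte_fin// !ltNge !leNye.
Qed.

End mle.

(** * Tails of normal laws *)

Section normal_tail.
Context {R : realType}.
Implicit Types (s t a c v x y k : R) (n : nat).
Local Notation mu := (@lebesgue_measure R).

Lemma normal_pdfN s x : normal_pdf 0 s (- x) = normal_pdf 0 s x \/ s = 0.
Proof.
have [->|s0] := eqVneq s 0; [by right|left].
by rewrite !normal_pdfE// /normal_fun !subr0 sqrrN.
Qed.

Definition tail s t : R := fine (normal_prob 0 s `]t, +oo[%classic).

Lemma normal_prob_fin s (A : set R) : measurable A ->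
  normal_prob 0 s A = (fine (normal_prob 0 s A))%:E.
Proof. by move=> mA; rewrite fineK// fin_num_measure. Qed.

Lemma measurable_pdfE s : measurable_fun [set: R] (fun x : R => (normal_pdf 0 s x)%:E).
Proof. by apply/measurable_EFinP; exact: measurable_normal_pdf. Qed.

Lemma normal_prob_itvNyc s t : normal_prob 0 s `]-oo, t]%classic = normal_prob 0 s `]-oo, t[%classic.
Proof.
rewrite /normal_prob integral_itv_bndo_bndc//.
by apply: measurable_funTS; exact: measurable_pdfE.
Qed.

Lemma normal_prob_itvcy s t : normal_prob 0 s `[t, +oo[%classic = normal_prob 0 s `]t, +oo[%classic.
Proof.
rewrite /normal_prob integral_itv_obnd_cbnd//.
by apply: measurable_funTS; exact: measurable_pdfE.
Qed.

Lemma normal_prob_itvNyo s t : s != 0 ->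
  normal_prob 0 s `]-oo, t[%classic = normal_prob 0 s `]- t, +oo[%classic.
Proof.
move=> s0; rewrite -normal_prob_itvNyc -normal_prob_itvcy /normal_prob.
rewrite -{1}(opprK t) ge0_integration_by_substitutionNy.
- apply: eq_integral => x _ /=.
  by have [->//|e] := normal_pdfN s x; rewrite e eqxx in s0.
- by apply: continuous_subspaceT; exact: continuous_normal_pdf.
- by move=> x _; exact: normal_pdf_ge0.
Qed.

Lemma normal_prob_scale s c t : 0 < s -> 0 < c ->
  normal_prob 0 (c * s) `]c * t, +oo[%classic = normal_prob 0 s `]t, +oo[%classic.
Proof.
move=> s0 c0; rewrite -!normal_prob_itvcy /normal_prob.
pose F (x : R) := c * x.
have dF (x : R) : is_derive x (1 : R) F c.
  by rewrite /F; apply: is_derive_eq; rewrite /GRing.scale /= mulr1 ?mulr0 ?addr0.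
have F'E : F^`()%classic = cst c.
  by apply/funext => x; rewrite derive1E; have [_ ->] := dF x.
have -> : c * t = F t by [].
rewrite (@increasing_ge0_integration_by_substitutiony R F (normal_pdf 0 (c * s)) t).
- have -> : (normal_pdf 0 (c * s) \o F) * F^`()%classic = normal_pdf 0 s; last by [].
  rewrite F'E; apply/funext => x; rewrite -[LHS]/(normal_pdf 0 (c * s) (c * x) * c).
  have cs0 : c * s != 0 by rewrite mulf_neq0// gt_eqF.
  rewrite !normal_pdfE ?(gt_eqF s0)// /normal_peak /normal_fun !subr0 /F.
  have -> : - (c * x) ^+ 2 / ((c * s) ^+ 2 *+ 2) = - x ^+ 2 / (s ^+ 2 *+ 2).
    have cn : c != 0 by rewrite gt_eqF.
    by rewrite !exprMn -mulrN -mulrnAr invfM mulrACA mulfV ?mul1r// expf_neq0.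
  rewrite mulrAC; congr (_ * _).
  have -> : (c * s) ^+ 2 * pi *+ 2 = c ^+ 2 * (s ^+ 2 * pi *+ 2).
    by rewrite exprMn -mulrA mulrnAr.
  rewrite sqrtrM ?sqr_ge0// sqrtr_sqr gtr0_norm// invfM mulrAC mulVf ?mul1r// gt_eqF//.
- by move=> x y _ _ xy; rewrite /F ltr_pM2l.
- by rewrite F'E => x _; exact: cvg_cst.
- by rewrite F'E; exact: is_cvg_cst.
- by rewrite F'E; exact: is_cvg_cst.
- split; first by move=> x _; have [] := dF x.
  apply: cvg_at_right_filter; rewrite /F.
  by apply: cvgM; [exact: cvg_cst|exact: cvg_id].
- by rewrite /F; apply/gt0_cvgMry => //; exact: cvg_id.
- apply: continuous_subspaceT; apply: continuous_normal_pdf.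
  by rewrite mulf_neq0// gt_eqF.
- by move=> x _; exact: normal_pdf_ge0.
Qed.

Lemma tail_scale s c t : 0 < s -> 0 < c -> tail (c * s) (c * t) = tail s t.
Proof. by move=> s0 c0; rewrite /tail normal_prob_scale. Qed.

Lemma normal_prob_Nyo_tail s t : s != 0 ->
  normal_prob 0 s `]-oo, t[%classic = (tail s (- t))%:E.
Proof. by move=> s0; rewrite normal_prob_itvNyo// normal_prob_fin. Qed.

Lemma normal_prob_setC s (A : set R) : measurable A ->
  normal_prob 0 s (~` A) = (1 - fine (normal_prob 0 s A))%:E.
Proof. by move=> mA; rewrite EFinB -normal_prob_fin//; exact: probability_setC. Qed.

Lemma tailN s t : s != 0 -> tail s (- t) = 1 - tail s t.
Proof.
move=> s0; apply: EFin_inj; rewrite -normal_prob_Nyo_tail// -normal_prob_itvNyc.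
by rewrite -setCitvr normal_prob_setC.
Qed.

Lemma tail0 s : s != 0 -> tail s 0 = 2^-1.
Proof. by move=> s0; have := tailN 0 s0; rewrite oppr0 => h; lra. Qed.

(** The origin of the asymptotic variance. With [a = - H''(m)] and [k = p * m ^ (p - 1)], the
    fluctuation of [x ^ p] is [k * y] with [y] of variance [1 / a], and its tilted mean is
    [t * k ^ 2 / a]; dividing by [k ^ 2 / a] leaves a normal variable of variance [a / k ^ 2]. *)
Lemma normal_prob_slope a k t : 0 < a -> k != 0 ->
  fine (normal_prob 0 (Num.sqrt a^-1) [set y | t * (k ^+ 2 / a) < k * y]) =
  tail (Num.sqrt (k ^+ 2 / a)^-1) t.
Proof.
move=> a0 k0.
have s0 : 0 < Num.sqrt a^-1 by rewrite sqrtr_gt0 invr_gt0.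
have sE : Num.sqrt (k ^+ 2 / a)^-1 = a / `|k| * Num.sqrt a^-1.
  rewrite -[a / `|k|]ger0_norm ?divr_ge0 ?ltW//; last by rewrite normr_gt0.
  rewrite -sqrtr_sqr -sqrtrM ?sqr_ge0//; congr Num.sqrt.
  rewrite exprMn exprVn real_normK ?num_real//.
  by field; rewrite k0 gt_eqF.
have c0 : 0 < a / `|k| by rewrite divr_gt0// normr_gt0.
move: (k0); rewrite neq_lt => /orP[kn|kp].
- have -> : [set y | t * (k ^+ 2 / a) < k * y] = `]-oo, (t * k / a)[%classic.
    apply/seteqP; split => y /=; rewrite in_itv /= => h.
      rewrite -(ltr_nM2r kn) [y * k]mulrC; apply: le_lt_trans h.
      by rewrite le_eqVlt; apply/orP; left; apply/eqP; ring.
    rewrite -(ltr_nM2r kn) [y * k]mulrC in h; apply: le_lt_trans h.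
    by rewrite le_eqVlt; apply/orP; left; apply/eqP; ring.
  rewrite normal_prob_Nyo_tail; last by rewrite gt_eqF.
  rewrite [LHS]/=.
  rewrite sE -(tail_scale _ s0 c0); congr tail; rewrite ltr0_norm//.
  by field; rewrite k0 gt_eqF.
- have -> : [set y | t * (k ^+ 2 / a) < k * y] = `](t * k / a), +oo[%classic.
    apply/seteqP; split => y /=; rewrite in_itv /= andbT => h.
      rewrite -(ltr_pM2r kp) [y * k]mulrC; apply: le_lt_trans h.
      by rewrite le_eqVlt; apply/orP; left; apply/eqP; ring.
    rewrite -(ltr_pM2r kp) [y * k]mulrC in h; apply: le_lt_trans h.
    by rewrite le_eqVlt; apply/orP; left; apply/eqP; ring.
  rewrite -/(tail _ _) sE -(tail_scale _ s0 c0); congr tail; rewrite gtr0_norm//.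
  by field; rewrite k0 gt_eqF.
Qed.

Lemma normal_prob_norm_gt s t : s != 0 -> 0 <= t ->
  normal_prob 0 s [set z | t < `|z|] = (2 * tail s t)%:E.
Proof.
move=> s0 t0.
have -> : [set z | t < `|z|] = `]-oo, - t[%classic `|` `]t, +oo[%classic.
  apply/seteqP; split => z /=; rewrite !in_itv /= andbT.
    by rewrite lter_normr => /orP[?|?]; [right|left; lra].
  by rewrite lter_normr => -[?|->//]; apply/orP; right; lra.
have : normal_prob 0 s (`]-oo, (- t)%R[%classic `|` `]t, +oo[%classic) =
    (normal_prob 0 s `]-oo, (- t)%R[%classic + normal_prob 0 s `]t, +oo[%classic)%E.
  apply: measureU => //.
  by apply/seteqP; split => // z /=; rewrite !in_itv /= andbT => -[? ?]; lra.
move=> ->; rewrite normal_prob_Nyo_tail// opprK [X in (_ + X)%E]normal_prob_fin//.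
by rewrite -EFinD /tail; congr EFin; ring.
Qed.

Lemma normal_prob_norm_lt s t : s != 0 -> 0 < t ->
  normal_prob 0 s [set z | `|z| < t] = (1 - 2 * tail s t)%:E.
Proof.
move=> s0 t0.
have -> : [set z | `|z| < t] = `]-t, t[%classic.
  by apply/seteqP; split => z /=; rewrite in_itv /= ltr_norml.
have h : normal_prob 0 s `]-oo, t[%classic =
    (normal_prob 0 s `]-oo, (- t)%R]%classic + normal_prob 0 s `](- t)%R, t[%classic)%E.
  have <- : normal_prob 0 s (`]-oo, (- t)%R]%classic `|` `](- t)%R, t[%classic) =
      (normal_prob 0 s `]-oo, (- t)%R]%classic + normal_prob 0 s `](- t)%R, t[%classic)%E.
    apply: measureU => //.
    by apply/seteqP; split => // z /=; rewrite !in_itv /= => -[? /andP[? ?]]; lra.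
  congr (normal_prob _ _ _); apply/seteqP; split => z /=; rewrite !in_itv /=.
    by move=> zt; have [|] := leP z (- t); [left|right; rewrite zt andbT].
  by move=> [|/andP[_ //]] ?; lra.
move: h; rewrite normal_prob_itvNyc !normal_prob_Nyo_tail// opprK.
have mt : measurable (`](- t)%R, t[%classic : set R) by [].
rewrite (tailN _ s0) (normal_prob_fin s mt) -EFinD => -[h].
by congr EFin; move: h; set r := fine _; lra.
Qed.

End normal_tail.

(** * Convergence in law *)

Section portmanteau.
Context {R : realType}.
Implicit Types (f : \bar R -> R) (t c e M : R) (N n k : nat).

Lemma heine (g : R -> R) M e : continuous g -> 0 < e ->
  exists2 d, 0 < d & forall x y, -M <= x <= M -> `|x - y| < d -> `|g x - g y| <= e.
Proof.
move=> cg e0.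
have cpt := @segment_compact R (- M) M.
have /compact_near_coveringP := cpt.
move=> /(_ R (0 : R)^'+ (fun d x => forall y, `|x - y| < d -> `|g x - g y| <= e)).
move=> h; have {h} : \forall d \near (0 : R)^'+, `[- M, M]%classic `<=`
    (fun x => forall y, `|x - y| < d -> `|g x - g y| <= e).
  apply: h => x _.
  have /cvgrPdist_le/(_ (e / 2)) := cg x; rewrite divr_gt0// => /(_ isT).
  move=> /nbhs_ballP[r /= r0 hr].
  have r2 : 0 < r / 2 by rewrite divr_gt0.
  exists (ball x (r / 2), [set d | 0 < d < r / 2]) => /=.
    split; first exact: nbhsx_ballx.
    near=> d; apply/andP; split; near: d; [exact: nbhs_right_gt|exact: nbhs_right_lt].
  move=> [x' d] /= [xx' /andP[d0 dr]] y x'y.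
  have h1 : `|g x - g x'| <= e / 2.
    by apply: hr; apply: le_ball xx'; rewrite ler_pdivrMr// ler_peMr ?ltW//; lra.
  have h2 : `|g x - g y| <= e / 2.
    apply: hr; rewrite /ball /= in xx' *.
    have := ler_distD x' x y; lra.
  have := ler_distD (g x) (g x') (g y); rewrite [`|g x' - g x|]distrC; lra.
move=> h.
have [d [d0 hd]] : exists d : R, 0 < d /\ `[- M, M]%classic `<=`
    (fun x => forall y, `|x - y| < d -> `|g x - g y| <= e).
  have : \forall d \near (0 : R)^'+, 0 < d /\ `[- M, M]%classic `<=`
    (fun x => forall y, `|x - y| < d -> `|g x - g y| <= e).
    near=> d; split; near: d => //; exact: nbhs_right_gt.
  by move/filter_ex.
by exists d => // x y xM; apply: hd; rewrite /= in_itv.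
Unshelve. all: by end_near. Qed.

Definition step_sum c (s : seq (R * R)) (x : \bar R) : R :=
  c + \sum_(i <- s) i.2 * ((i.1%:E < x)%E)%:R.

(** The index [k] is the first one below [n] with [x <= a k], or [n] if there is none. *)
Lemma step_index (a : nat -> R) (x : \bar R) n : exists k, [/\ (k <= n)%N,
  forall j, (j < k)%N -> ((a j)%:E < x)%E & (k < n)%N -> (x <= (a k)%:E)%E].
Proof.
elim: n => [|n [k [kn kl kr]]]; first by exists 0%N; split.
have [kn'|nk] := ltnP k n.
  by exists k; split => //; [exact: leqW|move=> _; exact: kr].
have kE : k = n by apply/eqP; rewrite eqn_leq kn.
rewrite {}kE in kl.
have [xa|ax] := leP x (a n)%:E.
  by exists n; split.
exists n.+1; split => //; last by rewrite ltnn.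
by move=> j; rewrite ltnS leq_eqVlt => /orP[/eqP -> //|]; exact: kl.
Qed.

Lemma step_approx f e : continuous f -> 0 < e ->
  exists c s, (forall i, i \in s -> i.1 != 0) /\
    forall x, `|f x - step_sum c s x| <= e.
Proof.
move=> cf e0.
have e2 : 0 < e / 2 by rewrite divr_gt0.
have [M1 hM1] : exists M1 : R, forall x, (M1%:E < x)%E -> `|f +oo%E - f x| <= e / 2.
  have /cvgrPdist_le/(_ _ e2) := cf +oo%E.
  by move=> [A [_ hA]]; exists A.
have [M2 hM2] : exists M2 : R, forall x, (x < M2%:E)%E -> `|f -oo%E - f x| <= e / 2.
  have /cvgrPdist_le/(_ _ e2) := cf -oo%E.
  by move=> [A [_ hA]]; exists A.
(* Outside [[-M, M]] the function stays within [e / 2] of its values at the infinite points. *)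
pose M := 1 + `|M1| + `|M2|.
have M0 : 0 < M by rewrite /M -addrA ltr_pwDl ?addr_ge0.
have M1M : M1 < M.
  by rewrite /M; have := ler_norm M1; have := normr_ge0 M2; lra.
have M2M : - M < M2.
  by rewrite /M; have := ler_norm (- M2); rewrite normrN; have := normr_ge0 M1; lra.
have cg : continuous (f \o EFin).
  move=> r; apply: continuous_comp; last exact: cf.
  by move=> A /nbhs_EFin.
have [d d0 hd] := heine M cg e0.
(* An odd number of equal steps from [- M] to [M] keeps [0] off the grid. *)
have [q [q0 qd]] : exists q : nat, (0 < q)%N /\ 2 * M / q.*2.+1%:R < d.
  exists (Num.truncn (2 * M / d)).+1; split => //.
  rewrite ltr_pdivrMr ?ltr0n// [ltRHS]mulrC -ltr_pdivrMr//.
  apply: lt_le_trans (truncnS_gt _) _; rewrite ler_nat; set q := Num.Def.trunc _; rewrite -addnn; lia.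
pose n := q.*2.+1.
have n0 : 0 < n%:R :> R by rewrite ltr0n.
pose a j : R := - M + 2 * M / n%:R * j%:R.
have aS j : a j.+1 - a j = 2 * M / n%:R by rewrite /a -natr1; ring.
have an : a n = M by rewrite /a divfK ?gt_eqF//; ring.
have a0 : a 0%N = - M by rewrite /a mulr0 addr0.
have st0 : 0 < 2 * M / n%:R by rewrite divr_gt0 ?mulr_gt0.
have a_le i j : (i <= j)%N -> a i <= a j.
  by move=> ij; rewrite /a lerD2l ler_pM2l// ler_nat.
have a_nz j : a j != 0.
  rewrite /a; apply/eqP => h.
  have : 2 * j%:R = n%:R :> R.
    have MM : M * (2 * j%:R) = M * n%:R.
      have : (- M + 2 * M / n%:R * j%:R) * n%:R = 0 by rewrite h mul0r.
      rewrite mulrDl; have -> : 2 * M / n%:R * j%:R * n%:R = M * (2 * j%:R).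
        by field; rewrite gt_eqF.
      lra.
    exact: (mulfI (lt0r_neq0 M0) MM).
  by rewrite -natrM => /eqP; rewrite eqr_nat /n => /eqP; lia.
have a_in j : (j <= n)%N -> - M <= a j <= M.
  by move=> jn; rewrite -{1}a0 -an !a_le.
pose s := [seq (a j, f (a j.+1)%:E - f (a j)%:E) | j <- index_iota 0 n].
exists (f (a 0%N)%:E), s; split.
  by move=> i /mapP[j _ ->] /=; exact: a_nz.
move=> x; have [k [kn kl kr]] := step_index a x n.
(* The jumps at the grid points below [x] telescope. *)
have -> : step_sum (f (a 0%N)%:E) s x = f (a k)%:E.
  rewrite /step_sum big_map /= (big_cat_nat (n := k))//=.
  rewrite [X in _ + (_ + X)]big1_seq ?addr0; last first.
    move=> j; rewrite mem_index_iota => /andP[_ /andP[kj jn]].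
    have xk := kr (leq_ltn_trans kj jn).
    by rewrite ltNge (le_trans xk) ?mulr0// lee_fin a_le.
  rewrite (eq_big_nat _ _ (F2 := fun j => f (a j.+1)%:E - f (a j)%:E)); last first.
    by move=> j /andP[_ jk]; rewrite kl// mulr1.
  by rewrite telescope_sumr//; ring.
have unif r j : (0 < j <= n)%N -> a j.-1 < r -> r <= a j -> `|f r%:E - f (a j)%:E| <= e.
  case: j => // j /= jn h1 h2; rewrite distrC; apply: hd; first exact: a_in.
  rewrite ger0_norm; last by lra.
  by have := aS j; rewrite -/n in qd; lra.
have big r : (M%:E <= r)%E -> `|f r - f M%:E| <= e.
  move=> Mr.
  have h1 : `|f +oo%E - f r| <= e / 2 by apply: hM1; apply: lt_le_trans Mr; rewrite lte_fin.
  have h2 : `|f +oo%E - f M%:E| <= e / 2 by apply: hM1; rewrite lte_fin.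
  by have := ler_distD (f +oo%E) (f r) (f M%:E); rewrite [`|f r - f +oo%E|]distrC; lra.
have small r : (r <= (- M)%:E)%E -> `|f r - f (- M)%:E| <= e.
  move=> Mr.
  have h1 : `|f -oo%E - f r| <= e / 2 by apply: hM2; apply: (le_lt_trans Mr); rewrite lte_fin.
  have h2 : `|f -oo%E - f (- M)%:E| <= e / 2 by apply: hM2; rewrite lte_fin.
  by have := ler_distD (f -oo%E) (f r) (f (- M)%:E); rewrite [`|f r - f -oo%E|]distrC; lra.
case: k kn kl kr => [_ _ kr|k kn kl kr].
  by rewrite a0; apply: small; rewrite -a0; exact: kr.
have ak := kl k (ltnSn k).
have [knn|nk] := ltnP k.+1 n.
  have xk := kr knn.
  case: x ak xk {kl kr} => [r| |] ak xk.
  - by rewrite lte_fin in ak; rewrite lee_fin in xk; apply: unif.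
  - by rewrite leye_eq in xk.
  - by rewrite ltNge leNye in ak.
have kE : k.+1 = n by apply/eqP; rewrite eqn_leq kn.
rewrite kE an.
have [Mx|xM] := leP M%:E x; first exact: big.
case: x ak xM {kl kr} => [r| |] ak xM.
- rewrite lte_fin in ak; rewrite lte_fin in xM.
  by rewrite -an -kE; apply: unif; rewrite ?kn// kE an ltW.
- by rewrite ltNge leey in xM.
- by rewrite ltNge leNye in ak.
Qed.

Lemma measurable_ereal_gt t : measurable [set x : \bar R | (t%:E < x)%E].
Proof. by rewrite -set_itvoy; exact: emeasurable_itv. Qed.

Lemma measurable_step_sum c s : measurable_fun [set: \bar R] (step_sum c s).
Proof.
apply: measurable_funD => //; apply: measurable_sum => i.
apply: measurable_funM => //.
rewrite (_ : (fun x => _) = \1_[set x : \bar R | (i.1%:E < x)%E]); last first.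
  by apply/funext => x; rewrite indicE; congr (nat_of_bool _)%:R; apply/idP/idP; rewrite inE.
by apply: measurable_indic; exact: measurable_ereal_gt.
Qed.

Lemma continuous_ereal_measurable f : continuous f -> measurable_fun [set: \bar R] f.
Proof.
move=> cf.
have /choice[g hg] : forall n : nat, exists cs : R * seq (R * R),
    forall x, `|f x - step_sum cs.1 cs.2 x| <= n.+1%:R^-1.
  move=> n; have n0 : 0 < n.+1%:R^-1 :> R by rewrite invr_gt0.
  by have [c [s [_ h]]] := step_approx cf n0; exists (c, s).
apply: (@measurable_fun_cvg _ _ _ _ (fun n => step_sum (g n).1 (g n).2)).
  by move=> n; exact: measurable_step_sum.
move=> x _; apply/cvgrPdist_le => e e0; near=> n.
apply: le_trans (hg n x) _.
rewrite -[leRHS]invrK lef_pV2 ?posrE ?invr_gt0 ?ltr0n//.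
apply: (@le_trans _ _ n%:R); last by rewrite ler_nat.
by near: n; exact: nbhs_infty_ger.
Unshelve. all: by end_near. Qed.

Section law.
Variables (P : forall N, config N -> R) (T : forall N, config N -> \bar R).
Variable nu : {measure set (\bar R) -> \bar R}.
Hypothesis P_ge0 : forall N (sigma : config N), 0 <= P sigma.
Hypothesis P_sum1 : forall N, \sum_(sigma : config N) P sigma = 1.
Hypothesis nu1 : nu setT = 1%E.
Hypothesis tails : forall t, t != 0 ->
  (\sum_(sigma : config N) P sigma * ((t%:E < T sigma)%E)%:R) @[N --> \oo] -->
  fine (nu [set x | (t%:E < x)%E]).

Let nu_fin (A : set (\bar R)) : measurable A -> nu A = (fine (nu A))%:E.
Proof.
move=> mA; rewrite fineK// ge0_fin_numE//.
have h : (nu A <= nu setT)%E by apply: le_measure; rewrite ?inE.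
by apply: le_lt_trans h _; rewrite nu1 ltry.
Qed.

Let nu_cst c : (\int[nu]_x c%:E)%E = c%:E.
Proof. by rewrite integral_cst// nu1 mule1. Qed.

Let nu_integrable (g : \bar R -> R) M : measurable_fun [set: \bar R] g ->
  (forall x, `|g x| <= M) -> nu.-integrable [set: \bar R] (fun x => (g x)%:E).
Proof.
move=> mg gM; apply/integrableP; split; first exact/measurable_EFinP.
apply: (@le_lt_trans _ _ (\int[nu]_x M%:E)%E); last by rewrite nu_cst ltry.
apply: ge0_le_integral => //.
- by apply/measurableT_comp => //; exact/measurable_EFinP.
- by move=> x _; rewrite lee_fin; exact: le_trans (gM x).
Qed.

Lemma integral_step_sum c (s : seq (R * R)) :
  nu.-integrable [set: \bar R] (fun x => (step_sum c s x)%:E) /\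
  (\int[nu]_x (step_sum c s x)%:E)%E =
  (c + \sum_(i <- s) i.2 * fine (nu [set x | (i.1%:E < x)%E]))%:E.
Proof.
have ci : nu.-integrable [set: \bar R] (fun=> c%:E).
  by apply: (@nu_integrable (fun=> c) `|c|).
have ii (i : R * R) : nu.-integrable [set: \bar R]
    (fun x => (i.2 * ((i.1%:E < x)%E)%:R)%:E).
  apply: (@nu_integrable _ `|i.2|).
    have := measurable_step_sum 0 [:: i].
    by congr measurable_fun; apply/funext => x; rewrite /step_sum big_seq1 add0r.
  by move=> x; rewrite normrM ler_piMr//; case: (_ < _)%E; rewrite ?normr1 ?normr0.
have si : nu.-integrable [set: \bar R]
    (fun x => \sum_(i <- s) (i.2 * ((i.1%:E < x)%E)%:R)%:E)%E.
  by apply: integrable_sum => // i _; exact: ii.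
have E x : (step_sum c s x)%:E = (c%:E + \sum_(i <- s) (i.2 * ((i.1%:E < x)%E)%:R)%:E)%E.
  by rewrite /step_sum EFinD sumEFin.
split; first by under eq_fun do rewrite E; exact: integrableD.
under eq_integral do rewrite E.
rewrite integralD// nu_cst EFinD; congr (_ + _)%E.
rewrite integral_sum// -sumEFin; apply: eq_bigr => i _.
have mi := measurable_ereal_gt i.1.
under eq_integral do rewrite EFinM.
rewrite integralZl//; last first.
  apply: (@nu_integrable (fun x => ((i.1%:E < x)%E)%:R) 1).
    have := measurable_step_sum 0 [:: (i.1, 1)].
    by congr measurable_fun; apply/funext => x; rewrite /step_sum big_seq1 add0r mul1r.
  by move=> x; case: (_ < _)%E; rewrite ?normr1 ?normr0.
rewrite EFinM -nu_fin//; congr (_ * _)%E.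
rewrite -[X in nu X]setIT -(@integral_indic _ _ _ nu setT measurableT _ mi).
by apply: eq_integral => x _; rewrite indicE; congr (nat_of_bool _)%:R%:E; apply/idP/idP; rewrite inE.
Qed.

Lemma cvg_in_law_of_tails : cvg_in_law P T nu.
Proof.
move=> f cf [B fB].
have mf := continuous_ereal_measurable cf.
have fi := nu_integrable mf fB.
have [I IE] : exists I : R, (\int[nu]_x (f x)%:E)%E = I%:E.
  by exists (fine (\int[nu]_x (f x)%:E)%E); rewrite fineK//; exact: integrable_fin_num.
rewrite IE; apply: cvg_EFin; first by near=> N.
rewrite /comp /=; apply/cvgrPdist_le => e e0.
have e3 : 0 < e / 3 by rewrite divr_gt0.
have [c [s [s0 hs]]] := step_approx cf e3.
pose J := c + \sum_(i <- s) i.2 * fine (nu [set x | (i.1%:E < x)%E]).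
have shift d x : step_sum (c + d) s x = step_sum c s x + d by rewrite /step_sum; ring.
have IJ : `|I - J| <= e / 3.
  have [i1 E1] := integral_step_sum (c + e / 3) s.
  have [i2 E2] := integral_step_sum (c - e / 3) s.
  have h1 : I <= J + e / 3.
    rewrite -lee_fin -IE; apply: le_trans (le_integral measurableT fi i1 _) _.
      by move=> x _; rewrite lee_fin shift; have := hs x; rewrite ler_norml => /andP[]; lra.
    by rewrite E1 lee_fin /J; lra.
  have h2 : J - e / 3 <= I.
    rewrite -lee_fin -IE; apply: le_trans _ (le_integral measurableT i2 fi _).
      by rewrite E2 lee_fin /J; lra.
    by move=> x _; rewrite lee_fin shift; have := hs x; rewrite ler_norml => /andP[]; lra.
  by rewrite ler_norml; apply/andP; split; lra.
have cJ : (\sum_(sigma : config N) P sigma * step_sum c s (T sigma)) @[N --> \oo] --> J.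
  have : (c + \sum_(i <- s) i.2 *
      \sum_(sigma : config N) P sigma * ((i.1%:E < T sigma)%E)%:R) @[N --> \oo] --> J.
    apply: cvgD; first exact: cvg_cst.
    apply: cvg_seq_sum => i si; apply: cvgM; first exact: cvg_cst.
    by apply: tails; exact: s0.
  apply: cvg_trans; apply: near_eq_cvg; near=> N.
  rewrite [RHS](eq_bigr (fun sigma => P sigma * c +
    \sum_(i <- s) P sigma * (i.2 * ((i.1%:E < T sigma)%E)%:R))); last first.
    by move=> sigma _; rewrite /step_sum mulrDr mulr_sumr.
  rewrite big_split /= -mulr_suml P_sum1 mul1r exchange_big /=; congr (_ + _).
  by apply: eq_bigr => i _; rewrite mulr_sumr; apply: eq_bigr => sigma _; rewrite mulrCA.
move/cvgrPdist_le : cJ => /(_ _ e3); apply: filterS => N hN.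
have hf : `|\sum_(sigma : config N) P sigma * f (T sigma) -
    \sum_(sigma : config N) P sigma * step_sum c s (T sigma)| <= e / 3.
  rewrite -sumrB; have -> : e / 3 = \sum_(sigma : config N) P sigma * (e / 3).
    by rewrite -mulr_suml P_sum1 mul1r.
  apply: le_trans (ler_norm_sum _ _ _) _; apply: ler_sum => sigma _.
  by rewrite -mulrBr normrM ger0_norm ?P_ge0// ler_wpM2l ?P_ge0.
move: hN hf IJ; set A := \sum_(_ | _) _; set B' := \sum_(_ | _) _ => h1 h2 h3.
have := ler_distD J I B'; have := ler_distD A J B'; rewrite [`|A - B'|]distrC; lra.
Unshelve. all: by end_near. Qed.

End law.

End portmanteau.

Section laws.
Context {R : realType}.
Implicit Types (mu : set (\bar R) -> \bar R) (t v w x : R) (F G : R -> R).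

(* Only [t != 0] is required, since [0] is an atom of the limit laws. *)
Definition law_tail mu (M : R) F :=
  [/\ exists nu : {measure set (\bar R) -> \bar R}, (nu : set (\bar R) -> \bar R) = mu,
      mu setT = M%:E &
      forall t, t != 0 -> mu [set x | (t%:E < x)%E] = (F t)%:E].

Lemma law_tail_mixture0 : law_tail (mixture [::]) 0 (fun=> 0).
Proof.
split=> [||t _]; rewrite /mixture ?big_nil//.
by exists mzero; apply/funext => A; rewrite big_nil.
Qed.

(** A [mixture] is a bare set function; recursion on its list builds the measure behind it together
    with its mass and tails. *)
Lemma law_tail_mixture_cons w mu ws M M' F G : 0 <= w ->
  law_tail mu M F -> law_tail (mixture ws) M' G ->
  law_tail (mixture ((w, mu) :: ws)) (w * M + M') (fun t => w * F t + G t).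
Proof.
move=> w0 [[nu nuE] muT muF] [[nu' nu'E] wsT wsG].
have E A : mixture ((w, mu) :: ws) A = (w%:E * mu A + mixture ws A)%E.
  by rewrite /mixture big_cons.
split.
- exists (measure_add (mscale (NngNum w0) nu) nu').
  by apply/funext => A; rewrite E -nuE -nu'E; exact: measure_addE.
- by rewrite E muT wsT -EFinM -EFinD.
- by move=> t t0; rewrite E muF// wsG// -EFinM -EFinD.
Qed.

Lemma law_tail_dirac (a : \bar R) :
  law_tail (\d_ a : set (\bar R) -> \bar R) 1 (fun t => ((t%:E < a)%E)%:R).
Proof.
split=> [||t _]; first by exists (\d_ a).
  by rewrite diracT.
rewrite diracE; congr (_%:R)%:E; congr nat_of_bool.
by apply/idP/idP; rewrite inE.
Qed.

Lemma law_tail_pushforward (s : R) (f : R -> \bar R) F : measurable_fun [set: R] f ->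
  (forall t, t != 0 -> normal_prob 0 s [set z | (t%:E < f z)%E] = (F t)%:E) ->
  law_tail (pushforward (normal_prob 0 s) f) 1 F.
Proof.
move=> mf fF; split=> [||t t0]; first by exists (pushforward (normal_prob 0 s) f).
  by rewrite /pushforward preimage_setT probability_setT.
by rewrite -fF.
Unshelve. all: exact: mf. Qed.

Lemma law_tail_gauss v : law_tail (gauss v) 1 (tail (Num.sqrt v)).
Proof.
apply: law_tail_pushforward => [|t _]; first exact/measurable_EFinP.
rewrite -[RHS]normal_prob_fin//; congr (normal_prob _ _ _).
by apply/seteqP; split => z; rewrite /= in_itv /= andbT lte_fin.
Qed.

Lemma law_tail_gauss_plus v : 0 < v -> law_tail (gauss_plus v) 1
  (fun t => if 0 < t then 2 * tail (Num.sqrt v) t else 1).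
Proof.
move=> v0; have s0 : Num.sqrt v != 0 by rewrite gt_eqF// sqrtr_gt0.
apply: law_tail_pushforward => [|t t0].
  by apply/measurable_EFinP; exact: normr_measurable.
have -> : [set z : R | (t%:E < `|z|%:E)%E] = [set z : R | t < `|z|].
  by apply/seteqP; split => z; rewrite /= lte_fin.
case: ifPn => [tp|]; first by rewrite normal_prob_norm_gt// ltW.
rewrite -leNgt le_eqVlt (negbTE t0) /= => tn.
rewrite -(@probability_setT _ _ _ (normal_prob 0 (Num.sqrt v))).
congr (normal_prob _ _ _).
by apply/seteqP; split => z //= _; exact: lt_le_trans tn _.
Qed.

Lemma law_tail_gauss_minus v : 0 < v -> law_tail (gauss_minus v) 1
  (fun t => if 0 < t then 0 else 1 - 2 * tail (Num.sqrt v) (- t)).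
Proof.
move=> v0; have s0 : Num.sqrt v != 0 by rewrite gt_eqF// sqrtr_gt0.
apply: law_tail_pushforward => [|t t0].
  by apply/measurable_EFinP; apply: measurable_funN; exact: normr_measurable.
have -> : [set z : R | (t%:E < (- `|z|)%:E)%E] = [set z : R | `|z| < - t].
  by apply/seteqP; split => z; rewrite /= lte_fin ltrNr.
case: ifPn => [tp|].
  rewrite (_ : [set z : R | _] = set0) ?measure0//.
  by apply/seteqP; split => z //= h; have := normr_ge0 z; lra.
rewrite -leNgt le_eqVlt (negbTE t0) /= => tn.
by rewrite normal_prob_norm_lt// oppr_gt0.
Qed.

Lemma law_tail_cvg (P : forall N, config N -> R) (T : forall N, config N -> \bar R) mu M F :
  law_tail mu M F -> M = 1 -> (forall N (sigma : config N), 0 <= P N sigma) ->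
  (forall N, \sum_(sigma : config N) P N sigma = 1) ->
  (forall t, t != 0 ->
    (\sum_(sigma : config N) P N sigma * ((t%:E < T N sigma)%E)%:R) @[N --> \oo] --> F t) ->
  cvg_in_law P T mu.
Proof.
move=> [[nu <-] nuT nuF] M1 P0 P1 PT; rewrite M1 in nuT.
apply: cvg_in_law_of_tails => // t t0; rewrite nuF//; exact: PT.
Qed.

End laws.

(** * Tails of the estimation error *)

Section error_tail.
Context {R : realType}.
Implicit Types (beta h t s c v x y m : R) (p N k : nat) (ms : seq R).
Local Notation mu := (@lebesgue_measure R).

Lemma cvg_lt_near (a b : nat -> R) (l l' : R) : a N @[N --> \oo] --> l ->
  b N @[N --> \oo] --> l' -> l != l' ->
  \forall N \near \oo, (a N < b N) = (l < l').
Proof.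
move=> al bl; rewrite neq_lt => /orP[ll'|l'l].
  have d0 : 0 < (l' - l) / 2 by rewrite divr_gt0// subr_gt0.
  move/cvgrPdist_lt : al => /(_ _ d0) al; move/cvgrPdist_lt : bl => /(_ _ d0) bl.
  near=> N.
  have : `|l - a N| < (l' - l) / 2 by near: N.
  have : `|l' - b N| < (l' - l) / 2 by near: N.
  rewrite !ltr_norml ll' => /andP[? ?] /andP[? ?]; lra.
have d0 : 0 < (l - l') / 2 by rewrite divr_gt0// subr_gt0.
move/cvgrPdist_lt : al => /(_ _ d0) al; move/cvgrPdist_lt : bl => /(_ _ d0) bl.
near=> N.
have : `|l - a N| < (l - l') / 2 by near: N.
have : `|l' - b N| < (l - l') / 2 by near: N.
rewrite !ltr_norml (lt_gtF l'l) => /andP[? ?] /andP[? ?]; lra.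
Unshelve. all: by end_near. Qed.

(* Tilting [beta] by [t / sqrt N] is a change of measure by
   [expR (t * (sqrt N * (x ^+ p - s)))]; the constant [s] cancels. *)
Lemma cw_sum_tilt beta h p t s Hs (F : R -> R) N : (0 < N)%N ->
  \sum_(sigma : config N) cw_prob (beta + t / Num.sqrt N%:R) h p sigma * F (mag sigma) =
  Wsum beta h p Hs N (fun x => expR (t * (Num.sqrt N%:R * (x ^+ p - s))) * F x) /
  Wsum beta h p Hs N (fun x => expR (t * (Num.sqrt N%:R * (x ^+ p - s)))).
Proof.
move=> N0; rewrite (cw_sum beta h p _ F Hs N0).
have n0 : 0 < N%:R :> R by rewrite ltr0n.
have r0 : 0 < Num.sqrt N%:R :> R by rewrite sqrtr_gt0.
have NE : N%:R * (beta + t / Num.sqrt N%:R - beta) = t * Num.sqrt N%:R :> R.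
  rewrite -{1}[N%:R](@sqr_sqrtr R) ?ltW//; set r := Num.sqrt _ in r0 *.
  by field; rewrite gt_eqF.
pose K : R := expR (t * Num.sqrt N%:R * s).
have K0 : K != 0 by rewrite gt_eqF ?expR_gt0.
have E x : expR (N%:R * (beta + t / Num.sqrt N%:R - beta) * x ^+ p) =
    K * expR (t * (Num.sqrt N%:R * (x ^+ p - s))).
  by rewrite NE /K -expRD; congr expR; ring.
have WK (G : R -> R) : Wsum beta h p Hs N (fun x => K * G x) = K * Wsum beta h p Hs N G.
  by rewrite /Wsum mulr_sumr; apply: eq_bigr => i _; rewrite mulrCA.
under [X in Wsum _ _ _ _ _ X / _]eq_fun do rewrite E -mulrA.
under [X in _ / Wsum _ _ _ _ _ X]eq_fun do rewrite E.
by rewrite !WK invfM mulrACA divff ?mul1r.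
Qed.

Lemma mean_pow_tilt beta h p t s k Hs N : (0 < N)%N ->
  Num.sqrt N%:R ^+ k * (mean_pow (beta + t / Num.sqrt N%:R) h p N - s) =
  Wsum beta h p Hs N (fun x => expR (t * (Num.sqrt N%:R * (x ^+ p - s))) *
    (Num.sqrt N%:R ^+ k * (x ^+ p - s))) /
  Wsum beta h p Hs N (fun x => expR (t * (Num.sqrt N%:R * (x ^+ p - s)))).
Proof.
move=> N0; rewrite -(cw_sum_tilt beta h p t s Hs
  (fun x => Num.sqrt N%:R ^+ k * (x ^+ p - s)) N0).
under [RHS]eq_bigr do rewrite mulrCA mulrBr.
by rewrite -mulr_sumr sumrB -mulr_suml cw_prob_sum1 mul1r.
Qed.

(** The exponent [k] gives the scale on which [x ^ p] fluctuates about [s] near the selected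
    maximizers: [1] away from the origin and [p] at the origin. On this scale the fluctuation tends
    to [phi m y] and the tilted mean to [c]. Near the other maximizers [x ^ p] tends to [m ^ p],
    which differs from the limit [s] of the mean, so the comparison is decided without scaling. *)
Lemma cvg_error_tail beta h p ms t s c k (phi : R -> R -> R)
    (bhat : forall N, config N -> \bar R) :
  (0 < p)%N -> (0 < k)%N -> maximizers beta h p ms ->
  (forall N (sigma : config N), is_mle h p sigma (bhat N sigma)) ->
  (forall m, m \in ms -> m ^+ p = s \/ t * m ^+ p < t * s) ->
  (exists2 m, m \in ms & m ^+ p = s) ->
  (forall m, m \in ms -> m ^+ p = s -> exists A B, [/\ 0 <= A, 0 <= B &
     forall N x, (0 < N)%N -> -1 <= x <= 1 ->
       `|Num.sqrt N%:R ^+ k * (x ^+ p - s)| <= A * expR (B * (Num.sqrt N%:R * `|x - m|))]) ->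
  (forall m, m \in ms -> measurable_fun [set: R] (phi m)) ->
  (forall m, m \in ms -> m ^+ p = s -> forall y (x_ : nat -> R),
     Num.sqrt N%:R * (x_ N - m) @[N --> \oo] --> y ->
     Num.sqrt N%:R ^+ k * (x_ N ^+ p - s) @[N --> \oo] --> phi m y) ->
  (forall m, m \in ms -> m ^+ p = s ->
     gint (- ddH beta p m) (fun y => expR (t * (p%:R * m ^+ p.-1) * y) * phi m y) =
     c * gint (- ddH beta p m) (fun y => expR (t * (p%:R * m ^+ p.-1) * y))) ->
  (forall m, m \in ms -> m ^+ p = s -> {ae mu, forall y, phi m y != c}) ->
  (\sum_(sigma : config N) cw_prob beta h p sigma *
     ((t%:E < scaled_error beta bhat sigma)%E)%:R) @[N --> \oo] -->
  \sum_(m <- ms) max_weight beta h p ms m *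
    (if m ^+ p == s then
       fine (normal_prob 0 (Num.sqrt (- ddH beta p m)^-1) [set y | c < phi m y])
     else ((s < m ^+ p)%R)%:R).
Proof.
move=> p0 k0 hmax hmle sep exs bnd mphi phil phic phin.
have [m0 m0ms m0s] := exs.
have s1 : `|s| <= 1.
  have /andP[? ?] : -1 < m0 < 1 by apply: global_max_itv; apply/(max_mem hmax).
  by rewrite -m0s normrX exprn_ile1// ler_norml; apply/andP; split; lra.
pose u N := mean_pow (beta + t / Num.sqrt N%:R) h p N.
have cu : Num.sqrt N%:R ^+ k * (u N - s) @[N --> \oo] --> c.
  have GB N x : (0 < N)%N -> -1 <= x <= 1 ->
      `|Num.sqrt N%:R ^+ k * (x ^+ p - s)| <= 2 * Num.sqrt N%:R ^+ k.
    move=> _ x1; rewrite normrM [X in X * _]ger0_norm ?exprn_ge0// mulrC ler_wpM2r ?exprn_ge0//.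
    have : `|x ^+ p| <= 1 by rewrite normrX exprn_ile1// ler_norml.
    by have := ler_normB (x ^+ p) s; lra.
  have lim := @cvg_tilt_ratio R beta h p ms m0 t s
    (fun N x => Num.sqrt N%:R ^+ k * (x ^+ p - s)) phi k 2 c hmax m0ms sep exs
    (ler0n _ 2) GB bnd mphi (fun m mms e y z _ => @phil m mms e y z) phic.
  apply: (cvg_near lim) => //; near=> N.
  by rewrite -mean_pow_tilt//; near: N; exact: nbhs_infty_gt.
have us : u N @[N --> \oo] --> s.
  have lim : Num.sqrt N%:R ^+ k * (u N - s) * (2 / Num.sqrt N%:R) ^+ k / 2 ^+ k + s
      @[N --> \oo] --> c * 0 ^+ k / 2 ^+ k + s.
    apply: cvgD; last exact: cvg_cst.
    apply: cvgMl; apply: cvgM => //.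
    exact: (cvg_comp (fun N => 2 / Num.sqrt N%:R) (fun x => x ^+ k) (@cvg_sqrt_nat_inv R) (@exprn_continuous R k 0)).
  apply: (cvg_near lim); last by rewrite expr0n eqn0Ngt k0 mulr0 mul0r add0r.
  near=> N.
  have r0 : Num.sqrt N%:R != 0 :> R.
    by rewrite gt_eqF// sqrtr_gt0 ltr0n; near: N; exact: nbhs_infty_gt.
  rewrite exprMn exprVn; have rk : Num.sqrt N%:R ^+ k != 0 :> R by rewrite expf_neq0.
  have k2 : 2 ^+ k != 0 :> R by rewrite expf_neq0.
  by set rr := Num.sqrt _ ^+ k in rk *; set tt := 2 ^+ k in k2 *; field; rewrite rk k2.
pose E m : set R := if m ^+ p == s then [set y | c < phi m y] else [set y | s < m ^+ p].
have mE m : m \in ms -> measurable (E m).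
  move=> mms; rewrite /E; case: ifP => _.
    rewrite (_ : [set _ | _] = setT `&` phi m @^-1` `]c, +oo[%classic); first exact: mphi.
    by rewrite setTI; apply/seteqP; split => y /=; rewrite in_itv /= andbT.
  by have [h'|h'] := boolP (s < m ^+ p); [rewrite (_ : [set _ | _] = setT)|
    rewrite (_ : [set _ | _] = set0)] => //; apply/seteqP; split => // y; rewrite /= (negbTE h').
have := @cvg_Wsum_prob R beta h p ms m0 (fun N x => u N < x ^+ p) E hmax m0ms mE.
have memE (P : pred R) (z : R) : (z \in [set y | P y]) = P z.
  by apply/idP/idP; rewrite inE.
have FE : forall m, m \in ms -> {ae mu, forall y, forall x_ : nat -> R,
     (\forall N \near \oo, -1 <= x_ N <= 1) ->
     Num.sqrt N%:R * (x_ N - m) @[N --> \oo] --> y ->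
     \forall N \near \oo, (u N < x_ N ^+ p) = (y \in E m)}.
  move=> m mms; rewrite /E; case: ifPn => [/eqP mE'|mE'].
    have := phin m mms mE'; apply: (@filterS _ _ (ae_filter_ringOfSetsType mu)) => y yc x_ _ xy.
    rewrite (memE (fun y => c < phi m y)).
    have := cvg_lt_near cu (phil m mms mE' y x_ xy).
    rewrite eq_sym => /(_ yc) ltE; near=> N.
    have <- : (Num.sqrt N%:R ^+ k * (u N - s) < Num.sqrt N%:R ^+ k * (x_ N ^+ p - s)) =
        (c < phi m y) by near: N.
    rewrite ltr_pM2l ?ltrD2r// exprn_gt0// sqrtr_gt0 ltr0n.
    by near: N; exact: nbhs_infty_gt.
  apply: aeW => y x_ _ xy.
  rewrite (memE (fun=> s < m ^+ p)); apply: cvg_lt_near us _ _; last by rewrite eq_sym.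
  exact: (cvg_comp x_ (fun x => x ^+ p) (cvg_scaled xy) (@exprn_continuous R p m)).
move=> /(_ FE) lim; apply: (cvg_near lim).
  near=> N; have N2 : (2 <= N)%N by near: N; exact: nbhs_infty_ge.
  have N0 : (0 < N)%N by exact: leq_trans N2.
  under [RHS]eq_bigr do rewrite (scaled_error_gt _ _ p0 N2 (hmle N _)) -/(u N).
  rewrite (cw_sum beta h p beta (fun x => ((u N < x ^+ p)%R)%:R) (H beta h p m0) N0).
  by congr (Wsum _ _ _ _ _ _ / Wsum _ _ _ _ _ _); apply/funext => x;
    rewrite subrr mulr0 mul0r expR0 ?mul1r.
apply: eq_big_seq => m mms; congr (_ * _); rewrite /E; case: ifP => // _.
have [h'|h'] := boolP (s < m ^+ p).
  by rewrite (_ : [set _ | _] = setT) ?probability_setT//; apply/seteqP; split.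
by rewrite (_ : [set _ | _] = set0) ?measure0//; apply/seteqP; split.
Unshelve. all: by end_near. Qed.

End error_tail.

(** * Moments of the normal law *)

Section gaussian_moments.
Context {R : realType}.
Implicit Types (a c t x y : R) (n p k : nat).
Local Notation mu := (@lebesgue_measure R).

Lemma gintegrable_exprn a p : 0 < a -> gintegrable a (fun y => y ^+ p).
Proof.
move=> a0.
have [i1 _] := gint_exp 1 a0; have [i2 _] := gint_exp (- 1) a0.
have i12 := integrableD measurableT i1 i2.
have i3 := integrableZl measurableT (p%:R ^+ p) i12.
have key (y : R) : `|y ^+ p * expR (- (a / 2) * y ^+ 2)| <=
    `|p%:R ^+ p * (expR (1 * y) * expR (- (a / 2) * y ^+ 2) +
      expR (- 1 * y) * expR (- (a / 2) * y ^+ 2))|.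
  rewrite [leRHS]ger0_norm ?mulr_ge0 ?exprn_ge0 ?addr_ge0 ?mulr_ge0 ?expR_ge0//.
  rewrite -mulrDl mulrA normrM (ger0_norm (expR_ge0 (- (a / 2) * y ^+ 2))).
  apply: ler_wpM2r; first exact: expR_ge0.
  rewrite normrX; apply: le_trans (pow_le_exp p (normr_ge0 y)) _.
  apply: ler_wpM2l; first exact: exprn_ge0.
  rewrite mul1r mulN1r.
  by case: (ger0P y) => _; [rewrite lerDl|rewrite lerDr]; exact: expR_ge0.
apply: (le_integrable _ _ _ i3) => //; last first.
  by move=> y _; rewrite -EFinD -EFinM lee_fin; exact: key.
apply/measurable_EFinP; apply: measurable_funM; first exact: measurable_funX.
by apply: measurableT_comp => //; apply: measurable_funM => //; exact: measurable_funX.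
Qed.

Lemma gint_exprn_odd a p : 0 < a -> odd p -> gint a (fun y => y ^+ p) = 0.
Proof.
move=> a0 podd.
pose f y := y ^+ p * expR (- (a / 2) * y ^+ 2).
have fN y : f (- y) = - f y.
  by rewrite /f exprNn -signr_odd podd expr1 sqrrN mulN1r mulNr.
have cf : continuous f.
  move=> y; apply: cvgM; first exact: exprn_continuous.
  apply: (@cvg_comp _ _ _ (fun y => - (a / 2) * y ^+ 2) expR); last exact: continuous_expR.
  by apply: cvgM; [exact: cvg_cst|exact: exprn_continuous].
have ig := gintegrable_exprn p a0; rewrite /gintegrable in ig.
have split_ : [set: R] = `]-oo, (- 0)%R]%classic `|` `]0, +oo[%classic.
  by rewrite oppr0 -setCitvr setUCl.
rewrite /gint split_ Rintegral_setU//=; last 2 first.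
- by rewrite -split_.
- by apply/disj_setPS => z [] /=; rewrite !in_itv /= oppr0 andbT; lra.
rewrite [X in _ + X]Rintegral_itv_obnd_cbnd; last first.
  by apply: integrableS ig.
apply/eqP; rewrite addr_eq0; apply/eqP.
(* The sign makes the integrand nonnegative on the negative half-line, as the substitution rule
   requires. *)
have e : \int[mu]_(x in `]-oo, (- 0)%R]) (- 1 * f x) = - 1 * \int[mu]_(x in `]-oo, (- 0)%R]) f x.
  by rewrite RintegralZl//; apply: integrableS ig.
transitivity (- (- 1 * \int[mu]_(x in `]-oo, (- 0)%R]) f x)); first by rewrite mulN1r opprK.
rewrite -e; congr (- _); rewrite /Rintegral; congr fine.
rewrite (@ge0_integration_by_substitutionNy _ (fun y => - 1 * f y) 0).
- by apply: eq_integral => y _; rewrite /= fN mulN1r opprK.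
- by apply: continuous_subspaceT => y; apply: cvgMr; exact: cf.
- move=> y; rewrite in_itv /= oppr0 => y0; rewrite mulN1r -fN mulr_ge0 ?expR_ge0//.
  by rewrite exprn_ge0// oppr_ge0 ltW.
Qed.

(** [integral_normal_prob] presupposes this finiteness. It is therefore applied to the truncations
    of [|f|], which are bounded; their integrals have the common bound [K], and monotone convergence
    concludes. *)
Lemma normal_prob_moment_fin a (f : R -> R) : 0 < a ->
  measurable_fun [set: R] f -> gintegrable a f ->
  (\int[normal_prob 0 (Num.sqrt a^-1)]_y `|(f y)%:E| < +oo)%E.
Proof.
move=> a0 mf ig.
pose P : probability (measurableTypeR R) R := normal_prob 0 (Num.sqrt a^-1).
rewrite -[X in (X < _)%E]/(\int[P]_y `|(f y)%:E|)%E.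
pose g n y := Num.min `|f y| n%:R.
have g0 n y : 0 <= g n y by rewrite le_min normr_ge0/=.
have gn n y : g n y <= n%:R by rewrite ge_min lexx orbT.
have gf n y : g n y <= `|f y| by rewrite ge_min lexx.
have mg n : measurable_fun [set: R] (g n).
  by apply: measurable_minr => //; exact: measurableT_comp.
have igf : gintegrable a (fun y => `|f y|).
  apply: eq_integrable (integrable_abse ig) => // y _.
  by rewrite /= normrM [X in _ * X]ger0_norm// expR_ge0.
have igg n : gintegrable a (g n).
  apply: (le_integrable _ _ _ igf) => //.
    apply/measurable_EFinP; apply: measurable_funM; first exact: mg.
    by apply: measurableT_comp => //; apply: measurable_funM => //; exact: measurable_funX.
  move=> y _; rewrite lee_fin !normrM ler_wpM2r//.
  by rewrite normr_id ger0_norm.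
pose K := (gmass a)^-1 * gint a (fun y => `|f y|).
have gK n : (\int[P]_y (g n y)%:E <= K%:E)%E.
  rewrite integral_normal_prob//.
    rewrite lee_fin; apply: ler_wpM2l; first by rewrite invr_ge0 ltW// gmass_gt0.
    apply: le_Rintegral => //; first exact: igg.
    by move=> y _; rewrite ler_wpM2r ?expR_ge0.
  apply: (@le_lt_trans _ _ (\int[P]_y n%:R%:E)%E).
    apply: ge0_le_integral => //.
    - have h : measurable_fun [set: R] (fun y => `|g n y|) by apply: measurableT_comp (mg n).
      exact/measurable_EFinP.
    - by move=> y _; rewrite lee_fin ger0_norm.
  rewrite integral_cst//.
  rewrite (_ : (_ * _)%E = n%:R%:E) ?ltry// -[RHS]mule1; congr (_ * _)%E.
  exact: probability_setT.
have lim : (\int[P]_y (g n y)%:E)%E @[n --> \oo] --> (\int[P]_y limn (fun n => (g n y)%:E))%E.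
  apply: cvg_monotone_convergence => //.
  - move=> n; have h : measurable_fun [set: R] (fun y => (g n y)%:E).
      by apply/measurable_EFinP; exact: mg.
    exact: h.
  - by move=> n y _; rewrite lee_fin.
  - move=> y _ m n mn; rewrite lee_fin le_min !ge_min lexx/=.
    by rewrite ler_nat mn orbT.
have -> : (\int[P]_y `|(f y)%:E|)%E = (\int[P]_y limn (fun n => (g n y)%:E))%E.
  apply: eq_integral => y _; apply/esym/cvg_lim => //.
  apply: cvg_near_cst; near=> n; rewrite /g min_l//.
  by near: n; exact: nbhs_infty_ger.
apply: (@le_lt_trans _ _ K%:E); last exact: ltry.
rewrite -(cvg_lim _ lim)//; apply: lime_le; first by apply/cvg_ex; eexists; exact: lim.
by apply: nearW => n; exact: gK.
Unshelve. all: by end_near. Qed.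

Lemma ae_exprn_neq p c : (0 < p)%N -> {ae mu, forall y, y ^+ p != c}.
Proof.
move=> p0.
have [[y0 y0c]|no] := pselect (exists y, y ^+ p = c); last first.
  by apply: aeW => y; apply/eqP => yc; apply: no; exists y.
have cs : countable [set y0; - y0].
  by apply: finite_set_countable.
have neg : mu.-negligible [set y0; - y0].
  apply/negligibleP; first by apply: measurableU; exact: measurable_set1.
  exact: countable_lebesgue_measure0.
apply: negligibleS neg => y /= /negP; rewrite negbK => /eqP yc.
have : `|y| ^+ p == `|y0| ^+ p by rewrite -!normrX yc y0c.
rewrite eqrXn2// => /eqP; case: (ger0P y) => hy; case: (ger0P y0) => hy0 e; [left|right|right|left]; lra.
Qed.

End gaussian_moments.

Section tails_of_maximizers.
Context {R : realType}.
Implicit Types (beta h t s c v x y m : R) (p N k : nat) (ms : seq R).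
Local Notation mu := (@lebesgue_measure R).

Lemma asym_varE beta h p m : (0 < p)%N -> -1 < m < 1 ->
  asym_var beta h p m = ((p%:R * m ^+ p.-1) ^+ 2 / - ddH beta p m)^-1.
Proof.
case: p => // p _ m1; rewrite /asym_var H2E//.
have -> : (2 * p.+1 - 2 = p * 2)%N by lia.
by rewrite exprM exprMn invf_div /=; set d := ddH _ _ _; rewrite mulNr.
Qed.

Lemma slope_neq0 p m : (0 < p)%N -> m != 0 -> p%:R * m ^+ p.-1 != 0.
Proof. by move=> p0 m0; rewrite mulf_neq0 ?expf_neq0// pnatr_eq0 -lt0n. Qed.

Lemma asym_var_gt0 beta h p m : (0 < p)%N -> -1 < m < 1 -> m != 0 ->
  ddH beta p m < 0 -> 0 < asym_var beta h p m.
Proof.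
move=> p0 m1 m0 dm; rewrite asym_varE// invr_gt0 divr_gt0 ?oppr_gt0//.
by rewrite exprn_even_gt0// slope_neq0.
Qed.

Section with_mle.
Variables (beta h : R) (p : nat) (ms : seq R).
Variable bhat : forall N : nat, config N -> \bar R.
Hypothesis p2 : (2 < p)%N.
Hypothesis hmax : maximizers beta h p ms.
Hypothesis hmle : forall N (sigma : config N), is_mle h p sigma (bhat sigma).

Let p0 : (0 < p)%N. Proof. exact: ltn_trans p2. Qed.

Let itv m : m \in ms -> -1 < m < 1.
Proof. by move=> mms; apply: global_max_itv; apply/(max_mem hmax). Qed.

(** Here [phi m y = K m * y] on the scale [sqrt N]. The tilt by [t * K m] gives [y] the mean
    [t * K m / a], so [K m * y] has mean [t * K m ^ 2 / a = t / v], and a common [v] makes it the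
    same at all selected maximizers. *)
Lemma cvg_error_tail_slope t s v :
  (forall m, m \in ms -> m ^+ p = s \/ t * m ^+ p < t * s) ->
  (exists2 m, m \in ms & m ^+ p = s) -> s != 0 ->
  (forall m, m \in ms -> m ^+ p = s -> asym_var beta h p m = v) ->
  (\sum_(sigma : config N) cw_prob beta h p sigma *
     ((t%:E < scaled_error beta bhat sigma)%E)%:R) @[N --> \oo] -->
  \sum_(m <- ms) max_weight beta h p ms m *
    (if m ^+ p == s then tail (Num.sqrt v) t else ((s < m ^+ p)%R)%:R).
Proof.
move=> sep exs s0 hv.
pose K m := p%:R * m ^+ p.-1.
have K0 m : m ^+ p = s -> K m != 0.
  move=> mp; apply: slope_neq0 => //; apply/eqP => m0.
  by move: s0; rewrite -mp m0 expr0n eqn0Ngt p0 eqxx.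
have a0 m : m \in ms -> 0 < - ddH beta p m by rewrite oppr_gt0; exact: (max_ddH hmax).
have vE m : m \in ms -> m ^+ p = s -> K m ^+ 2 / - ddH beta p m = v^-1.
  by move=> mms mp; rewrite -(hv m mms mp) asym_varE ?itv// invrK.
have lim := @cvg_error_tail R beta h p ms t s (t * v^-1) 1 (fun m y => K m * y) bhat p0
  (ltn0Sn 0) hmax hmle sep exs.
have {lim} lim := lim _ _ _ _ _.
apply: (cvg_near (lim _ _ _ _ _)) => {lim}.
- move=> m mms mp; exists p%:R, 1; split => // N x _ x1.
  rewrite expr1 -mp normrM ger0_norm// mul1r.
  apply: (@le_trans _ _ (Num.sqrt N%:R * (p%:R * `|x - m|))).
    apply: ler_wpM2l => //; apply: exprn_lipschitz; first by rewrite ler_norml.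
    by have /andP[? ?] := itv mms; rewrite ler_norml; apply/andP; split; lra.
  rewrite mulrCA; apply: ler_wpM2l => //.
  have := expR_ge1Dx (Num.sqrt N%:R * `|x - m|); lra.
- by move=> m _; apply: measurable_funM.
- by move=> m _ mp y x_ xy; rewrite -mp; under eq_fun do rewrite expr1; exact: cvg_scaled_pow.
- move=> m mms mp; rewrite -(vE m mms mp).
  rewrite (_ : (fun y => _ * (K m * y)) = fun y => K m * (y * expR (t * K m * y))); last first.
    by apply/funext => y; rewrite mulrCA [expR _ * y]mulrC.
  rewrite gintZ ?gint_id_exp ?a0//; last first.
  - by apply: gintegrable_id_exp; exact: a0.
  - by apply: gintegrable_id_exp; exact: a0.
  by rewrite -/(K m); set G := gint _ _; set e := (- ddH beta p m)^-1; ring.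
- move=> m mms mp; have := ae_exprn_neq (t * v^-1 / K m) (ltn0Sn 0).
  apply: (@filterS _ _ (ae_filter_ringOfSetsType mu)) => y; rewrite expr1.
  by apply: contra => /eqP <-; rewrite mulrC mulrA mulVf ?mul1r// K0.
- exact: nearW.
- apply: eq_big_seq => m mms; case: (m ^+ p =P s) => [mp|_]; last exact: erefl.
  apply: (congr1 (fun r => _ * r)).
  by have := normal_prob_slope t (a0 m mms) (K0 m mp); rewrite (vE m mms mp) invrK.
Qed.

(** At the origin the slope [p * m ^ (p - 1)] vanishes, so the tilt disappears in the limit and with
    it [t]. Since [H''(0) = - 1], the scaled variable is standard normal and the threshold is its
    [p]-th moment. *)
Lemma cvg_error_tail_zero t : t < 0 -> 0 \in ms -> (forall m, m \in ms -> 0 <= m ^+ p) ->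
  (\sum_(sigma : config N) cw_prob beta h p sigma *
     ((t%:E < scaled_error beta bhat sigma)%E)%:R) @[N --> \oo] -->
  \sum_(m <- ms) max_weight beta h p ms m *
    (if m == 0 then fine (normal_prob 0 1
       [set y : R | (gmass 1)^-1 * gint 1 (fun z : R => z ^+ p) < y ^+ p]) else 1).
Proof.
move=> t0 z0 pos.
have z0p : 0 ^+ p = 0 :> R by rewrite expr0n eqn0Ngt p0.
have mp0 m : m ^+ p = 0 -> m = 0 by move/eqP; rewrite expf_eq0 => /andP[_ /eqP].
set c := (gmass 1)^-1 * _.
have sep m : m \in ms -> m ^+ p = 0 \/ t * m ^+ p < t * 0.
  move=> /pos; rewrite le_eqVlt => /orP[/eqP <-|mp]; [by left|right].
  by rewrite mulr0 nmulr_rlt0.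
have dd0 : - ddH beta p 0 = 1 by rewrite ddH00// opprK.
have lim := @cvg_error_tail R beta h p ms t 0 c p (fun m y => y ^+ p) bhat p0
  p0 hmax hmle sep.
have {lim} lim := lim _ _ _ _ _ _.
apply: (cvg_near (lim _ _ _ _ _ _)) => {lim}.
- by exists 0.
- move=> m mms /mp0 ->; exists (p%:R ^+ p), 1; split => // N x _ x1.
  rewrite !subr0 mul1r -exprMn normrX normrM ger0_norm//.
  by apply: pow_le_exp; rewrite mulr_ge0.
- by move=> m _; exact: measurable_funX.
- move=> m mms /mp0 -> y x_ xy; under eq_fun do rewrite subr0 -exprMn.
  under eq_fun do rewrite -[x_ _]subr0.
  exact: (cvg_comp (fun N => Num.sqrt N%:R * (x_ N - 0)) (fun x => x ^+ p) xy
    (@exprn_continuous R p y)).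
- move=> m mms /mp0 ->; rewrite dd0.
  have -> : t * (p%:R * 0 ^+ p.-1) = 0 :> R.
    by rewrite expr0n; case: (p) p2 => [|[|n]] //= _; rewrite !mulr0.
  rewrite (_ : (fun y => expR (0 * y) * y ^+ p) = fun y => y ^+ p); last first.
    by apply/funext => y; rewrite mul0r expR0 mul1r.
  rewrite (_ : (fun y => expR (0 * y)) = fun=> 1); last first.
    by apply/funext => y; rewrite mul0r expR0.
  by rewrite gint1// mulrAC mulVf ?mul1r// gt_eqF// gmass_gt0.
- by move=> m _ _; exact: ae_exprn_neq.
- exact: nearW.
- apply: eq_big_seq => m mms; congr (_ * _); rewrite expf_eq0 p0 /=.
  case: eqP => [->|/eqP m0]; first by rewrite dd0 invr1 sqrtr1.
  by rewrite lt_neqAle pos// andbT eq_sym expf_eq0 p0 /= m0.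
Qed.

End with_mle.

Lemma normal_prob_pow_odd p : odd p -> fine (normal_prob 0 1
  [set y : R | (gmass 1)^-1 * gint 1 (fun z : R => z ^+ p) < y ^+ p]) = 2^-1.
Proof.
move=> podd; rewrite gint_exprn_odd// mulr0 -(@tail0 R 1)//.
congr (fine (normal_prob _ _ _)); apply/seteqP; split => y; rewrite /= in_itv /= andbT.
  by rewrite exprn_odd_gt0.
by rewrite exprn_odd_gt0.
Qed.

Lemma normal_prob_pow_gamma p : fine (normal_prob 0 1
  [set y : R | (gmass 1)^-1 * gint 1 (fun z : R => z ^+ p) < y ^+ p]) = 1 - gamma_ p.
Proof.
set c := (gmass 1)^-1 * _.
have mX : measurable_fun [set: R] (fun z : R => z ^+ p) by exact: measurable_funX.
have s1 : Num.sqrt 1^-1 = 1 :> R by rewrite invr1 sqrtr1.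
have EE : ('E_(normal_prob 0 1)[fun z : R => (z ^+ p)%R])%E = c%:E.
  rewrite unlock -[in LHS]s1 integral_normal_prob//; first exact: gintegrable_exprn.
  by apply: normal_prob_moment_fin => //; exact: gintegrable_exprn.
rewrite /gamma_ EE.
have mA : measurable [set z : R | ((z ^+ p)%:E <= c%:E)%E].
  rewrite (_ : [set _ | _] = setT `&` (fun z : R => z ^+ p) @^-1` `]-oo, c]%classic).
    exact: mX.
  by rewrite setTI; apply/seteqP; split => y /=; rewrite in_itv /= lee_fin.
rewrite (_ : [set y | c < y ^+ p] = ~` [set z : R | ((z ^+ p)%:E <= c%:E)%E]).
  by rewrite normal_prob_setC.
by apply/seteqP; split => y /=; rewrite lee_fin ltNge => /negP.
Qed.

End tails_of_maximizers.

(** * The limit laws *)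

Section limit_laws.
Context {R : realType}.
Implicit Types (t x y m v : R).
Variables (beta h : R) (p : nat).
Variable bhat : forall N : nat, config N -> \bar R.
Hypothesis p2 : (2 < p)%N.
Hypothesis hmle : forall N (sigma : config N), is_mle h p sigma (bhat sigma).

Let p0 : (0 < p)%N. Proof. exact: ltn_trans p2. Qed.
Let wt := max_weight beta h p.
Let var := asym_var beta h p.
Let converges_to := cvg_in_law (fun N (sigma : config N) => cw_prob beta h p sigma)
  (fun N (sigma : config N) => scaled_error beta bhat sigma).
Let ptail t N := \sum_(sigma : config N) cw_prob beta h p sigma *
     ((t%:E < scaled_error beta bhat sigma)%E)%:R.

Lemma converges_to_law_tail mu M F : law_tail mu M F -> M = 1 ->
  (forall t, t != 0 -> ptail t N @[N --> \oo] --> F t) -> converges_to mu.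
Proof.
move=> muF M1 lim; apply: (law_tail_cvg muF M1) => //.
- by move=> N sigma; exact: cw_prob_ge0.
- by move=> N; exact: cw_prob_sum1.
Qed.

Lemma maximizers_var_gt0 ms m : maximizers beta h p ms -> m \in ms -> m != 0 -> 0 < var m.
Proof.
move=> hmax mms m0; apply: asym_var_gt0 => //; last exact: (max_ddH hmax).
by apply: global_max_itv; apply/(max_mem hmax).
Qed.

Lemma cvg_ptail_top ms hi t : maximizers beta h p ms -> hi \in ms -> hi != 0 -> 0 < t ->
  (forall m, m \in ms -> m != hi -> m ^+ p < hi ^+ p) ->
  ptail t N @[N --> \oo] --> wt ms hi * tail (Num.sqrt (var hi)) t.
Proof.
move=> hmax hims hi0 t0 lt_hi.
have sep m : m \in ms -> m ^+ p = hi ^+ p \/ t * m ^+ p < t * hi ^+ p.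
  move=> mms; have [->|mhi] := eqVneq m hi; [by left|right].
  by rewrite ltr_pM2l// lt_hi.
have eq_hi m : m \in ms -> m ^+ p = hi ^+ p -> m = hi.
  move=> mms e; apply/eqP; apply: contraT => mhi.
  by have := lt_hi m mms mhi; rewrite e ltxx.
apply: (cvg_near (cvg_error_tail_slope p2 hmax hmle sep _ _ _ (v := var hi))).
- by exists hi.
- by rewrite expf_neq0.
- by move=> m mms /(eq_hi m mms) ->.
- exact: nearW.
rewrite (bigD1_seq hi) ?(max_uniq hmax)//= eqxx big_seq_cond big1 ?addr0//.
move=> m /andP[mms mhi]; have := lt_hi m mms mhi => lt.
by rewrite lt_eqF// ltNge ltW// mulr0.
Qed.

Lemma cvg_ptail_bottom lo hi ms t : perm_eq ms [:: lo; hi] -> maximizers beta h p ms ->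
  lo != 0 -> lo ^+ p < hi ^+ p -> t < 0 ->
  ptail t N @[N --> \oo] --> wt ms lo * tail (Num.sqrt (var lo)) t + wt ms hi.
Proof.
move=> pms hmax lo0 lohi t0.
have mE m : m \in ms -> m = lo \/ m = hi.
  by rewrite (perm_mem pms) !inE => /orP[/eqP|/eqP]; [left|right].
have loms : lo \in ms by rewrite (perm_mem pms) !inE eqxx.
have sep m : m \in ms -> m ^+ p = lo ^+ p \/ t * m ^+ p < t * lo ^+ p.
  by move=> /mE[->|->]; [left|right; rewrite ltr_nM2l].
apply: (cvg_near (cvg_error_tail_slope p2 hmax hmle sep _ _ _ (v := var lo))).
- by exists lo.
- by rewrite expf_neq0.
- move=> m mms e; have [->//|mhi] := mE m mms.
  by rewrite -mhi e ltxx in lohi.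
- exact: nearW.
rewrite (perm_big _ pms) /= big_cons big_seq1 -/wt eqxx (gt_eqF lohi) lohi.
by move: (wt ms lo) (wt ms hi) (tail _ _) => A B T; rewrite mulr1.
Qed.

Lemma weight_pair lo hi ms : perm_eq ms [:: lo; hi] -> maximizers beta h p ms ->
  wt ms hi = 1 - wt ms lo.
Proof.
move=> pms hmax; have := max_weight_sum hmax.
by rewrite (perm_big _ pms) /= big_cons big_seq1 -/wt => <-; rewrite addrAC subrr add0r.
Qed.

Lemma weight_le1 m ms : maximizers beta h p ms -> m \in ms -> wt ms m <= 1.
Proof.
move=> hmax mms; rewrite -(max_weight_sum hmax) (bigD1_seq m) ?(max_uniq hmax)//=.
by rewrite lerDl sumr_ge0// => i _; exact: max_weight_ge0.
Qed.

(** The maximizers are ordered by their [p]-th powers, which serves both signs of [h]. Downward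
    fluctuations near [hi] are below the mean for [t > 0] but above it for [t < 0], where [lo] is
    selected, and symmetrically for upward fluctuations near [lo]; these two halves form the atom at
    [0]. *)
Lemma two_point_cvg lo hi ms : perm_eq ms [:: lo; hi] -> maximizers beta h p ms ->
  lo != 0 -> hi != 0 -> lo ^+ p < hi ^+ p ->
  forall t, t != 0 -> ptail t N @[N --> \oo] -->
    (1 - wt ms lo) / 2 * (if 0 < t then 2 * tail (Num.sqrt (var hi)) t else 1) +
    (wt ms lo / 2 * (if 0 < t then 0 else 1 - 2 * tail (Num.sqrt (var lo)) (- t)) +
    2^-1 * ((t%:E < 0%:E)%E)%:R).
Proof.
move=> pms hmax lo0 hi0 lohi t t0.
have loms : lo \in ms by rewrite (perm_mem pms) !inE eqxx.
have hims : hi \in ms by rewrite (perm_mem pms) !inE eqxx orbT.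
move: t0; rewrite neq_lt => /orP[t0|t0].
  rewrite (lt_gtF t0) lte_fin t0 tailN; last first.
    by rewrite gt_eqF// sqrtr_gt0; exact: maximizers_var_gt0 loms lo0.
  apply: (cvg_near (cvg_ptail_bottom pms hmax lo0 lohi t0)); first exact: nearW.
  by rewrite (weight_pair pms hmax) -[true%:R]/(1 : R); set T := tail _ _; field.
rewrite t0 lte_fin (lt_gtF t0).
apply: (cvg_near (cvg_ptail_top hmax hims hi0 t0 _)); [|exact: nearW|].
  move=> m; rewrite (perm_mem pms) !inE => /orP[/eqP ->//|/eqP ->].
  by rewrite eqxx.
by rewrite (weight_pair pms hmax) -[false%:R]/(0 : R); set T := tail _ _; field.
Qed.

Lemma law_two_increasing m1 m2 : maximizers beta h p [:: m1; m2] ->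
  m1 != 0 -> m2 != 0 -> m1 ^+ p < m2 ^+ p ->
  converges_to (mixture
    [:: (wt [:: m1; m2] m1 / 2, gauss_minus (var m1));
        ((1 - wt [:: m1; m2] m1) / 2, gauss_plus (var m2));
        (2^-1, \d_ (0%:E) : set (\bar R) -> \bar R)]).
Proof.
move=> hmax m10 m20 m12.
have i1 : m1 \in [:: m1; m2] by rewrite !inE eqxx.
have i2 : m2 \in [:: m1; m2] by rewrite !inE eqxx orbT.
have w0 : 0 <= wt [:: m1; m2] m1 by exact: max_weight_ge0.
have w1 := weight_le1 hmax i1.
have v1 := maximizers_var_gt0 hmax i1 m10.
have v2 := maximizers_var_gt0 hmax i2 m20.
apply: (converges_to_law_tail
  (law_tail_mixture_cons _ (law_tail_gauss_minus v1)
  (law_tail_mixture_cons _ (law_tail_gauss_plus v2)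
  (law_tail_mixture_cons _ (law_tail_dirac 0%:E) law_tail_mixture0)))).
- by rewrite divr_ge0.
- by rewrite divr_ge0// subr_ge0.
- by rewrite invr_ge0.
- by field.
move=> t t0; apply: (cvg_near (two_point_cvg (perm_refl _) hmax m10 m20 m12 t0)).
  exact: nearW.
by rewrite addr0 addrCA.
Qed.

Lemma law_two_decreasing m1 m2 : maximizers beta h p [:: m1; m2] ->
  m1 != 0 -> m2 != 0 -> m2 ^+ p < m1 ^+ p ->
  converges_to (mixture
    [:: (wt [:: m1; m2] m1 / 2, gauss_plus (var m1));
        ((1 - wt [:: m1; m2] m1) / 2, gauss_minus (var m2));
        (2^-1, \d_ (0%:E) : set (\bar R) -> \bar R)]).
Proof.
move=> hmax m10 m20 m12.
have i1 : m1 \in [:: m1; m2] by rewrite !inE eqxx.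
have i2 : m2 \in [:: m1; m2] by rewrite !inE eqxx orbT.
have w0 : 0 <= wt [:: m1; m2] m1 by exact: max_weight_ge0.
have w1 := weight_le1 hmax i1.
have v1 := maximizers_var_gt0 hmax i1 m10.
have v2 := maximizers_var_gt0 hmax i2 m20.
apply: (converges_to_law_tail
  (law_tail_mixture_cons _ (law_tail_gauss_plus v1)
  (law_tail_mixture_cons _ (law_tail_gauss_minus v2)
  (law_tail_mixture_cons _ (law_tail_dirac 0%:E) law_tail_mixture0)))).
- by rewrite divr_ge0.
- by rewrite divr_ge0// subr_ge0.
- by rewrite invr_ge0.
- by field.
have pms : perm_eq [:: m1; m2] [:: m2; m1] by rewrite (perm_catC [:: m1] [:: m2]).
move=> t t0; apply: (cvg_near (two_point_cvg pms hmax m20 m10 m12 t0)).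
  exact: nearW.
by rewrite (weight_pair (perm_refl _) hmax) subKr addr0.
Qed.

(** The odd moment is [0], so the sign of the fluctuation splits the weight of the origin equally
    between [-oo] and [0]. *)
Lemma law_zero_odd b : odd p -> 0 < b -> maximizers beta h p [:: 0; b] ->
  converges_to (mixture
    [:: (wt [:: 0; b] 0 / 2, \d_ (-oo%E) : set (\bar R) -> \bar R);
        ((1 - wt [:: 0; b] 0) / 2, gauss_plus (var b));
        (2^-1, \d_ (0%:E) : set (\bar R) -> \bar R)]).
Proof.
move=> podd b0 hmax.
have i1 : 0 \in [:: 0; b] by rewrite !inE eqxx.
have i2 : b \in [:: 0; b] by rewrite !inE eqxx orbT.
have w0 : 0 <= wt [:: 0; b] 0 by exact: max_weight_ge0.
have w1 := weight_le1 hmax i1.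
have bn0 : b != 0 by rewrite gt_eqF.
have v2 := maximizers_var_gt0 hmax i2 bn0.
have wb := weight_pair (perm_refl _) hmax.
apply: (converges_to_law_tail
  (law_tail_mixture_cons _ (law_tail_dirac -oo%E)
  (law_tail_mixture_cons _ (law_tail_gauss_plus v2)
  (law_tail_mixture_cons _ (law_tail_dirac 0%:E) law_tail_mixture0)))).
- by rewrite divr_ge0.
- by rewrite divr_ge0// subr_ge0.
- by rewrite invr_ge0.
- by field.
have z0 : 0 ^+ p = 0 :> R by rewrite expr0n eqn0Ngt p0.
have bp : 0 < b ^+ p by rewrite exprn_gt0.
move=> t; rewrite neq_lt => /orP[t0|t0].
  apply: (cvg_near (cvg_error_tail_zero p2 hmax hmle t0 i1 _)); [|exact: nearW|].
    by move=> m; rewrite !inE => /orP[/eqP ->|/eqP ->]; rewrite ?z0// ltW.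
  rewrite big_cons big_seq1 eqxx (negbTE bn0) normal_prob_pow_odd// -/wt wb.
  by rewrite (lt_gtF t0) lte_fin t0 ltNge leNye -[true%:R]/(1 : R) /=; field.
apply: (cvg_near (cvg_ptail_top hmax i2 bn0 t0 _)); [|exact: nearW|].
  by move=> m; rewrite !inE => /orP[/eqP -> _|/eqP ->]; rewrite ?z0// eqxx.
rewrite wb t0 lte_fin (lt_gtF t0) ltNge leNye /=.
by rewrite -[false%:R]/(0 : R); set T := tail _ _; field.
Qed.

Lemma curv_sym m : ~~ odd p -> -1 < m < 1 -> curv beta h p (- m) = curv beta h p m.
Proof.
move=> podd m1; have m1' : -1 < - m < 1 by move: m1 => /andP[? ?]; apply/andP; split; lra.
by rewrite /curv !H2E// ddHN// sqrrN.
Qed.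

Lemma asym_var_sym m : ~~ odd p -> -1 < m < 1 -> var (- m) = var m.
Proof.
move=> podd m1; have m1' : -1 < - m < 1 by move: m1 => /andP[? ?]; apply/andP; split; lra.
rewrite /var !asym_varE// ddHN// !exprMn -!exprM.
rewrite [in LHS]exprNn -signr_odd oddM andbF expr0 mul1r//.
Qed.

Lemma weight_sym ms m : ~~ odd p -> -1 < m < 1 -> wt ms (- m) = wt ms m.
Proof. by move=> podd m1; rewrite /wt /max_weight curv_sym. Qed.

Lemma exprnN_even m : ~~ odd p -> (- m) ^+ p = m ^+ p.
Proof. by move=> podd; rewrite exprNn -signr_odd (negbTE podd) expr0 mul1r. Qed.

(** Both maximizers have the same [p]-th power and variance, so both are selected for every [t], and
    no atom appears. *)
Lemma law_symmetric m : ~~ odd p -> 0 < m -> maximizers beta h p [:: - m; m] ->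
  converges_to (gauss (var m)).
Proof.
move=> podd m0 hmax.
have i2 : m \in [:: - m; m] by rewrite !inE eqxx orbT.
have m1 : -1 < m < 1 by apply: global_max_itv; apply/(max_mem hmax).
apply: (converges_to_law_tail (law_tail_gauss _)) => // t _.
have mE x : x \in [:: - m; m] -> x ^+ p = m ^+ p.
  by rewrite !inE => /orP[/eqP ->|/eqP ->] //; exact: exprnN_even.
have sep x : x \in [:: - m; m] -> x ^+ p = m ^+ p \/ t * x ^+ p < t * m ^+ p.
  by move=> /mE; left.
apply: (cvg_near (cvg_error_tail_slope p2 hmax hmle sep _ _ _ (v := var m))).
- by exists m.
- by rewrite expf_neq0// gt_eqF.
- by move=> x; rewrite !inE => /orP[/eqP ->|/eqP ->] _ //; exact: asym_var_sym.
- exact: nearW.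
rewrite big_cons big_seq1 exprnN_even// eqxx -mulrDl.
by have := max_weight_sum hmax; rewrite big_cons big_seq1 => ->; rewrite mul1r.
Qed.

(** For [t > 0] the points [- m] and [m] are selected together; their contribution, twice [p_1]
    times a normal tail, is [p_1] times the tail of the half-normal law. *)
Lemma law_symmetric_zero m : ~~ odd p -> 0 < m -> maximizers beta h p [:: - m; 0; m] ->
  converges_to (mixture
    [:: (wt [:: - m; 0; m] 0 * gamma_ p, \d_ (-oo%E) : set (\bar R) -> \bar R);
        (wt [:: - m; 0; m] (- m), gauss_plus (var m));
        (1 - wt [:: - m; 0; m] (- m) - wt [:: - m; 0; m] 0 * gamma_ p,
           \d_ (0%:E) : set (\bar R) -> \bar R)]).
Proof.
move=> podd m0 hmax; set ms := [:: - m; 0; m] in hmax *.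
have i0 : 0 \in ms by rewrite !inE eqxx orbT.
have i2 : m \in ms by rewrite !inE eqxx !orbT.
have m1 : -1 < m < 1 by apply: global_max_itv; apply/(max_mem hmax).
have mn0 : m != 0 by rewrite gt_eqF.
have v2 := maximizers_var_gt0 hmax i2 mn0.
have w0 x : 0 <= wt ms x by exact: max_weight_ge0.
have wS : wt ms (- m) + (wt ms 0 + wt ms (- m)) = 1.
  rewrite {2}weight_sym// -(max_weight_sum hmax) /ms.
  by rewrite big_cons big_cons big_seq1.
have g0 : 0 <= gamma_ p :> R by exact: fine_ge0.
have g1 : gamma_ p <= 1 :> R.
  rewrite -subr_ge0 -normal_prob_pow_gamma; exact: fine_ge0.
have wg : wt ms 0 * gamma_ p <= wt ms 0 by rewrite ler_piMr.
apply: (converges_to_law_tail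
  (law_tail_mixture_cons _ (law_tail_dirac -oo%E)
  (law_tail_mixture_cons _ (law_tail_gauss_plus v2)
  (law_tail_mixture_cons _ (law_tail_dirac 0%:E) law_tail_mixture0)))).
- by rewrite mulr_ge0.
- exact: w0.
- by move: wS wg (w0 (- m)); move: (wt ms (- m)) (wt ms 0 * gamma_ p) (wt ms 0) => A B C; lra.
- by move: (wt ms (- m)) (wt ms 0) (gamma_ p) => A B C; ring.
have z0 : 0 ^+ p = 0 :> R by rewrite expr0n eqn0Ngt p0.
have mp : 0 < m ^+ p by rewrite exprn_gt0.
move=> t; rewrite neq_lt => /orP[t0|t0].
  apply: (cvg_near (cvg_error_tail_zero p2 hmax hmle t0 i0 _)); [|exact: nearW|].
    by move=> x _; rewrite exprn_even_ge0.
  rewrite !big_cons big_nil oppr_eq0 eqxx (negbTE mn0) normal_prob_pow_gamma// -/wt.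
  rewrite -[X in _ + (_ + (X * _ + _))]weight_sym//.
  rewrite (lt_gtF t0) lte_fin t0 ltNge leNye -[true%:R]/(1 : R) /=.
  move: wS; move: (wt ms (- m)) (wt ms 0) (gamma_ p) => A B C AB.
  have -> : B = 1 - 2 * A by lra.
  by ring.
have vE : var (- m) = var m by exact: asym_var_sym.
have sep x : x \in ms -> x ^+ p = m ^+ p \/ t * x ^+ p < t * m ^+ p.
  rewrite !inE => /or3P[/eqP ->|/eqP ->|/eqP ->]; last by left.
    by left; exact: exprnN_even.
  by right; rewrite z0 ltr_pM2l.
apply: (cvg_near (cvg_error_tail_slope p2 hmax hmle sep _ _ _ (v := var m))).
- by exists m.
- by rewrite expf_neq0.
- move=> x; rewrite !inE => /or3P[/eqP ->|/eqP ->|/eqP ->] // e.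
  by move: mp; rewrite -e z0 ltxx.
- exact: nearW.
rewrite !big_cons big_nil exprnN_even// eqxx z0 lt_eqF// (lt_gtF mp) -/wt.
rewrite -[X in _ + (_ + (X * _ + _))]weight_sym// t0 lte_fin (lt_gtF t0) ltNge leNye /=.
rewrite -[false%:R]/(0 : R); set T := tail _ _.
by move: (wt ms (- m)) (wt ms 0) (gamma_ p) T => A B C T; ring.
Qed.

End limit_laws.

Lemma exprn_odd_lt (R : realDomainType) (p : nat) (x y : R) : odd p -> x < y ->
  x ^+ p < y ^+ p.
Proof.
move=> podd xy; have pn0 : p != 0%N by case: (p) podd.
have pos a b : 0 <= a -> a < b -> a ^+ p < b ^+ p :> R.
  by move=> a0 ab; rewrite ltrXn2r// nnegrE// (le_trans a0) ?ltW.
have [x0|x0] := leP 0 x; first exact: pos.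
have [y0|y0] := leP y 0; last first.
  by apply: (@lt_trans _ _ 0); [rewrite exprn_odd_lt0|rewrite exprn_odd_gt0].
have powN z : - z ^+ p = (- z) ^+ p by rewrite exprNn -signr_odd podd expr1 mulN1r.
by rewrite -ltrN2 !powN; apply: pos; rewrite ?oppr_ge0 ?ltrN2.
Qed.

Lemma maximizers_pair (R : realType) (beta h : R) (p : nat) (a b : R) :
  a < b -> (forall x, is_global_max beta h p x <-> x = a \/ x = b) ->
  ddH beta p a < 0 -> ddH beta p b < 0 -> maximizers beta h p [:: a; b].
Proof.
move=> ab iff da db; split => //.
- by rewrite /= inE lt_eqF.
- move=> x; rewrite iff !inE; split => [/orP[/eqP|/eqP]|[->|->]]; rewrite ?eqxx ?orbT//.
    by left.
  by right.
- by move=> m; rewrite !inE => /orP[/eqP ->|/eqP ->].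
Qed.

Lemma global_max_zero (R : realType) (beta h : R) (p : nat) : (2 < p)%N ->
  is_global_max beta h p 0 -> h = 0.
Proof. by move=> p2 /global_max_dH; rewrite dH0h. Qed.

Theorem theorem2p6 (R : realType) (p : nat) (hp : (3 <= p)%N) (beta h : R)
    (beta_ge0 : 0 <= beta) (hcrit : p_critical beta h p)
    (bhat : forall N : nat, config N -> \bar R)
    (bhat_mle : forall (N : nat) (sigma : config N),
      is_mle h p sigma (bhat N sigma)) :
  let wt := max_weight beta h p in
  let var := asym_var beta h p in
  let converges_to := fun mu : set (\bar R) -> \bar R =>
    cvg_in_law (fun N (sigma : config N) => cw_prob beta h p sigma)
      (fun N (sigma : config N) => scaled_error beta bhat sigma) mu in
  exists ms : seq R,
    [/\ sorted <%R ms,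
        forall x : R, x \in ms <-> is_global_max beta h p x,
        size ms = 2%N \/ size ms = 3%N,
        odd p ->
          exists m1 m2 : R,
            [/\ ms = [:: m1; m2],
                (beta, h) <> (beta_tilde p, 0) ->
                  converges_to (mixture
                    [:: (wt ms m1 / 2, gauss_minus (var m1));
                        ((1 - wt ms m1) / 2, gauss_plus (var m2));
                        (2^-1, \d_ (0%:E) : set (\bar R) -> \bar R)])
              & (beta, h) = (beta_tilde p, 0) ->
                  converges_to (mixture
                    [:: (wt ms m1 / 2, \d_ (-oo%E) : set (\bar R) -> \bar R);
                        ((1 - wt ms m1) / 2, gauss_plus (var m2));
                        (2^-1, \d_ (0%:E) : set (\bar R) -> \bar R)])]
      & ~~ odd p ->
          [/\ 0 < h ->
                exists m1 m2 : R, ms = [:: m1; m2] /\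
                  converges_to (mixture
                    [:: (wt ms m1 / 2, gauss_minus (var m1));
                        ((1 - wt ms m1) / 2, gauss_plus (var m2));
                        (2^-1, \d_ (0%:E) : set (\bar R) -> \bar R)]),
              h < 0 ->
                exists m1 m2 : R, ms = [:: m1; m2] /\
                  converges_to (mixture
                    [:: (wt ms m1 / 2, gauss_plus (var m1));
                        ((1 - wt ms m1) / 2, gauss_minus (var m2));
                        (2^-1, \d_ (0%:E) : set (\bar R) -> \bar R)]),
              h = 0 -> beta_tilde p < beta ->
                exists m : R,
                  [/\ 0 < m, ms = [:: - m; m] & converges_to (gauss (var m))]
            & h = 0 -> beta = beta_tilde p ->
                exists m : R,
                  [/\ 0 < m, ms = [:: - m; 0; m] &
                    converges_to (mixture
                      [:: (wt ms 0 * gamma_ p,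
                             \d_ (-oo%E) : set (\bar R) -> \bar R);
                          (wt ms (- m), gauss_plus (var m));
                          (1 - wt ms (- m) - wt ms 0 * gamma_ p,
                             \d_ (0%:E) : set (\bar R) -> \bar R)])]]].
Proof.
move=> wt var converges_to.
have p0 : (0 < p)%N by exact: ltn_trans hp.
have [podd|podd] := boolP (odd p).
  have [bt|bt] := pselect ((beta, h) = (beta_tilde p, 0)).
    have h0 : h = 0 by case: bt.
    have crit0 : p_critical beta 0 p by rewrite -h0.
    have [b [b0 iff db]] := crit_odd_zero hp podd beta_ge0 crit0.
    rewrite -{1}h0 in iff.
    have hmax : maximizers beta h p [:: 0; b].
      by apply: maximizers_pair => //; rewrite ddH00// ltrN10.
    exists [:: 0; b]; split => //.
    - by rewrite /= b0.
    - exact: (max_mem hmax).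
    - by left.
    move=> _; exists 0, b; split => // _.
    exact: law_zero_odd.
  have [|a [b [ab iff da db]]] := crit_one_sided hp beta_ge0 hcrit.
    by move=> x _; rewrite /one_sided podd.
  have hmax := maximizers_pair ab iff da db.
  (* A maximizer at [0] would force [h = 0] and [beta = beta_tilde p], the case already treated. *)
  have nz x : is_global_max beta h p x -> x != 0.
    move=> hx; apply/eqP => x0; rewrite x0 in hx.
    have h0 := global_max_zero hp hx; rewrite h0 in hx hcrit.
    have [c [c0 iffc _]] := crit_odd_zero hp podd beta_ge0 hcrit.
    apply: bt; rewrite h0; congr pair.
    by apply: (beta_tilde_eq p0 beta_ge0 c0 hx); apply/iffc; right.
  have a0 : a != 0 by apply/nz/iff; left.
  have b0 : b != 0 by apply/nz/iff; right.
  exists [:: a; b]; split => //.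
  - by rewrite /= ab.
  - exact: (max_mem hmax).
  - by left.
  move=> _; exists a, b; split => // _.
  by apply: law_two_increasing => //; exact: exprn_odd_lt.
have [h0|[h0|h0]] : h < 0 \/ 0 < h \/ h = 0.
  by case: (ltgtP h 0) => ?; [left|right; left|right; right].
- have [a [b [ab b0 iff da db]]] := crit_even_neg hp podd beta_ge0 h0 hcrit.
  have hmax := maximizers_pair ab iff da db.
  exists [:: a; b]; split => //.
  + by rewrite /= ab.
  + exact: (max_mem hmax).
  + by left.
  move=> _; split=> [h0'|_|h0'|h0'].
  + by rewrite (lt_gtF h0) in h0'.
  + exists a, b; split => //.
    apply: law_two_decreasing => //; rewrite ?lt_eqF//.
      exact: lt_trans b0.
    rewrite -(exprnN_even _ podd) -(exprnN_even a podd).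
    by rewrite ltrXn2r ?gtn_eqF// ?nnegrE ?oppr_ge0 ?ltrN2// ltW// (lt_trans ab).
  + by rewrite h0' ltxx in h0.
  + by rewrite h0' ltxx in h0.
- have [a [b [ab a0 iff da db]]] := crit_even_pos hp podd beta_ge0 h0 hcrit.
  have hmax := maximizers_pair ab iff da db.
  exists [:: a; b]; split => //.
  + by rewrite /= ab.
  + exact: (max_mem hmax).
  + by left.
  move=> _; split=> [_|h0'|h0'|h0'].
  + exists a, b; split => //.
    apply: law_two_increasing => //; rewrite ?gt_eqF//.
      exact: lt_trans ab.
    by rewrite ltrXn2r ?gtn_eqF// ?nnegrE ltW// (lt_trans _ ab).
  + by rewrite (lt_gtF h0) in h0'.
  + by rewrite h0' ltxx in h0.
  + by rewrite h0' ltxx in h0.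
have crit0 : p_critical beta 0 p by rewrite -h0.
have [m [m0 hm hNm hall dm]] := crit_even_zero hp podd beta_ge0 crit0.
rewrite -{1}h0 in hm; rewrite -{1}h0 in hNm.
have dNm : ddH beta p (- m) < 0 by rewrite ddHN.
have Nm0 : - m < 0 by rewrite oppr_lt0.
have [gm0|gm0] := pselect (is_global_max beta 0 p 0).
  have hmax : maximizers beta h p [:: - m; 0; m].
    split => //.
    - by rewrite /= !inE negb_or !lt_eqF// (lt_trans Nm0).
    - move=> x; rewrite h0 !inE; split.
        by move=> /or3P[/eqP ->|/eqP ->|/eqP ->] //; rewrite -h0.
      by move=> /hall[->|[->|->]]; rewrite eqxx ?orbT.
    - by move=> x; rewrite !inE => /or3P[/eqP ->|/eqP ->|/eqP ->] //; rewrite ddH00// ltrN10.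
  have bt : beta = beta_tilde p.
    by apply: (beta_tilde_eq p0 beta_ge0 m0 gm0); rewrite -h0.
  exists [:: - m; 0; m]; split => //.
  - by rewrite /= Nm0 m0.
  - exact: (max_mem hmax).
  - by right.
  move=> _; split=> [h0'|h0'|_ lt|_ _].
  - by rewrite h0 ltxx in h0'.
  - by rewrite h0 ltxx in h0'.
  - by rewrite -bt ltxx in lt.
  by exists m; split => //; exact: law_symmetric_zero.
have hmax : maximizers beta h p [:: - m; m].
  apply: maximizers_pair => //; first exact: lt_trans m0.
  move=> x; split=> [|[->|->] //].
  by rewrite h0 => hx; case: (hall x hx) => [x0|[->|->]]; [rewrite x0 in hx|right|left].
exists [:: - m; m]; split => //.
- by rewrite /= (lt_trans Nm0).
- exact: (max_mem hmax).
- by left.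
move=> _; split=> [h0'|h0'|_ _|_ bt].
- by rewrite h0 ltxx in h0'.
- by rewrite h0 ltxx in h0'.
- by exists m; split => //; exact: law_symmetric.
(* At [beta = beta_tilde p] the origin is a maximizer, so this case is void. *)
by case: gm0; rewrite bt; exact: beta_tilde_max0.
Qed.
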